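(* Let $(B,\|\cdot\|)$ be a separable Banach space. The following three statements are equivalent: (i) $B$ is cotype 2. (ii) There is a constant $c\in(0,\infty)$ such that for all non-degenerate $B$-valued random variables $X$ and all $r>0$, $$E T_r\le \frac{c}{h(r)}.$$ (iii) There is a constant $c\in(0,\infty)$ such that for all non-degenerate $B$-valued random variables $X$, all $r>0$ and all integers $n\ge 1$, $$P(T_r> n)\le \frac{c}{n\,h(r)}.$$ Moreover, the constants appearing in the three equivalent statements may be taken to depend only on each other.
   Context: For a $B$-valued random variable $X$ let $X_1,X_2,\dots$ be independent copies of $X$, $S_n=\sum_{j=1}^n X_j$, and for $r>0$ let $T_r=\min\{n\ge 1:\|S_n\|>r\}$. Non-degenerate means not almost surely constant. Write $E(Y;A)=E(Y\mathbf 1_A)$ (Bochner expectation when $Y$ is $B$-valued). For $r>0$ define $$G(r)=P(\|X\|>r),\quad K(r)=r^{-2}E(\|X\|^2;\|X\|\le r),\quad M(r)=r^{-1}E(X;\|X\|\le r),$$ $$h(r)=G(r)+K(r)+\|M(r)\|.$$ Both $T_r$ and $h$ depend on (the distribution of) $X$; the constants $c$ in the statements do not depend on $X$, $r$ or $n$. $B$ is cotype 2 if there is a constant $c\in(0,\infty)$ such that for every $n\ge1$ and every sequence of independent $B$-valued random variables $X_1,\dots,X_n$ with $EX_i=0$ and $E\|X_i\|^2<\infty$ for $1\le i\le n$, $$E\Big\|\sum_{i=1}^n X_i\Big\|^2\ge c\sum_{i=1}^n E\|X_i\|^2;$$ any such $c$ is called a cotype 2 constant for $B$, and it is the constant associated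 with the statement ''$B$ is cotype 2''. ''The constants may be taken to depend only on each other'' means: if one of the statements holds with constant $c$, then each other statement holds with a constant that is determined by $c$ alone. *)

(* Defs.v *)
From HB Require Import structures.
From mathcomp Require Export all_boot all_order all_algebra finmap.
From mathcomp Require Export all_classical all_reals all_analysis.
Export Order.TTheory GRing.Theory Num.Theory numFieldNormedType.Exports.

Set Implicit Arguments.
Unset Strict Implicit.
Unset Printing Implicit Defensive.

Local Open Scope classical_set_scope.
Local Open Scope ring_scope.

Definition separable (T : topologicalType) : Prop :=
  exists2 D : set T, countable D & dense D.

Definition borel (T : ptopologicalType) := g_sigma_algebraType (@open T).

Section Bvalued.
Context {R : realType} {B : completeNormedModType R}.

Definition random_variable d (T : measurableType d) (X : T -> B) : Prop :=
  measurable_fun [set: T] (X : T -> borel B).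

Section one_space.
Context d (T : measurableType d) (P : probability T R).

Definition simple (s : T -> B) : Prop :=
  random_variable s /\ finite_set (range s).

Definition simple_expectation (s : T -> B) : B :=
  \sum_(y \in range s) fine (P (s @^-1` [set y])) *: y.

(* [Y] is Bochner integrable with Bochner expectation [v] *)
Definition has_expectation (Y : T -> B) (v : B) : Prop :=
  random_variable Y /\
  exists s : nat -> T -> B,
    [/\ forall n, simple (s n),
        (\int[P]_w (`|Y w - s n w|)%:E)%E @[n --> \oo] --> 0%E
      & simple_expectation (s n) @[n --> \oo] --> v].

(* junk value 0 when [Y] is not Bochner integrable *)
Definition Bexpectation (Y : T -> B) : B := xget 0 (has_expectation Y).

Definition nondegenerate (X : T -> B) : Prop :=
  ~ exists a : B, \forall w \ae P, X w = a.

Definition mutually_independent (I : choiceType) (X : I -> T -> B) : Prop :=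
  forall (J : {fset I}) (A : I -> set (borel B)),
    (forall i, measurable (A i)) ->
    P (\bigcap_(i in [set` J]) (X i @^-1` A i)) =
    (\prod_(i <- J) P (X i @^-1` A i))%E.

(* The sums are indexed from 0: X_1, X_2, ... is X 0, X 1, ... *)
Definition partial_sum (X : nat -> T -> B) (n : nat) (w : T) : B :=
  \sum_(j < n) X j w.

(* The infimum of the empty set is +oo. *)
Definition exit_time (X : nat -> T -> B) (r : R) (w : T) : \bar R :=
  ereal_inf [set (n%:R)%:E | n in
    [set n : nat | (1 <= n)%N /\ r < `|partial_sum X n w|]].

Definition tailG (X : T -> B) (r : R) : R := fine (P [set w | r < `|X w|]).

Definition truncK (X : T -> B) (r : R) : R :=
  r ^- 2 * Rintegral P [set w | `|X w| <= r] (fun w => `|X w| ^+ 2).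

Definition truncM (X : T -> B) (r : R) : B :=
  r^-1 *: Bexpectation (fun w => \1_[set w' | `|X w'| <= r] w *: X w).

Definition h (X : T -> B) (r : R) : R :=
  tailG X r + truncK X r + `|truncM X r|.

End one_space.

(* The copies need not live on the probability space carrying [X]. *)
Definition independent_copies d (T : measurableType d) (P : probability T R)
    (X : T -> B) d' (T' : measurableType d') (P' : probability T' R)
    (Xs : nat -> T' -> B) : Prop :=
  [/\ forall j, random_variable (Xs j),
      mutually_independent P' Xs
    & forall j (A : set (borel B)), measurable A ->
        P' (Xs j @^-1` A) = P (X @^-1` A)].

End Bvalued.

Section statements.
Context {R : realType}.
Implicit Types (B : completeNormedModType R) (c : R).

Definition cotype2_constant B c : Prop :=
  0 < c /\
  forall (n : nat) d (T : measurableType d) (P : probability T R)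
    (X : 'I_n -> T -> B),
    (1 <= n)%N ->
    (forall i, random_variable (X i)) ->
    mutually_independent P X ->
    (forall i, has_expectation P (X i) 0) ->
    (forall i, (\int[P]_w (`|X i w| ^+ 2)%:E < +oo)%E) ->
    (c%:E * \sum_(i < n) \int[P]_w (`|X i w| ^+ 2)%:E
       <= \int[P]_w (`|\sum_(i < n) X i w| ^+ 2)%:E)%E.

Definition cotype2 B : Prop := exists c, cotype2_constant B c.

Definition mean_exit_constant B c : Prop :=
  0 < c /\
  forall d (T : measurableType d) (P : probability T R) (X : T -> B)
    d' (T' : measurableType d') (P' : probability T' R) (Xs : nat -> T' -> B)
    (r : R),
    random_variable X -> nondegenerate P X ->
    independent_copies P X P' Xs -> 0 < r ->
    (\int[P']_w exit_time Xs r w <= (c / h P X r)%:E)%E.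

Definition tail_exit_constant B c : Prop :=
  0 < c /\
  forall d (T : measurableType d) (P : probability T R) (X : T -> B)
    d' (T' : measurableType d') (P' : probability T' R) (Xs : nat -> T' -> B)
    (r : R) (n : nat),
    random_variable X -> nondegenerate P X ->
    independent_copies P X P' Xs -> 0 < r -> (1 <= n)%N ->
    (P' [set w | (n%:R)%:E < exit_time Xs r w] <= (c / (n%:R * h P X r))%:E)%E.

(* [phi] is chosen before the space: the new constant is a function of the
   given constant alone, the same for all separable Banach spaces. *)
Definition constant_determines
    (S S' : completeNormedModType R -> R -> Prop) : Prop :=
  exists phi : R -> R,
    forall B c, separable B -> S B c -> S' B (phi c).

Definition constants_determine_each_other
    (S S' : completeNormedModType R -> R -> Prop) : Prop :=
  constant_determines S S' /\ constant_determines S' S.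

End statements.

(* Main.v *)
(** From cotype 2 to mean exit times: if the walk stays in the ball of radius [2 r] up to
    time [n] with probability at least 1/2, then the increments truncated at [4 r] give a
    walk whose maximum has a geometric tail on the scale [r], so its second moment at time
    [n] is O(r^2). Cotype 2 applied to the centred truncated increments bounds
    [n h(4 r)]. Hence for [n] of order [1 / h(4 r)] this probability is below 1/2, and
    independence of successive blocks of length [n] gives [E T_r <= 2 n]. Markov's
    inequality then gives the tail bound.

    From the tail bound back to cotype 2: given vectors [x_i], [i] in [I], with
    [V = sum |x_i|^2], let [n = #|I|] and consider [n] independent copies of
    [sum_i xi_i x_i], where [xi_i] is 0 except with probability [1 / (4 s n)], when it is a
    random sign. If [r^2 = V / (16 s c)] and no [|x_i|] exceeds [r], the tail bound shows
    that the walk leaves the ball of radius [r] with probability at least 1/2, and a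
    reflection argument gives [E |S_n|^2 >= r^2 / 2]. Conversely
    [E |S_n|^2 <= (2 + 4 K / s^2) E |sum_i eps_i x_i|^2] if [K] is a Rademacher cotype
    constant for as many vectors, since repeated activity of a coordinate is rare. For
    [s >= 256 c] this improves [K] to [64 s c + K / 2], and iterating gives a constant
    depending only on [c]. Finally [E |sum eps_i X_i|^2 <= 4 E |sum X_i|^2] for independent
    centred [X_i] and any signs [eps_i]. *)

From HB Require Import structures.
Require Import Defs.
From mathcomp Require Import measurable_realfun ring lra zify.

Set Implicit Arguments.
Unset Strict Implicit.
Unset Printing Implicit Defensive.

Local Open Scope classical_set_scope.
Local Open Scope ring_scope.

(** * Random variables and Bochner expectations *)

Section borel_measurability.
Context {R : realType} {B : completeNormedModType R}.

(** The way back to cotype 2 is decided by counting powers of s. A coordinate is active more than l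
    times with probability at most 1 / (2^l s^(l+1)), so all repeated activity together costs of
    order K / s^2, whereas passing from r^2 back to V costs only a factor of order s c. The a priori
    constant K therefore returns multiplied by 128 c / s, which is at most 1/2 once s >= 256 c.
    Single activity costs no K at all, by the contraction principle. Sparsity also gives the lower
    bound on h: with substantial probability exactly one coordinate is active, so the truncated
    second moment sees every |x_i|^2 separately. In the forward direction the scales have different
    origins. A block of a walk that stays in radius r, restarted at 0, stays in radius 2 r; the
    increments of a walk confined to radius 2 r are at most 4 r, so truncation at 4 r is invisible
    there. Independence of past and future is proved on path space, where a sigma-algebra records
    which coordinates an event may depend on. The test walks need only finitely many equally likely
    outcomes per step, so their expectations are finite averages. *)

Lemma open_borel (U : set B) : open U -> measurable (U : set (borel B)).
Proof. by move=> oU; exact: sub_sigma_algebra. Qed.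

Lemma measurable_borel d (T : measurableType d) (f : T -> B) :
  (forall U : set B, open U -> measurable (f @^-1` U)) ->
  measurable_fun [set: T] (f : T -> borel B).
Proof.
move=> H; apply: (@measurability _ _ _ (borel B) _ _ (@open B)) => //.
by move=> _ [U oU <-]; rewrite setTI; exact: H.
Qed.

Lemma continuous_borel (g : B -> R) : continuous g ->
  measurable_fun [set: borel B] (g : borel B -> R).
Proof.
move=> cg; apply: (measurability _ (RGenOpens.measurableE R)).
move=> _ [_ [a [b ->] <-]]; rewrite setTI; apply: open_borel.
by move/continuousP: cg; apply; exact: interval_open.
Qed.

Lemma continuous_borelB (g : B -> B) : continuous g ->
  measurable_fun [set: borel B] (g : borel B -> borel B).
Proof.
move=> cg; apply: measurable_borel => U oU; apply: open_borel.
by move/continuousP: cg; exact.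
Qed.

Lemma measurable_normB : measurable_fun [set: borel B] (fun x : borel B => `|x : B|).
Proof. by apply: continuous_borel; exact: norm_continuous. Qed.

Section on_T.
Context d (T : measurableType d).
Implicit Types X Y : T -> B.

Lemma rv_comp (g : borel B -> borel B) X :
  measurable_fun setT g -> random_variable X -> random_variable (g \o X).
Proof. by move=> mg mX; exact: (measurableT_comp mg mX). Qed.

Lemma rv_preimage X (A : set (borel B)) : random_variable X -> measurable A ->
  measurable (X @^-1` A).
Proof. by move=> mX mA; rewrite -[X in measurable X]setTI; exact: mX. Qed.

Lemma rv_cst (a : B) : random_variable (cst a : T -> B).
Proof. exact: measurable_cst. Qed.

Lemma rv_norm X : random_variable X -> measurable_fun setT (fun w => `|X w|).
Proof. by move=> mX; exact: (measurableT_comp measurable_normB mX). Qed.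

Lemma rv_normX X n : random_variable X ->
  measurable_fun setT (fun w => `|X w| ^+ n).
Proof. by move=> mX; apply: measurable_funX; exact: rv_norm. Qed.

Lemma rv_opp X : random_variable X -> random_variable (fun w => - X w).
Proof.
by move=> mX; apply: (rv_comp (g := -%R)) => //; apply: continuous_borelB; exact: opp_continuous.
Qed.

Lemma rv_scale (k : R) X : random_variable X -> random_variable (fun w => k *: X w).
Proof.
move=> mX; apply: (rv_comp (g := fun x => k *: x)) => //.
by apply: continuous_borelB; exact: scaler_continuous.
Qed.

Lemma rv_indic X (A : set T) : measurable A -> random_variable X ->
  random_variable (fun w => \1_A w *: X w).
Proof.
move=> mA mX; rewrite /random_variable.
rewrite [X in measurable_fun _ X](_ : _ = fun w => if w \in A then X w else 0); last first.
  by apply/funext => w; rewrite indicE; case: (w \in A); rewrite ?scale1r ?scale0r.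
apply: (measurable_fun_ifT (f := fun w => w \in A)) => //.
apply: (measurable_fun_bool true); rewrite setTI (_ : _ @^-1` _ = A)//.
by apply/seteqP; split => w; [move/set_mem|move/mem_set].
Qed.

End on_T.

Hypothesis sepB : separable B.

(** Separability in sequential form; an index attached to no point of the dense set takes the
    default value 0. *)
Lemma dense_sequence :
  exists u : nat -> B, forall (x : B) (e : R), 0 < e -> exists n, `|x - u n| < e.
Proof.
have [D /countable_injP[f injf] dD] := sepB.
exists (fun n => xget 0 [set x | D x /\ f x = n]) => x e e0.
have [y [/= xy Dy]] := dD (ball x e) (ex_intro _ x (ballxx x e0)) (ball_open x e).
exists (f y); case: xgetP => [z _ [Dz fzy]|/(_ y)[]//].
rewrite (injf z y) ?inE//.
by move: xy; rewrite -ball_normE.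
Qed.

(** Separability enters here: addition is continuous on the product, but only [X] and [Y] separately
    are known to be measurable. The preimage of an open set is therefore written as a countable
    union of rectangles of balls with centres in the dense sequence. *)
Lemma rv_add d (T : measurableType d) (X Y : T -> B) :
  random_variable X -> random_variable Y -> random_variable (fun w => X w + Y w).
Proof.
move=> mX mY; have [u du] := dense_sequence.
apply: measurable_borel => U oU.
pose V (t : nat * nat * nat) : set B := ball (u t.1.1 + u t.1.2) (2 * t.2.+1%:R^-1).
pose W (t : nat * nat * nat) : set T :=
  if `[< V t `<=` U >] then X @^-1` (ball (u t.1.1) t.2.+1%:R^-1) `&`
                            Y @^-1` (ball (u t.1.2) t.2.+1%:R^-1) else set0.
have -> : (fun w => X w + Y w) @^-1` U = \bigcup_t W t.
  apply/seteqP; split => w /=.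
  - move=> Uw; have /nbhs_ballP[e /= e0 eU] : nbhs (X w + Y w) U.
      by rewrite nbhsE; exists U.
    (* When [X w] and [Y w] are within 1/(k+1) of [u i] and [u j], each point of the ball
       [V (i, j, k)], of radius 2/(k+1), is within 4/(k+1) of [X w + Y w]. *)
    have [k ke] : exists k, 4 * k.+1%:R^-1 < e.
      have e4 : 0 < e / 4 by rewrite divr_gt0.
      have [k _ /(_ k (leqnn k))] := near_infty_natSinv_lt (PosNum e4).
      by rewrite /= => kk; exists k; rewrite mulrC -ltr_pdivlMr.
    have k0 : (0 : R) < k.+1%:R^-1 by rewrite invr_gt0.
    have [i Xi] := du (X w) _ k0.
    have [j Yj] := du (Y w) _ k0.
    exists (i, j, k) => //; rewrite /W asboolT /=.
      by split; rewrite /= -ball_normE /= distrC.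
    move=> z; rewrite /V /= -ball_normE /= => zk; apply: eU.
    rewrite -ball_normE /=; apply: le_lt_trans ke.
    have -> : X w + Y w - z = (X w - u i) + (Y w - u j) + (u i + u j - z).
      by rewrite [(X w - u i) + _]addrACA -opprD addrA subrK.
    apply: (le_trans (ler_normD _ _)).
    have key (a b c e1 v : R) : a < v -> b < v -> c < 2 * v -> e1 <= a + b -> e1 + c <= 4 * v by lra.
    exact: (key _ _ _ _ _ Xi Yj zk (ler_normD _ _)).
  - move=> [[[i j] k] _]; rewrite /W; case: asboolP => [VU|]//= [Xi Yj].
    apply: VU; rewrite /V /= -ball_normE /=.
    move: Xi Yj; rewrite -!ball_normE /= => Xi Yj.
    rewrite opprD addrACA.
    have key (a b c v : R) : a < v -> b < v -> c <= a + b -> c < 2 * v by lra.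
    exact: (key _ _ _ _ Xi Yj (ler_normD _ _)).
apply: countable_bigcupT_measurable; first exact: countableP.
move=> t; rewrite /W; case: asboolP => // _.
by apply: measurableI; apply: rv_preimage => //; apply: open_borel; exact: ball_open.
Qed.

Lemma rv_sub d (T : measurableType d) (X Y : T -> B) :
  random_variable X -> random_variable Y -> random_variable (fun w => X w - Y w).
Proof. by move=> mX mY; apply: rv_add => //; exact: rv_opp. Qed.

Lemma rv_sum d (T : measurableType d) I (s : seq I) (P : pred I) (X : I -> T -> B) :
  (forall i, P i -> random_variable (X i)) ->
  random_variable (fun w => \sum_(i <- s | P i) X i w).
Proof.
move=> mX; elim: s => [|i s IH].
  by under eq_fun do rewrite big_nil; exact: rv_cst.
case: (boolP (P i)) => Pi.
  by under eq_fun do rewrite big_cons Pi; apply: rv_add => //; exact: mX.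
by under eq_fun do rewrite big_cons (negbTE Pi).
Qed.

End borel_measurability.

Section nonnegative_expectation.
Context {R : realType} d (T : measurableType d) (P : probability T R).
Implicit Types f g : T -> R.

Lemma ex_le f g : measurable_fun setT f -> measurable_fun setT g ->
  (forall w, 0 <= f w) -> (forall w, f w <= g w) ->
  (\int[P]_w (f w)%:E <= \int[P]_w (g w)%:E)%E.
Proof.
move=> mf mg f0 fg; apply: ge0_le_integral => //.
- by move=> w _; rewrite lee_fin.
- exact/measurable_EFinP.
- exact/measurable_EFinP.
- by move=> w _; rewrite lee_fin.
Qed.

Lemma exD f g : measurable_fun setT f -> measurable_fun setT g ->
  (forall w, 0 <= f w) -> (forall w, 0 <= g w) ->
  (\int[P]_w (f w + g w)%:E = \int[P]_w (f w)%:E + \int[P]_w (g w)%:E)%E.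
Proof.
move=> mf mg f0 g0; under eq_integral do rewrite EFinD.
rewrite ge0_integralD//; try by move=> w _; rewrite lee_fin.
- exact/measurable_EFinP.
- exact/measurable_EFinP.
Qed.

Lemma exZ (k : R) f : measurable_fun setT f -> 0 <= k -> (forall w, 0 <= f w) ->
  (\int[P]_w (k * f w)%:E = k%:E * \int[P]_w (f w)%:E)%E.
Proof.
move=> mf k0 f0; under eq_integral do rewrite EFinM.
rewrite ge0_integralZl//; first exact/measurable_EFinP.
by move=> w _; rewrite lee_fin.
Qed.

Lemma ex_cst (k : R) : (\int[P]_w k%:E = k%:E)%E.
Proof. by rewrite integral_cst//= probability_setT mule1. Qed.

Lemma ex_ge0 f : (forall w, 0 <= f w) -> (0 <= \int[P]_w (f w)%:E)%E.
Proof. by move=> f0; apply: integral_ge0 => w _; rewrite lee_fin. Qed.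

Lemma ex_indic (A : set T) : measurable A -> (\int[P]_w (\1_A w)%:E = P A)%E.
Proof. by move=> mA; rewrite integral_indic// setIT. Qed.

Lemma ex_sum I (s : seq I) (f : I -> T -> R) :
  (forall i, measurable_fun setT (f i)) -> (forall i w, 0 <= f i w) ->
  (\int[P]_w (\sum_(i <- s) f i w)%:E = \sum_(i <- s) \int[P]_w (f i w)%:E)%E.
Proof.
move=> mf f0; under eq_integral do rewrite -sumEFin.
rewrite ge0_integral_sum//; first by move=> i; exact/measurable_EFinP.
by move=> i w _; rewrite lee_fin.
Qed.

(* Tangent-line form of Jensen's inequality for the square. *)
Lemma ex_sqr_tangent f (a : R) : measurable_fun setT f ->
  (forall w, 0 <= f w) -> 0 <= a -> (a%:E <= \int[P]_w (f w)%:E)%E ->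
  ((a ^+ 2)%:E <= \int[P]_w (f w ^+ 2)%:E)%E.
Proof.
move=> mf f0 a0 af.
have mf2 : measurable_fun setT (fun w => f w ^+ 2) by exact: measurable_funX.
have : (\int[P]_w ((2 * a) * f w)%:E <= \int[P]_w (f w ^+ 2 + a ^+ 2)%:E)%E.
  apply: ex_le.
  - exact: measurable_funM.
  - exact: measurable_funD.
  - by move=> w; rewrite !mulr_ge0.
  - by move=> w; have := sqr_ge0 (f w - a); rewrite sqrrB; lra.
rewrite exZ ?mulr_ge0// exD//; last 2 first.
  by move=> w; exact: sqr_ge0.
  by move=> _; exact: sqr_ge0.
rewrite ex_cst => h.
have {}h := le_trans (lee_wpmul2l (_ : (0 <= (2 * a)%:E)%E) af) h.
have {}h : ((2 * a * a)%:E <= \int[P]_w (f w ^+ 2)%:E + (a ^+ 2)%:E)%E.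
  by rewrite EFinM; apply: h; rewrite lee_fin mulr_ge0.
rewrite -(leeD2rE _ _ (isT : (a ^+ 2)%:E \is a fin_num)).
by apply: le_trans h; rewrite -EFinD lee_fin; lra.
Qed.

End nonnegative_expectation.

Section transfer.
Context {R : realType} d1 (T1 : measurableType d1) d2 (T2 : measurableType d2).
Variables (P1 : probability T1 R) (P2 : probability T2 R) (phi : T1 -> T2).
Hypothesis mphi : measurable_fun setT phi.
Hypothesis law : forall A, measurable A -> P1 (phi @^-1` A) = P2 A.

Lemma ex_law (f : T2 -> R) : measurable_fun setT f -> (forall x, 0 <= f x) ->
  (\int[P1]_w (f (phi w))%:E = \int[P2]_x (f x)%:E)%E.
Proof.
move=> mf f0.
rewrite -[RHS](@eq_measure_integral _ _ _ _ P2 (pushforward P1 phi)).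
  rewrite ge0_integral_pushforward//; first exact/measurable_EFinP.
  by move=> x _; rewrite lee_fin.
by move=> A mA _; exact: law.
Qed.

End transfer.

(** * Bochner expectations: linearity, norm bound and uniqueness *)

Section bochner.
Context {R : realType} {B : completeNormedModType R}.
Hypothesis sepB : separable B.

Section one_space.
Context d (T : measurableType d) (P : probability T R).
Implicit Types s Y : T -> B.

Lemma measurable_fibre (y : B) : measurable ([set y] : set (borel B)).
Proof.
rewrite -[X in measurable X]setCK; apply: measurableC; apply: open_borel.
rewrite openC; apply: accessible_closed_set1; exact: hausdorff_accessible.
Qed.

Lemma simple_fibre s y : simple s -> measurable (s @^-1` [set y]).
Proof. by move=> [ms _]; apply: rv_preimage => //; exact: measurable_fibre. Qed.

Lemma probability_partition (U : choiceType) (u : T -> U) (A : set T) :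
  finite_set (range u) -> (forall x, measurable (u @^-1` [set x])) ->
  measurable A ->
  fine (P A) = \sum_(x <- fset_set (range u)) fine (P (A `&` u @^-1` [set x])).
Proof.
move=> fu mu mA.
have {1}-> : A = \bigcup_(x in range u) (A `&` u @^-1` [set x]).
  apply/seteqP; split => w; first by move=> Aw; exists (u w).
  by move=> [x _ []].
rewrite measure_fin_bigcup//.
- rewrite fsbig_finite//= sum_fine// => x _; apply: fin_num_measure.
  exact: measurableI.
- by move=> i j _ _ [w [[_ <-] [_ <-]]].
- by move=> x _; exact: measurableI.
Qed.

(** The definition sums over the distinct values of the function, and such a sum does not split
    under subtraction. Any finite partition finer than the fibres gives the same result; for
    linearity it is the partition generated by a pair of simple functions. *)
Lemma simple_expectation_comp (U : choiceType) (u : T -> U) (f : U -> B) :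
  finite_set (range u) -> (forall x, measurable (u @^-1` [set x])) ->
  simple (f \o u) ->
  simple_expectation P (f \o u) =
  \sum_(x <- fset_set (range u)) fine (P (u @^-1` [set x])) *: f x.
Proof.
move=> fu mu sfu; rewrite /simple_expectation fsbig_finite; last by case: sfu.
have -> : fset_set (range (f \o u)) = [fset f x | x in fset_set (range u)]%fset.
  by rewrite -fset_set_image// image_comp.
rewrite [RHS](partition_big_imfset _ f) /=; apply: eq_bigr => y _.
rewrite (probability_partition fu mu); last exact: simple_fibre.
rewrite scaler_suml [RHS]big_mkcond /=.
apply: eq_bigr => x _.
case: eqP => [fxy|fxy].
  rewrite -fxy (_ : _ `&` _ = u @^-1` [set x])//.
  by apply/seteqP; split => w /= => [[]|->].
rewrite (_ : _ `&` _ = set0) ?measure0 ?scale0r//.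
by rewrite -subset0 => w /= [fuw ux]; apply: fxy; rewrite -ux.
Qed.

Lemma simple_pair s s' : simple s -> simple s' ->
  finite_set (range (fun w => (s w, s' w))) /\
  forall x, measurable ((fun w => (s w, s' w)) @^-1` [set x]).
Proof.
move=> ss ss'; split.
  apply: (@sub_finite_set _ _ (range s `*` range s')).
    by move=> _ [w _ <-]; split => /=; exists w.
  by apply: finite_setX; [case: ss|case: ss'].
move=> [x y]; rewrite (_ : _ @^-1` _ = s @^-1` [set x] `&` s' @^-1` [set y]).
  by apply: measurableI; exact: simple_fibre.
by apply/seteqP; split => w /= => [[-> ->]|[-> ->]].
Qed.

Lemma simple_sub s s' : simple s -> simple s' -> simple (fun w => s w - s' w).
Proof.
move=> ss ss'; split; first by apply: rv_sub => //; [case: ss|case: ss'].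
have [f2 _] := simple_pair ss ss'.
have := finite_image (fun p => p.1 - p.2) f2.
by rewrite image_comp.
Qed.

Lemma simple_expectationB s s' : simple s -> simple s' ->
  simple_expectation P (fun w => s w - s' w) =
  simple_expectation P s - simple_expectation P s'.
Proof.
move=> ss ss'; have [f2 m2] := simple_pair ss ss'.
rewrite (simple_expectation_comp (f := fun p => p.1 - p.2) f2 m2); last exact: simple_sub.
rewrite (simple_expectation_comp (f := fst) f2 m2)//.
rewrite (simple_expectation_comp (f := snd) f2 m2)//.
by rewrite -sumrB; apply: eq_bigr => x _; rewrite scalerBr.
Qed.

Lemma simple_cst (a : B) : simple (cst a : T -> B).
Proof.
split; first exact: rv_cst.
by apply: (@sub_finite_set _ _ [set a]) => // _ [w _ <-].
Qed.

Lemma simple_expectation_cst (a : B) : simple_expectation P (cst a : T -> B) = a.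
Proof.
rewrite (@simple_expectation_comp unit (fun=> tt) (fun=> a)); last 3 first.
- exact: finite_finset.
- by case; rewrite (_ : _ @^-1` _ = setT)//; apply/seteqP.
- exact: simple_cst.
rewrite (_ : range _ = [set tt]); last by apply/seteqP; split => [[]|[] _]//=; exists point.
rewrite fset_set1 big_seq_fset1 (_ : _ @^-1` _ = setT); last by apply/seteqP.
by rewrite probability_setT scale1r.
Qed.

Lemma simple_expectation_norm s : simple s ->
  (`|simple_expectation P s|%:E <= \int[P]_w `|s w|%:E)%E.
Proof.
move=> ss; have fs : finite_set (range s) by case: ss.
have -> : (\int[P]_w `|s w|%:E = \int[P]_w (\sum_(y <- fset_set (range s)) `|y| * \1_(s @^-1` [set y]) w)%:E)%E.
  apply: eq_integral => w _; congr _%:E.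
  rewrite (big_fsetD1 (s w)) /=; last by rewrite in_fset_set// inE; exists w.
  rewrite indicE mem_set// mulr1 big_seq big1 ?addr0// => y.
  rewrite !inE => /andP[ysw _]; rewrite indicE memNset ?mulr0//=.
  by move=> /esym/eqP; apply/negP.
have mi y : measurable_fun setT (\1_(s @^-1` [set y]) : T -> R).
  by apply: measurable_indic; exact: simple_fibre.
rewrite ex_sum; last 2 first.
- by move=> y; apply: measurable_funM.
- by move=> y w; rewrite mulr_ge0// indicE.
under eq_bigr => y _.
  rewrite exZ//.
  rewrite ex_indic; last exact: simple_fibre.
  rewrite -(@fineK _ (P _)) ?fin_num_measure//; last exact: simple_fibre.
  rewrite -EFinM; over.
rewrite sumEFin lee_fin /simple_expectation fsbig_finite//=.
apply: (le_trans (ler_norm_sum _ _ _)); apply: ler_sum => y _.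
by rewrite normrZ ger0_norm ?fine_ge0// mulrC.
Qed.

Lemma has_expectation_approx Y v (e : R) : has_expectation P Y v -> 0 < e ->
  exists s, [/\ simple s, (\int[P]_w `|Y w - s w|%:E <= e%:E)%E
    & `|v - simple_expectation P s| <= e].
Proof.
move=> [mY [s [ss cs cv]]] e0.
have h1 : \forall n \near \oo, (\int[P]_w `|Y w - s n w|%:E <= e%:E)%E.
  have [N _ hN] := cs _ (nbhs_open_ereal_lt (f := cst e) e0).
  by exists N => // n /hN /= /ltW.
have h2 : \forall n \near \oo, `|v - simple_expectation P (s n)| <= e.
  by move/cvgrPdist_le : cv; apply.
near \oo => n; exists (s n); split => //; near: n => //.
Unshelve. all: by end_near. Qed.

Lemma has_expectation_norm Y v : has_expectation P Y v ->
  (`|v|%:E <= \int[P]_w `|Y w|%:E)%E.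
Proof.
move=> hY; have mY : random_variable Y by case: hY.
apply/lee_addgt0Pr => e e0.
have e20 : 0 < e / 3 by lra.
have [s [ss h1 h2]] := has_expectation_approx hY e20.
have ms : random_variable s by case: ss.
have h3 : (\int[P]_w `|s w|%:E <= \int[P]_w (`|Y w| + `|Y w - s w|)%:E)%E.
  apply: ex_le => //.
  - exact: rv_norm.
  - by apply: measurable_funD; apply: rv_norm => //; exact: rv_sub.
  - by move=> w; rewrite -lerBlDl; apply: le_trans (lerB_dist _ _) _; rewrite distrC.
rewrite exD// in h3; last 2 first.
- exact: rv_norm.
- by apply: rv_norm; exact: rv_sub.
have h4 := le_trans (simple_expectation_norm ss) h3.
have h5 : (`|v|%:E <= `|simple_expectation P s|%:E + (e / 3)%:E)%E.
  rewrite -EFinD lee_fin -lerBlDl; apply: le_trans h2; exact: lerB_dist.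
apply: (le_trans h5).
apply: (@le_trans _ _ (\int[P]_w `|Y w|%:E + (e / 3)%:E + (e / 3)%:E)%E).
  by apply: leeD => //; apply: (le_trans h4); exact: leeD.
by rewrite -addeA -EFinD leeD2l// lee_fin; lra.
Qed.

Lemma has_expectationB Y Y' v v' : has_expectation P Y v ->
  has_expectation P Y' v' -> has_expectation P (fun w => Y w - Y' w) (v - v').
Proof.
move=> [mY [s [ss cs cv]]] [mY' [s' [ss' cs' cv']]].
split; first exact: rv_sub.
exists (fun n w => s n w - s' n w); split.
- by move=> n; exact: simple_sub.
- apply: (@squeeze_cvge _ _ _ _ (cst 0%E) _ (fun n => \int[P]_w `|Y w - s n w|%:E + \int[P]_w `|Y' w - s' n w|%:E)%E).
  + apply: nearW => n; rewrite ex_ge0//=.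
    have [ms _] := ss n; have [ms' _] := ss' n.
    rewrite -exD//; last 2 first.
    * by apply: rv_norm; exact: rv_sub.
    * by apply: rv_norm; exact: rv_sub.
    apply: ex_le => //.
    * by apply: rv_norm; do !apply: rv_sub.
    * by apply: measurable_funD; apply: rv_norm; exact: rv_sub.
    * move=> w; rewrite (_ : Y w - Y' w - (s n w - s' n w) = (Y w - s n w) - (Y' w - s' n w)).
        exact: ler_normB.
      by rewrite opprD addrACA -opprD.
  + exact: cvg_cst.
  + by rewrite -(adde0 0%E); apply: cvgeD.
- under eq_fun do rewrite simple_expectationB//.
  exact: cvgB.
Qed.

Lemma has_expectation_cst (a : B) : has_expectation P (cst a) a.
Proof.
split; first exact: rv_cst.
exists (fun=> cst a); split => [_||]; first exact: simple_cst.
- rewrite (_ : (fun _ => _) = cst 0%E); first exact: cvg_cst.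
  by apply/funext => n /=; rewrite subrr normr0 ex_cst.
- by rewrite simple_expectation_cst; exact: cvg_cst.
Qed.

Lemma has_expectationD Y Y' v v' : has_expectation P Y v ->
  has_expectation P Y' v' -> has_expectation P (fun w => Y w + Y' w) (v + v').
Proof.
move=> hY hY'; have := has_expectationB hY (has_expectationB (has_expectation_cst 0) hY').
rewrite sub0r opprK; congr (has_expectation P _ _).
by apply/funext => w /=; rewrite sub0r opprK.
Qed.

Lemma has_expectation_sum I (r : seq I) (Q : pred I) (Y : I -> T -> B) (v : I -> B) :
  (forall i, has_expectation P (Y i) (v i)) ->
  has_expectation P (fun w => \sum_(i <- r | Q i) Y i w) (\sum_(i <- r | Q i) v i).
Proof.
move=> hY; elim: r => [|i r IH].
  rewrite big_nil; under eq_fun do rewrite big_nil; exact: has_expectation_cst.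
rewrite big_cons; case: (boolP (Q i)) => Qi.
  by under eq_fun do rewrite big_cons Qi; exact: has_expectationD.
by under eq_fun do rewrite big_cons (negbTE Qi).
Qed.

Lemma has_expectation_unique Y v v' :
  has_expectation P Y v -> has_expectation P Y v' -> v = v'.
Proof.
move=> h h'; have := has_expectation_norm (has_expectationB h h').
under eq_integral do rewrite subrr normr0.
by rewrite ex_cst lee_fin normr_le0 subr_eq0 => /eqP.
Qed.

Lemma BexpectationE Y v : has_expectation P Y v -> Bexpectation P Y = v.
Proof.
move=> h; rewrite /Bexpectation; case: xgetP => [y _ hy|/(_ v)//].
exact: (has_expectation_unique hy).
Qed.

End one_space.
End bochner.

(** * Existence of Bochner expectations and their dependence on the law alone *)

Section bochner_existence.
Context {R : realType} {B : completeNormedModType R}.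
Hypothesis sepB : separable B.

(* The point nearest to [x] among [0, u 0, ..., u n.-1]: a simple function of [x]. *)
Fixpoint nearest (u : nat -> B) n (x : B) : B :=
  if n is m.+1 then
    if `|x - u m| < `|x - nearest u m x| then u m else nearest u m x
  else 0.

Lemma nearest_step u n x : `|x - nearest u n.+1 x| <= `|x - nearest u n x|.
Proof. by rewrite /=; case: ifPn => // /ltW. Qed.

Lemma nearest_mono u x : {homo (fun n => `|x - nearest u n x|) : n m / (n <= m)%N >-> m <= n}.
Proof. by apply/nonincreasing_seqP => n; exact: nearest_step. Qed.

Lemma nearest_norm u n x : `|x - nearest u n x| <= `|x|.
Proof. by apply: (le_trans (nearest_mono u x (leq0n n))); rewrite subr0. Qed.

Lemma nearest_le u m n x : (m < n)%N -> `|x - nearest u n x| <= `|x - u m|.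
Proof.
move=> mn; apply: (le_trans (nearest_mono u x mn)) => /=.
by case: ifPn => //; rewrite -leNgt.
Qed.

Lemma nearest_simple u n d (T : measurableType d) (Y : T -> B) :
  random_variable Y -> simple (fun w => nearest u n (Y w)).
Proof.
move=> mY; elim: n => [|n [mn fn]]; first exact: simple_cst.
split.
  apply: (measurable_fun_ifT (f := fun w => `|Y w - u n| < `|Y w - nearest u n (Y w)|)) => //.
    by apply: measurable_fun_ltr; apply: rv_norm; apply: rv_sub => //; exact: rv_cst.
apply: (@sub_finite_set _ _ (u n |` range (fun w => nearest u n (Y w)))).
  by move=> _ [w _ <-] /=; case: ifPn => _; [left|right; exists w].
by rewrite finite_setU; split.
Qed.

(** Nearest-point approximations converge pointwise by density, and since 0 is always a candidate
    their error never exceeds |Y| <= M. Dominated convergence then gives convergence in mean, which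
    makes the simple expectations Cauchy; completeness of [B] supplies the limit. *)
Lemma has_expectation_bounded d (T : measurableType d) (P : probability T R)
    (Y : T -> B) (M : R) : random_variable Y -> (forall w, `|Y w| <= M) ->
  exists v, has_expectation P Y v.
Proof.
move=> mY YM; have [u du] := dense_sequence sepB.
pose s n w := nearest u n (Y w).
have ss n : simple (s n) by exact: nearest_simple.
have ms n : random_variable (s n) by case: (ss n).
have cs : (\int[P]_w (`|Y w - s n w|)%:E)%E @[n --> \oo] --> 0%E.
  rewrite -[X in _ --> X](ex_cst P 0).
  apply: (@dominated_cvg _ _ _ P setT measurableT _ _ (cst M%:E)).
  - by move=> n; apply/measurable_EFinP; apply: rv_norm; exact: rv_sub.
  - move=> w _; apply: cvg_EFin; first exact: nearW.
    apply/cvgrPdist_lt => e e0 /=; have [m um] := du (Y w) e e0.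
    exists m.+1 => // n /= mn; rewrite sub0r normrN normr_id.
    exact: le_lt_trans (nearest_le _ _ mn) um.
  - by [].
  - by apply: finite_measure_integrable_cst.
  - move=> n w _; rewrite abse_EFin normr_id lee_fin.
    exact: le_trans (nearest_norm _ _ _) (YM w).
have cse : cvg (simple_expectation P (s n) @[n --> \oo]).
  apply/cauchy_cvgP/cauchy_exP => e e0.
  have e20 : 0 < e / 2 by rewrite divr_gt0.
  have [N _ hN] := cs _ (nbhs_open_ereal_lt (f := cst (e / 2)) e20).
  exists (simple_expectation P (s N)); exists N => // n /= Nn.
  rewrite -ball_normE /= -simple_expectationB// -lte_fin.
  apply: (le_lt_trans (simple_expectation_norm P (simple_sub sepB (ss N) (ss n)))).
  apply: (@le_lt_trans _ _ (\int[P]_w (`|Y w - s N w| + `|Y w - s n w|)%:E)%E).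
    apply: ex_le => //.
    - by apply: rv_norm; exact: rv_sub.
    - by apply: measurable_funD; apply: rv_norm; exact: rv_sub.
    - move=> w; rewrite (_ : s N w - s n w = (Y w - s n w) - (Y w - s N w)).
        by rewrite [leRHS]addrC; exact: ler_normB.
      by rewrite opprB [RHS]addrC addrA subrK.
  rewrite exD//; last 2 first.
  - by apply: rv_norm; exact: rv_sub.
  - by apply: rv_norm; exact: rv_sub.
  rewrite (_ : e = e / 2 + e / 2); last by lra.
  by rewrite EFinD; apply: lteD; [exact: hN (leqnn N)|exact: hN].
exists (lim (simple_expectation P (s n) @[n --> \oo])).
by split => //; exists s; split.
Qed.

Lemma has_expectation_law d1 (T1 : measurableType d1) (P1 : probability T1 R)
    d2 (T2 : measurableType d2) (P2 : probability T2 R) (phi : T1 -> T2)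
    (Y : T2 -> B) v :
  measurable_fun setT phi ->
  (forall A, measurable A -> P1 (phi @^-1` A) = P2 A) ->
  has_expectation P2 Y v -> has_expectation P1 (Y \o phi) v.
Proof.
move=> mphi law [mY [s [ss cs cv]]].
have mc (f : T2 -> B) : random_variable f -> random_variable (f \o phi).
  by move=> mf; exact: (measurableT_comp mf mphi).
split; first exact: mc.
have ms n : random_variable (s n) by case: (ss n).
exists (fun n => s n \o phi); split.
- move=> n; split; first exact: mc.
  apply: (@sub_finite_set _ _ (range (s n))); last by case: (ss n).
  by move=> _ [w _ <-]; exists (phi w).
- rewrite (_ : (fun n => _) = fun n => (\int[P2]_w `|Y w - s n w|%:E)%E)//.
  apply/funext => n; rewrite -(ex_law mphi law)//.
  by apply: rv_norm; exact: rv_sub.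
- rewrite (_ : (fun n => _) = fun n => simple_expectation P2 (s n))//.
  apply/funext => n; rewrite /simple_expectation.
  have pE y : P1 ((s n \o phi) @^-1` [set y]) = P2 (s n @^-1` [set y]).
    by rewrite -law// ; exact: simple_fibre.
  under eq_fsbigr do rewrite pE.
  (* The range of [s n] may exceed that of [s n \o phi]; the values missed by [phi] have an empty
     fibre and contribute 0. *)
  apply: fsbig_widen; first by move=> _ [w _ <-]; exists (phi w).
  move=> y /= [_ ny]; rewrite -pE (_ : _ @^-1` _ = set0) ?measure0 ?scale0r//.
  by rewrite -subset0 => w /= wy; apply: ny; exists w.
Qed.

(** The expectation is found once, for [g] under the common law on [borel B], and pulled back along
    both variables. This links the truncated mean of [X] to that of copies living on another
    space. *)
Lemma common_expectation d1 (T1 : measurableType d1) (P1 : probability T1 R)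
    d2 (T2 : measurableType d2) (P2 : probability T2 R) (X1 : T1 -> B) (X2 : T2 -> B)
    (g : borel B -> borel B) (M : R) :
  random_variable X1 -> random_variable X2 ->
  (forall A : set (borel B), measurable A -> P2 (X2 @^-1` A) = P1 (X1 @^-1` A)) ->
  measurable_fun setT g -> (forall x, `|g x : B| <= M) ->
  exists v, has_expectation P1 (g \o X1) v /\ has_expectation P2 (g \o X2) v.
Proof.
move=> mX1 mX2 law mg gM.
pose X1' : {mfun T1 >-> borel B} := mfun_Sub (mem_set mX1).
have [v hv] := has_expectation_bounded (distribution P1 X1') mg gM.
by exists v; split; apply: has_expectation_law hv.
Qed.

End bochner_existence.

(** * Independence on path space *)

Section path_space.
Context {R : realType} {B : completeNormedModType R} {I : choiceType}.

Definition cylinder (J : {fset I}) (A : I -> set (borel B)) : set (I -> B) :=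
  [set p | forall i, i \in J -> A i (p i)].

Definition cylinders (D : set I) : set (set (I -> B)) :=
  [set C | exists J A, [/\ [set` J] `<=` D, forall i, measurable (A i) &
    C = cylinder J A]].

(* Measurable sets of [path D] are the events that depend only on the coordinates in [D]. *)
Definition path (D : set I) := g_sigma_algebraType (cylinders D).

Lemma cylinders_setI D : setI_closed (cylinders D).
Proof.
move=> _ _ [J [A [JD mA ->]]] [J' [A' [JD' mA' ->]]].
exists (J `|` J')%fset, (fun i => (if i \in J then A i else setT) `&`
                          (if i \in J' then A' i else setT)); split.
- by move=> i /=; rewrite inE => /orP[/JD|/JD'].
- by move=> i; apply: measurableI; case: ifP.
- apply/seteqP; split => p /=.
    by move=> [h h'] i _; split; case: ifP => // iJ; [exact: h|exact: h'].
  move=> h; split => i iJ.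
    by have [] := h i; rewrite ?inE iJ.
  by have [] := h i; rewrite ?inE iJ ?orbT.
Qed.

Lemma cylinders_setT D : cylinders D setT.
Proof.
exists fset0, (fun=> setT); split => //.
by apply/seteqP; split => // p _ i; rewrite inE.
Qed.

Lemma rv_coord (D : set I) i : D i -> random_variable (fun p : path D => p i).
Proof.
move=> Di; move=> _ A mA; rewrite setTI; apply: sub_sigma_algebra.
exists [fset i]%fset, (fun=> A); split => //.
- by move=> j /=; rewrite inE => /eqP ->.
- apply/seteqP; split => p /=; first by move=> Ap j; rewrite inE => /eqP ->.
  by apply; rewrite inE.
Qed.

Section sample_path.
Context d (T : measurableType d) (P : probability T R) (X : I -> T -> B).
Hypothesis mX : forall i, random_variable (X i).

Definition sample_path (w : T) : I -> B := fun i => X i w.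

Lemma sample_path_cylinder J A :
  sample_path @^-1` cylinder J A = \bigcap_(i in [set` J]) (X i @^-1` A i).
Proof. by apply/seteqP; split => w /= h i; exact: h. Qed.

Lemma measurable_sample_path D : measurable_fun setT (sample_path : T -> path D).
Proof.
apply: (@measurability _ _ _ (path D) _ _ (cylinders D)) => //.
move=> _ [_ [J [A [_ mA ->]]] <-]; rewrite setTI sample_path_cylinder.
apply: fin_bigcap_measurable => // i _; exact: rv_preimage.
Qed.

Lemma measurable_sample_preimage D (E : set (I -> B)) :
  measurable (E : set (path D)) -> measurable (sample_path @^-1` E).
Proof.
by move=> mE; rewrite -[X in measurable X]setTI; exact: (@measurable_sample_path D).
Qed.

Hypothesis indX : mutually_independent P X.

Lemma cylinders_independent (D D' : set I) C C' : D `&` D' = set0 ->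
  cylinders D C -> cylinders D' C' ->
  P (sample_path @^-1` C `&` sample_path @^-1` C') =
  (P (sample_path @^-1` C) * P (sample_path @^-1` C'))%E.
Proof.
move=> DD [J [A [JD mA ->]]] [J' [A' [JD' mA' ->]]].
pose A2 i := if i \in J then A i else A' i.
have JJ' i : i \in J' -> i \notin J.
  move=> iJ'; apply/negP => iJ; have : set0 i by rewrite -DD; split; [exact: JD|exact: JD'].
  by [].
have -> : sample_path @^-1` cylinder J A `&` sample_path @^-1` cylinder J' A' =
    \bigcap_(i in [set` (J `|` J')%fset]) (X i @^-1` A2 i).
  apply/seteqP; split => w /=.
    move=> [h h'] i /=; rewrite inE /A2; case: ifPn => [iJ _|iJ /= iJ'].
      exact: h.
    exact: h'.
  move=> h; split => i iJ.
    by have := h i; rewrite /A2 /= inE iJ; apply.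
  by have := h i; rewrite /A2 /= inE iJ (negbTE (JJ' _ iJ)) orbT; apply.
rewrite indX; last by move=> i; rewrite /A2; case: ifP.
rewrite !sample_path_cylinder !indX//.
rewrite (big_fsetID _ (mem J)) /=; congr (_ * _)%E.
  rewrite (_ : [fset x | x in (J `|` J')%fset & x \in J]%fset = J).
    by apply: eq_big_seq => i iJ; rewrite /A2 iJ.
  by apply/fsetP => i; rewrite !inE /=; case: (i \in J) => //=; rewrite andbF.
rewrite (_ : [fset x | x in (J `|` J')%fset & x \notin J]%fset = J').
  by apply: eq_big_seq => i iJ; rewrite /A2 (negbTE (JJ' _ iJ)).
apply/fsetP => i; rewrite !inE /=; case: (boolP (i \in J')) => iJ'.
  by rewrite JJ' ?orbT.
by rewrite orbF andbN.
Qed.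

End sample_path.

Section unique.
Context d (T : measurableType d) d' (T' : measurableType d').
Variables (m : {measure set T -> \bar R}) (m' : {measure set T' -> \bar R}).
Variables (X : I -> T -> B) (X' : I -> T' -> B).
Hypotheses (mX : forall i, random_variable (X i)) (mX' : forall i, random_variable (X' i)).
Hypothesis fm : (m setT < +oo)%E.

Lemma path_measure_unique D :
  (forall C, cylinders D C -> m (sample_path X @^-1` C) = m' (sample_path X' @^-1` C)) ->
  forall E : set (path D), measurable E ->
    m (sample_path X @^-1` E) = m' (sample_path X' @^-1` E).
Proof.
move=> h E mE.
pose phi : {mfun T >-> path D} := mfun_Sub (mem_set (measurable_sample_path mX (D := D))).
pose phi' : {mfun T' >-> path D} := mfun_Sub (mem_set (measurable_sample_path mX' (D := D))).
apply: (@measure_unique _ _ (path D) (cylinders D) (fun=> setT) _ _ _ _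
  (pushforward m phi) (pushforward m' phi')) => //.
- exact: cylinders_setI.
- by move=> _; exact: cylinders_setT.
- by rewrite bigcup_const.
Qed.

End unique.

(** Cylinders are replaced by general events in one factor at a time. With an event [F] frozen,
    [key] compares [P] restricted to [F] with [P] scaled by [P F]; it is used first with [F] given
    by [E], then with [F] a cylinder event. *)
Lemma path_independent d (T : measurableType d) (P : probability T R) (X : I -> T -> B)
    (D D' : set I) (E E' : set (I -> B)) :
  (forall i, random_variable (X i)) -> mutually_independent P X ->
  D `&` D' = set0 ->
  measurable (E : set (path D)) -> measurable (E' : set (path D')) ->
  P (sample_path X @^-1` E `&` sample_path X @^-1` E') =
  (P (sample_path X @^-1` E) * P (sample_path X @^-1` E'))%E.
Proof.
move=> mX indX DD mE mE'.
have key (F : set T) (mF : measurable F) (D1 : set I) :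
    (forall C, cylinders D1 C -> P (sample_path X @^-1` C `&` F) =
      (P F * P (sample_path X @^-1` C))%E) ->
    forall G, measurable (G : set (path D1)) ->
      P (sample_path X @^-1` G `&` F) = (P F * P (sample_path X @^-1` G))%E.
  move=> h G mG.
  have PF0 : 0 <= fine (P F) by rewrite fine_ge0.
  have PFE : (P F = (NngNum PF0)%:num%:E)%E by rewrite /= fineK ?fin_num_measure.
  rewrite PFE; apply: (@path_measure_unique _ _ _ _ (mrestr P mF) (mscale (NngNum PF0) P)
    _ _ mX mX _ D1) => //.
    by rewrite /mrestr (le_lt_trans (probability_le1 P _)) ?ltry// setTI.
  by move=> C hC; apply: (eq_trans (h C hC)); congr (_ * _)%E; exact: PFE.
have mPE := measurable_sample_preimage mX mE.
rewrite setIC; apply: (key _ mPE D' _ E' mE') => C' hC'.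
have mC' : measurable (sample_path X @^-1` C').
  by apply: (@measurable_sample_preimage _ _ _ mX D'); exact: sub_sigma_algebra.
rewrite setIC muleC; apply: (key _ mC' D _ E mE) => C hC.
rewrite muleC; exact: (cylinders_independent indX DD).
Qed.

Lemma path_law_eq d (T : measurableType d) (P : probability T R)
    d' (T' : measurableType d') (P' : probability T' R)
    (X : I -> T -> B) (X' : I -> T' -> B) (E : set (I -> B)) :
  (forall i, random_variable (X i)) -> mutually_independent P X ->
  (forall i, random_variable (X' i)) -> mutually_independent P' X' ->
  (forall i (A : set (borel B)), measurable A -> P (X i @^-1` A) = P' (X' i @^-1` A)) ->
  measurable (E : set (path setT)) ->
  P (sample_path X @^-1` E) = P' (sample_path X' @^-1` E).
Proof.
move=> mX iX mX' iX' law; apply: path_measure_unique => //.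
  by rewrite (le_lt_trans (probability_le1 P _)) ?ltry.
move=> _ [J [A [_ mA ->]]]; rewrite !sample_path_cylinder.
apply: (eq_trans (iX J A mA)); apply/esym/(eq_trans (iX' J A mA)).
by apply: eq_bigr => i _; rewrite law.
Qed.

End path_space.

Lemma mutually_independent_comp {R : realType} {B : completeNormedModType R}
    d (T : measurableType d) (P : probability T R) (I I' : choiceType)
    (X : I -> T -> B) (f : I' -> I) (g : borel B -> borel B) :
  injective f -> measurable_fun setT g -> mutually_independent P X ->
  mutually_independent P (fun i w => g (X (f i) w)).
Proof.
move=> injf mg indX J A mA.
(* The events transported to the index set [I]: off the range of [f] the condition is vacuous and
   the event is the whole space. *)
pose A2 i : set (borel B) := [set x | forall i', f i' = i -> A i' (g x)].
have A2E i : A2 (f i) = g @^-1` A i.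
  by apply/seteqP; split => x /= h; [exact: h|move=> i' /injf ->].
have mA2 i : measurable (A2 i).
  have [[j <-]|ni] := pselect (exists j, f j = i).
    by rewrite A2E -[X in measurable X]setTI; exact: mg.
  rewrite (_ : A2 i = setT)//; apply/seteqP; split => // x _ j fj.
  by exfalso; apply: ni; exists j.
have := indX [fset f x | x in J]%fset A2 mA2.
rewrite big_imfset /=; last by move=> ? ? _ _; exact: injf.
under [X in _ = X]eq_bigr do rewrite A2E -comp_preimage.
move=> <-; congr (P _); apply/seteqP; split => w /= h i /=.
  move=> /imfsetP[j /= jJ ->]; rewrite /= A2E; exact: h.
move=> iJ; have := h (f i); rewrite /= A2E; apply.
by apply/imfsetP; exists i.
Qed.

Section markov.
Context {R : realType} {B : completeNormedModType R}.
Context d (T : measurableType d) (P : probability T R) (X : nat -> T -> B).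
Hypotheses (mX : forall i, random_variable (X i)) (indX : mutually_independent P X).
Hypothesis law : forall i (A : set (borel B)), measurable A ->
  P (X i @^-1` A) = P (X 0%N @^-1` A).

Lemma measurable_shift k (F : set (nat -> B)) :
  measurable (F : set (path setT)) ->
  measurable ([set p | F (fun j => p (k + j)%N)] : set (path [set j | (k <= j)%N])).
Proof.
move=> mF.
have : measurable_fun setT ((fun p j => p (k + j)%N) :
    path [set j | (k <= j)%N] -> @path R B nat setT).
  apply: (@measurable_sample_path _ _ _ _ _ (fun j (p : path [set j | (k <= j)%N]) => p (k + j)%N)).
  by move=> j; apply: rv_coord; exact: leq_addr.
by move=> /(_ measurableT F mF); rewrite setTI.
Qed.

(** The two events use disjoint sets of coordinates, and the sequence shifted by [k] has the law of
    the original one. *)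
Lemma markov_property k (E F : set (nat -> B)) :
  measurable (E : set (path [set j | (j < k)%N])) ->
  measurable (F : set (path setT)) ->
  P [set w | E (X^~ w) /\ F (fun j => X (k + j)%N w)] =
  (P [set w | E (X^~ w)] * P [set w | F (X^~ w)])%E.
Proof.
move=> mE mF.
have /= := path_independent mX indX _ mE (measurable_shift (k := k) mF).
rewrite /setI /= /sample_path => ->; last first.
  by rewrite -subset0 => j /= []; rewrite ltnNge => /negP.
congr (_ * _)%E.
apply: (path_law_eq (X := fun j => X (k + j)%N)) => //.
- apply: (mutually_independent_comp (f := addn k) (g := id)) => //.
  exact: addnI.
- by move=> i A mA; rewrite law// [RHS]law.
Qed.

End markov.

(** * From cotype 2 to mean exit times *)

Section walks.
Context {R : realType} {B : completeNormedModType R}.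
Implicit Types (p : nat -> B) (a r t : R).

Definition walk p n : B := \sum_(j < n) p j.

Definition stays a n : set (nat -> B) :=
  [set p | forall k, (k <= n)%N -> `|walk p k| <= a].

Definition first_exit t k : set (nat -> B) :=
  [set p | (forall i, (i < k)%N -> `|walk p i| <= t) /\ t < `|walk p k|].

Lemma walk0 p : walk p 0 = 0. Proof. by rewrite /walk big_ord0. Qed.

Lemma walkS p n : walk p n.+1 = walk p n + p n.
Proof. by rewrite /walk big_ord_recr. Qed.

Lemma walk_shift p k n :
  walk (fun j => p (k + j)%N) n = walk p (k + n)%N - walk p k.
Proof. by apply/eqP; rewrite eq_sym subr_eq addrC /walk big_split_ord. Qed.

Lemma walk_norm p n rho : (forall j, `|p j| <= rho) -> `|walk p n| <= n%:R * rho.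
Proof.
move=> h; apply: (le_trans (ler_norm_sum _ _ _)).
rewrite -[n in n%:R]card_ord -sum1_card natr_sum mulr_suml.
by apply: ler_sum => i _; rewrite mul1r.
Qed.

Lemma stays_mono a n m : (m <= n)%N -> stays a n `<=` stays a m.
Proof. by move=> mn p h k km; apply: h; exact: leq_trans mn. Qed.

Lemma stays_block r n k p : stays r (k + n)%N p ->
  stays r k p /\ stays (2 * r) n (fun j => p (k + j)%N).
Proof.
move=> h; split; first by apply: stays_mono h; exact: leq_addr.
move=> j jn; rewrite walk_shift.
have := h (k + j)%N; rewrite leq_add2l => /(_ jn) h1.
have h2 := h k (leq_addr n k).
by apply: (le_trans (ler_normB _ _)); lra.
Qed.

Lemma stays_increment r n p j : stays r n p -> (j < n)%N -> `|p j| <= 2 * r.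
Proof.
move=> h jn; have h1 := h _ jn; have h2 := h j (ltnW jn).
rewrite (_ : p j = walk p j.+1 - walk p j); last by rewrite walkS addrC addKr.
by apply: (le_trans (ler_normB _ _)); lra.
Qed.

Lemma not_stays t n p :
  (~ stays t n p) <-> exists k, (k <= n)%N /\ first_exit t k p.
Proof.
split.
  move=> ns; have ex : exists k, (k <= n)%N && (t < `|walk p k|).
    apply: contrapT => ne; apply: ns => k kn; rewrite leNgt; apply/negP => tk.
    by apply: ne; exists k; rewrite kn.
  case: (ex_minnP ex) => k /andP[kn tk] mink; exists k; split => //; split => // i ik.
  rewrite leNgt; apply/negP => ti.
  have := mink i; rewrite ti andbT (leq_trans (ltnW ik) kn) => /(_ isT).
  by rewrite leqNgt ik.
move=> [k [kn [_ tk]]] h; have := h k kn; by rewrite leNgt tk.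
Qed.

(** At its first exit from radius [t] the walk has norm at most [t + rho], being one increment
    beyond the ball. Were the restarted walk confined to radius [a], the whole walk would remain
    within [t + rho + a]. *)
Lemma first_exit_restart a t rho n p : 0 <= t -> (forall j, `|p j| <= rho) ->
  ~ stays (t + (a + rho)) n p -> 0 <= a + rho ->
  exists k, [/\ (k <= n)%N, first_exit t k p & ~ stays a n (fun j => p (k + j)%N)].
Proof.
move=> t0 prho ns ar0.
have ns' : ~ stays t n p by move=> h; apply: ns => k kn; apply: le_trans (h k kn) _; lra.
move/not_stays : ns' => [k [kn fk]]; exists k; split => // hs.
apply: ns => i iN; case: (ltnP i k) => ik.
  by case: fk => /(_ i ik) h _; lra.
have wk : `|walk p k| <= t + rho.
  case: k kn fk hs ik => [|k] kn fk _ _.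
    by rewrite walk0 normr0; have := normr_ge0 (p 0%N); have := prho 0%N; lra.
  rewrite walkS; apply: (le_trans (ler_normD _ _)).
  by case: fk => /(_ k (ltnSn k)) h _; have := prho k; lra.
have := hs (i - k)%N (leq_trans (leq_subr _ _) iN).
rewrite walk_shift subnKC// => h.
rewrite -(subrK (walk p k) (walk p i)).
by apply: (le_trans (ler_normD _ _)); lra.
Qed.

(** A discrete layer-cake formula for the square: the odd numbers 2j + 1 with j < x add up to the
    square of the ceiling of x. *)
Lemma sum_odd_indicator (x : R) n : 0 <= x -> x <= n%:R ->
  x ^+ 2 <= \sum_(j < n) (2 * j%:R + 1) * (j%:R < x)%R%:R.
Proof.
move=> x0; elim: n => [|n IH] xn.
  have -> : x = 0 by apply/eqP; rewrite eq_le x0 andbT.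
  by rewrite big_ord0 expr0n.
case: (lerP x n%:R) => xn'.
  by apply: (le_trans (IH xn')); rewrite big_ord_recr /= lerDl !mulr_ge0// addr_ge0// mulr_ge0.
rewrite (eq_bigr (fun j : 'I_n.+1 => 2 * j%:R + 1)); last first.
  move=> j _; rewrite (_ : j%:R < x) ?mulr1//; apply: le_lt_trans xn'.
  by rewrite ler_nat -ltnS.
have -> : \sum_(j < n.+1) (2 * j%:R + 1) = (n.+1%:R : R) ^+ 2.
  elim: (n.+1) => [|m IHm]; first by rewrite big_ord0 expr0n.
  by rewrite big_ord_recr /= IHm -natr1; ring.
by rewrite ler_pXn2r// nnegrE.
Qed.

(** The full series equals 6; this is the 6 in [walk_second_moment]. *)
Lemma sum_odd_geometric n : \sum_(j < n) (2 * j%:R + 1) * 2^-1 ^+ j <= (6 : R).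
Proof.
suff -> : \sum_(j < n) (2 * j%:R + 1) * 2^-1 ^+ j = 6 - (4 * n%:R + 6) * 2^-1 ^+ n :> R.
  by rewrite lerBlDr lerDl mulr_ge0// ?exprn_ge0// ?invr_ge0// addr_ge0// mulr_ge0.
elim: n => [|n IH]; first by rewrite big_ord0 expr0; lra.
by rewrite big_ord_recr /= IH exprS -natr1; field.
Qed.

Hypothesis sepB : separable B.

Lemma rv_walk (D : set nat) n : `I_n `<=` D ->
  random_variable (fun p : @path R B nat D => walk p n).
Proof.
move=> nD; apply: (@rv_sum _ _ sepB _ _ _ _ _ (fun (j : 'I_n) (p : @path R B nat D) => p j)) => j _.
by apply: rv_coord; apply: nD; exact: ltn_ord.
Qed.

Lemma measurable_walk_le (D : set nat) n a : `I_n `<=` D ->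
  measurable ([set p | `|walk p n| <= a] : set (@path R B nat D)).
Proof.
move=> nD; have := rv_norm (rv_walk nD) measurableT (measurable_itv `]-oo, a]).
by rewrite setTI; congr measurable; apply/seteqP; split => p /=; rewrite in_itv.
Qed.

Lemma measurable_stays (D : set nat) n a : `I_n `<=` D ->
  measurable (stays a n : set (@path R B nat D)).
Proof.
move=> nD; rewrite (_ : stays a n = \bigcap_(k in `I_n.+1) [set p | `|walk p k| <= a]).
  apply: fin_bigcap_measurable; first exact: finite_II.
  move=> k /= kn; apply: measurable_walk_le => j /= jk; apply: nD => /=.
  exact: leq_trans jk _.
by apply/seteqP; split => p h k /=; [rewrite ltnS => /h|move=> kn; apply: h].
Qed.

Lemma measurable_first_exit (D : set nat) k t : `I_k `<=` D ->
  measurable (first_exit t k : set (@path R B nat D)).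
Proof.
move=> kD; rewrite (_ : first_exit t k =
  (\bigcap_(i in `I_k) [set p | `|walk p i| <= t]) `&` ~` [set p | `|walk p k| <= t]).
  apply: measurableI.
    apply: fin_bigcap_measurable; first exact: finite_II.
    move=> i /= ik; apply: measurable_walk_le => j /= ji; apply: kD => /=.
    exact: ltn_trans ik.
  by apply: measurableC; exact: measurable_walk_le.
by apply/seteqP; split => p /= [h1 h2]; split => //; rewrite ?ltNge; apply/negP; rewrite -?ltNge.
Qed.

Section iid.
Context d (T : measurableType d) (P : probability T R) (X : nat -> T -> B).
Hypotheses (mX : forall i, random_variable (X i)) (indX : mutually_independent P X).
Hypothesis law : forall i (A : set (borel B)), measurable A ->
  P (X i @^-1` A) = P (X 0%N @^-1` A).

Definition on_path (E : set (nat -> B)) : set T := [set w | E (X^~ w)].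

Lemma measurable_on_path (E : set (nat -> B)) :
  measurable (E : set (@path R B nat setT)) -> measurable (on_path E).
Proof. exact: measurable_sample_preimage. Qed.

Lemma measurable_on_stays a n : measurable (on_path (stays a n)).
Proof. by apply: measurable_on_path; exact: measurable_stays. Qed.

(** Both the start of a block and all its later points lie within [r] of the origin, so the block
    restarted at 0 stays within [2 * r]. The doubling does not accumulate: the past keeps radius [r]
    in the induction. *)
Lemma stays_block_prob r n k :
  (P (on_path (stays r (k * n)%N)) <= P (on_path (stays (2 * r) n)) ^+ k)%E.
Proof.
elim: k => [|k IH]; first by rewrite expe0; exact: probability_le1 (measurable_on_stays _ _).
rewrite expeS mulSnr muleC.
apply: (@le_trans _ _ (P [set w | stays r (k * n) (X^~ w) /\
    stays (2 * r) n (fun j => X (k * n + j)%N w)])).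
  apply: le_measure; rewrite ?inE; first exact: measurable_on_stays.
    apply: measurableI; first exact: measurable_on_stays.
    apply: (@measurable_sample_preimage _ _ _ _ _ (fun j => X (k * n + j)%N) _ setT) => //.
    exact: measurable_stays.
  by move=> w; exact: stays_block.
rewrite markov_property//; last 2 first.
- exact: measurable_stays.
- exact: measurable_stays.
by apply: lee_wpmul2r.
Qed.

(* Restart at the first exit from the ball of radius [t], which overshoots by at most [rho]. *)
Lemma exit_tail_step a t rho n : 0 <= t -> 0 <= a + rho ->
  (forall j w, `|X j w| <= rho) ->
  (P (~` on_path (stays (t + (a + rho)) n)) <=
   P (~` on_path (stays a n)) * P (~` on_path (stays t n)))%E.
Proof.
move=> t0 ar0 Xrho.
have mE k : measurable (on_path (first_exit t k)).
  by apply: measurable_on_path; exact: measurable_first_exit.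
pose F k := [set w | first_exit t k (X^~ w) /\ (~` stays a n) (fun j => X (k + j)%N w)].
have mS : measurable (~` stays a n : set (@path R B nat setT)).
  by apply: measurableC; exact: measurable_stays.
have mF k : measurable (F k).
  apply: measurableI; first exact: mE.
  exact: (measurable_sample_preimage (fun j => mX (k + j)%N) mS).
apply: (@le_trans _ _ (P (\big[setU/set0]_(k < n.+1) F k))).
  apply: le_measure; rewrite ?inE.
  - by apply: measurableC; exact: measurable_on_stays.
  - by apply: bigsetU_measurable.
  move=> w /= h; have [k [kn fk sk]] := first_exit_restart t0 (Xrho^~ w) h ar0.
  by rewrite -bigcup_mkord; exists k.
apply: (le_trans (Boole_inequality P _)) => //.
have FE k : P (F k) = (P (on_path (first_exit t k)) * P (~` on_path (stays a n)))%E.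
  rewrite /F markov_property//.
  exact: measurable_first_exit.
rewrite (eq_bigr (fun k : 'I_n.+1 => P (on_path (first_exit t k)) * P (~` on_path (stays a n)))%E (fun k _ => FE k)).
rewrite -ge0_sume_distrl// muleC lee_wpmul2l//.
(* First exits at different times exclude each other, so their probabilities add up to at most that
   of leaving radius [t] by time [n]. *)
have tE : trivIset setT (fun k => on_path (first_exit t k)).
  move=> i j _ _ [w [[hi ti] [hj tj]]]; apply/eqP; rewrite eqn_leq; apply/andP; split.
    by rewrite leqNgt; apply/negP => /hi; rewrite leNgt tj.
  by rewrite leqNgt; apply/negP => /hj; rewrite leNgt ti.
apply: (@le_trans _ _ (P (\big[setU/set0]_(k < n.+1) on_path (first_exit t k)))).
  by rewrite (measure_bigsetU _ mE tE).
apply: le_measure; rewrite ?inE.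
- by apply: bigsetU_measurable.
- by apply: measurableC; exact: measurable_on_stays.
rewrite -(bigcup_mkord n.+1 (fun k => on_path (first_exit t k))) => w [k /= kn fk].
apply/not_stays.
by exists k.
Qed.

Lemma exit_tail a rho n : 0 <= a + rho ->
  (forall j w, `|X j w| <= rho) ->
  (2^-1%:E <= P (on_path (stays a n)))%E -> forall j,
  (P (~` on_path (stays (j%:R * (a + rho)) n)) <= (2^-1 ^+ j)%:E)%E.
Proof.
move=> ar0 Xrho half; elim=> [|j IH].
  rewrite expr0; apply: probability_le1; apply: measurableC; exact: measurable_on_stays.
rewrite -natr1 mulrDl mul1r.
apply: (le_trans (exit_tail_step _ _ ar0 Xrho)); first by rewrite mulr_ge0.
rewrite exprS EFinM; apply: lee_pmul => //.
rewrite probability_setC; last exact: measurable_on_stays.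
rewrite leeBlDr; last by rewrite fin_num_measure//; exact: measurable_on_stays.
apply: (@le_trans _ _ (2^-1%:E + 2^-1%:E)%E); last by rewrite leeD2l.
by rewrite -EFinD lee_fin; lra.
Qed.

(** Each further multiple of [a + rho] halves the tail of the maximum, so the layer-cake sum in
    units of [a + rho] is bounded independently of [n]. *)
Lemma walk_second_moment a rho n : 0 < a + rho -> 0 <= a ->
  (forall j w, `|X j w| <= rho) ->
  (2^-1%:E <= P (on_path (stays a n)))%E ->
  (\int[P]_w (`|walk (X^~ w) n| ^+ 2)%:E <= (6 * (a + rho) ^+ 2)%:E)%E.
Proof.
move=> u0 a0 Xrho half; set u := a + rho.
have mS : random_variable (fun w => walk (X^~ w) n) by exact: (rv_sum sepB).
have w0 (j : nat) : 0 <= u ^+ 2 * (2 * j%:R + 1) by rewrite mulr_ge0 ?sqr_ge0// addr_ge0// mulr_ge0.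
pose A j : set T := ~` [set w | `|walk (X^~ w) n| <= j%:R * u].
have mA j : measurable (A j).
  apply: measurableC; apply: (@measurable_on_path [set p | `|walk p n| <= j%:R * u]).
  exact: measurable_walk_le.
have PA j : (P (A j) <= (2^-1 ^+ j)%:E)%E.
  apply: le_trans (exit_tail (ltW u0) Xrho half j).
  apply: le_measure; rewrite ?inE//.
    by apply: measurableC; exact: measurable_on_stays.
  by move=> w hw h; apply: hw; exact: h.
apply: (@le_trans _ _ (\int[P]_w (\sum_(j < n) (u ^+ 2 * (2 * j%:R + 1)) * \1_(A j) w)%:E)%E).
  apply: ex_le.
  - exact: rv_normX.
  - by apply: measurable_sum => j; apply: measurable_funM => //; exact: measurable_indic.
  - by move=> w; exact: sqr_ge0.
  (* The first [n] layers suffice, since |S_n| <= n rho <= n u. *)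
  - move=> w; have xn : `|walk (X^~ w) n| / u <= n%:R.
      rewrite ler_pdivrMr//; apply: (le_trans (walk_norm _ (Xrho^~ w))).
      by rewrite ler_wpM2l// /u; lra.
    have := sum_odd_indicator (divr_ge0 (normr_ge0 _) (ltW u0)) xn.
    rewrite expr_div_n ler_pdivrMr ?exprn_gt0// mulrC mulr_sumr => h.
    apply: (le_trans h); apply: ler_sum => j _; rewrite mulrA ler_wpM2l//.
    rewrite indicE ler_nat; case: ltP => //= h1.
    rewrite lt0b; apply/mem_set => /= hle.
    by move: h1; rewrite ltr_pdivlMr// ltNge hle.
rewrite ex_sum; last 2 first.
- by move=> j; apply: measurable_funM => //; exact: measurable_indic.
- by move=> j w; rewrite mulr_ge0// indicE.
apply: (@le_trans _ _ (\sum_(j < n) (u ^+ 2 * (2 * j%:R + 1) * 2^-1 ^+ j)%:E)%E).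
  apply: lee_sum => j _; rewrite exZ; last 3 first.
  - exact: measurable_indic.
  - by [].
  - by move=> w; rewrite indicE.
  by rewrite ex_indic// [leRHS]EFinM lee_wpmul2l// lee_fin.
rewrite sumEFin lee_fin.
under eq_bigr do rewrite -mulrA.
by rewrite -mulr_sumr mulrC ler_wpM2r ?sqr_ge0// sum_odd_geometric.
Qed.

End iid.
End walks.

(** * Truncated moments and the comparison of [h] at the scales s and 4s *)

Section truncation.
Context {R : realType} {B : completeNormedModType R}.
Hypothesis sepB : separable B.
Implicit Types s t : R.

Definition trunc (s : R) (x : borel B) : borel B := \1_[set y : B | `|y| <= s] x *: (x : B).

Lemma truncE s (x : B) : trunc s x = if `|x| <= s then x else 0.
Proof.
rewrite /trunc indicE; case: ifPn => h.
  by rewrite mem_set// scale1r.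
by rewrite memNset ?scale0r//=; apply/negP.
Qed.

Lemma measurable_trunc s : measurable_fun setT (trunc s).
Proof.
apply: (@rv_indic _ _ _ (borel B) id); last exact: measurable_id.
have := @measurable_normB R B measurableT _ (measurable_itv `]-oo, s]).
by rewrite setTI; congr measurable; apply/seteqP; split => p /=; rewrite in_itv.
Qed.

Lemma trunc_norm s (x : B) : 0 <= s -> `|trunc s x : B| <= s.
Proof. by move=> s0; rewrite truncE; case: ifPn => // _; rewrite normr0. Qed.

Section one_space.
Context d (T : measurableType d) (P : probability T R) (X : T -> B).
Hypothesis mX : random_variable X.

Lemma ex_le_cst (f : T -> R) (M : R) : measurable_fun setT f ->
  (forall w, 0 <= f w) -> (forall w, f w <= M) ->
  (\int[P]_w (f w)%:E <= M%:E)%E.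
Proof. by move=> mf f0 fM; rewrite -(ex_cst P M); apply: ex_le. Qed.

Lemma ex_fin (f : T -> R) (M : R) : measurable_fun setT f ->
  (forall w, 0 <= f w) -> (forall w, f w <= M) ->
  (\int[P]_w (f w)%:E = (fine (\int[P]_w (f w)%:E))%:E)%E.
Proof.
move=> mf f0 fM; rewrite fineK// ge0_fin_numE ?ex_ge0//.
exact: le_lt_trans (ex_le_cst mf f0 fM) (ltry _).
Qed.

Definition trunc_moment s : R := fine (\int[P]_w (`|trunc s (X w) : B| ^+ 2)%:E).

Lemma rv_trunc s : random_variable (fun w => trunc s (X w) : B).
Proof. exact: (rv_comp (measurable_trunc s) mX). Qed.

Lemma trunc_sqr s (x : B) : 0 <= s -> `|trunc s x : B| ^+ 2 <= s ^+ 2.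
Proof. by move=> s0; rewrite ler_pXn2r ?nnegrE// trunc_norm. Qed.

Lemma trunc_momentE s : 0 <= s ->
  (\int[P]_w (`|trunc s (X w) : B| ^+ 2)%:E = (trunc_moment s)%:E)%E.
Proof.
move=> s0; apply: (@ex_fin _ (s ^+ 2)).
- by apply: rv_normX; exact: rv_trunc.
- by move=> w; exact: sqr_ge0.
- by move=> w; exact: trunc_sqr.
Qed.

Lemma trunc_moment_ge0 s : 0 <= trunc_moment s.
Proof. by apply: fine_ge0; apply: ex_ge0 => w; exact: sqr_ge0. Qed.

Lemma trunc_moment_le s t : 0 <= s -> s <= t -> trunc_moment s <= trunc_moment t.
Proof.
move=> s0 st; rewrite -lee_fin -!trunc_momentE//; last exact: le_trans st.
apply: ex_le.
- by apply: rv_normX; exact: rv_trunc.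
- by apply: rv_normX; exact: rv_trunc.
- by move=> w; exact: sqr_ge0.
- move=> w; rewrite !truncE; case: ifPn => [h|_]; last by rewrite normr0 expr0n sqr_ge0.
  by rewrite (le_trans h st).
Qed.

Lemma truncKE s : truncK P X s = s ^- 2 * trunc_moment s.
Proof.
rewrite /truncK /trunc_moment /Rintegral integral_mkcond; congr (_ * fine _).
apply: eq_integral => w _; rewrite /patch truncE.
case: ifPn => [/set_mem /= -> //|/negP wn]; case: ifPn => [ws|_].
  by exfalso; apply: wn; exact: mem_set.
by rewrite normr0 expr0n.
Qed.

Lemma trunc_expectation s : 0 <= s ->
  has_expectation P (fun w => trunc s (X w) : B) (s *: truncM P X s).
Proof.
move=> s0; have [v hv] := has_expectation_bounded sepB P (rv_trunc s) (fun w => trunc_norm (X w) s0).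
rewrite /truncM (_ : (fun w => _) = (fun w => trunc s (X w) : B)); last first.
  by apply/funext => w; rewrite /trunc !indicE.
rewrite (BexpectationE sepB hv) scalerA.
(* At [s = 0] the factor [s^-1] of [truncM] cannot be cancelled, but there the truncation is the
   zero map. *)
have [->|sn0] := eqVneq s 0; last by rewrite divff// scale1r.
rewrite mul0r scale0r.
rewrite (_ : (fun w => _) = cst 0); first exact: has_expectation_cst.
apply/funext => w; apply/eqP; rewrite -normr_le0.
exact: trunc_norm.
Qed.

Lemma measurable_tail s : measurable [set w | s < `|X w|].
Proof.
have := rv_norm mX measurableT (measurable_itv `]s, +oo[).
by rewrite setTI; congr measurable; apply/seteqP; split => p /=; rewrite in_itv /= andbT.
Qed.

Lemma tailGE s : P [set w | s < `|X w|] = (tailG P X s)%:E.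
Proof. by rewrite /tailG fineK// fin_num_measure//; exact: measurable_tail. Qed.

Lemma tailG_ge0 s : 0 <= tailG P X s. Proof. exact: fine_ge0. Qed.

Lemma tailG_le1 s : tailG P X s <= 1.
Proof. by rewrite -lee_fin -tailGE; apply: probability_le1; exact: measurable_tail. Qed.

Lemma truncK_ge0 s : 0 <= truncK P X s.
Proof. by rewrite truncKE mulr_ge0 ?trunc_moment_ge0// invr_ge0 sqr_ge0. Qed.

Lemma truncK_le1 s : 0 < s -> truncK P X s <= 1.
Proof.
move=> s0; rewrite truncKE mulrC ler_pdivrMr ?exprn_gt0// mul1r.
rewrite -lee_fin -trunc_momentE; last exact: ltW.
apply: ex_le_cst.
- by apply: rv_normX; exact: rv_trunc.
- by move=> w; exact: sqr_ge0.
- by move=> w; apply: trunc_sqr; exact: ltW.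
Qed.

Lemma truncM_le1 s : 0 < s -> `|truncM P X s| <= 1.
Proof.
move=> s0; have := has_expectation_norm sepB (trunc_expectation (ltW s0)).
rewrite normrZ gtr0_norm// => h.
have : ((s * `|truncM P X s|)%:E <= s%:E)%E.
  apply: (le_trans h); apply: ex_le_cst => //.
    by apply: rv_norm; exact: rv_trunc.
  by move=> w; apply: trunc_norm; exact: ltW.
by rewrite lee_fin ger_pMr.
Qed.

Lemma h_le3 s : 0 < s -> h P X s <= 3.
Proof.
move=> s0; rewrite /h; have := tailG_le1 s; have := truncK_le1 s0.
have := truncM_le1 s0; lra.
Qed.

Lemma h_ge0 s : 0 <= h P X s.
Proof. by rewrite /h !addr_ge0// ?tailG_ge0 ?truncK_ge0. Qed.

(** Vanishing of [tailG] and [truncK] already forces X = 0 almost surely. Nondegeneracy thus keeps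
    the divisions by [h] in the exit bounds genuine. *)
Lemma h_gt0 s : 0 < s -> nondegenerate P X -> 0 < h P X s.
Proof.
move=> s0 nd; rewrite lt_neqAle h_ge0 andbT; apply/eqP => h0; apply: nd; exists 0.
have [G0 K0] : tailG P X s = 0 /\ truncK P X s = 0.
  have := tailG_ge0 s; have := truncK_ge0 s; have := normr_ge0 (truncM P X s).
  move: h0; rewrite /h => h0 *; split; lra.
have m0 : trunc_moment s = 0.
  by apply/eqP; move/eqP: K0; rewrite truncKE mulf_eq0 invr_eq0 expf_eq0 /= gt_eqF.
have m0' := trunc_momentE (ltW s0).
have mt : measurable_fun setT (fun w => (`|trunc s (X w) : B| ^+ 2)%:E).
  by apply/measurable_EFinP; apply: rv_normX; exact: rv_trunc.
have ae0 : ae_eq P setT (fun w => (`|trunc s (X w) : B| ^+ 2)%:E) (cst 0%E).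
  apply/(ae_eq_integral_abs P measurableT mt).
  rewrite -[RHS]/(0%:E) -m0 -m0'; apply: eq_integral => w _.
  by rewrite gee0_abs// lee_fin sqr_ge0.
have aeT : \forall w \ae P, ~ (s < `|X w|).
  exists [set w | s < `|X w|]; split.
  - exact: measurable_tail.
  - by rewrite tailGE G0.
  - by move=> w /= /contrapT.
move: ae0 aeT; apply: filterS2 => w /= h1 h2.
have := h1 I; rewrite truncE leNgt; move/negP: h2 => -> /= [] /eqP.
by rewrite sqrf_eq0 normr_eq0 => /eqP.
Qed.

(** Values of norm between s and 4s are handled by Chebyshev's inequality at level s; expressing the
    moment through [truncK] at 4s produces 16 = 4^2. *)
Lemma tailG_trunc s : 0 < s -> tailG P X s <= tailG P X (4 * s) + 16 * truncK P X (4 * s).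
Proof.
move=> s0; have s40 : 0 < 4 * s by lra.
rewrite -lee_fin -tailGE EFinD truncKE.
rewrite (_ : 16 * _ = s ^- 2 * trunc_moment (4 * s)); last by field; rewrite gt_eqF.
have s20 : 0 <= s ^- 2 by rewrite invr_ge0 sqr_ge0.
rewrite EFinM -(trunc_momentE (ltW s40)) -exZ//; last first.
  by apply: rv_normX; exact: rv_trunc.
rewrite -tailGE -!ex_indic; try exact: measurable_tail.
rewrite -exD; last 4 first.
- by apply: measurable_indic; exact: measurable_tail.
- by apply: measurable_funM => //; apply: rv_normX; exact: rv_trunc.
- by move=> w; rewrite indicE.
- by move=> w; rewrite mulr_ge0 ?sqr_ge0.
apply: ex_le.
- by apply: measurable_indic; exact: measurable_tail.
- apply: measurable_funD; first by apply: measurable_indic; exact: measurable_tail.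
  by apply: measurable_funM => //; apply: rv_normX; exact: rv_trunc.
- by move=> w; rewrite indicE.
move=> w; rewrite truncE !indicE; case: (ltP s `|X w|) => h1; last first.
  by rewrite memNset ?addr_ge0 ?mulr_ge0 ?sqr_ge0//= ltNge h1.
rewrite mem_set//; case: ifPn => h2; last first.
  by rewrite mem_set ?normr0 ?expr0n ?mulr0 ?addr0//= ltNge.
rewrite memNset ?add0r; last by rewrite /= ltNge h2.
by rewrite mulrC ler_pdivlMr ?exprn_gt0// mul1r ler_pXn2r ?nnegrE// ltW.
Qed.

(** The two truncations differ only where s < |X| <= 4s, and there by at most 4s; dividing by s
    gives both factors 4. *)
Lemma truncM_scale s : 0 < s ->
  `|truncM P X s| <= 4 * `|truncM P X (4 * s)| + 4 * tailG P X s.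
Proof.
move=> s0; have s40 : 0 < 4 * s by lra.
have hd := has_expectationB sepB (trunc_expectation (ltW s40)) (trunc_expectation (ltW s0)).
have h1 := has_expectation_norm sepB hd.
have h2 : (`|(4 * s) *: truncM P X (4 * s) - s *: truncM P X s|%:E <=
    ((4 * s) * tailG P X s)%:E)%E.
  apply: (le_trans h1); rewrite EFinM -tailGE -ex_indic; last exact: measurable_tail.
  rewrite -exZ//; [|by apply: measurable_indic; exact: measurable_tail|exact: ltW].
  apply: ex_le => //.
  - by apply: rv_norm; apply: rv_sub => //; exact: rv_trunc.
  - by apply: measurable_funM => //; apply: measurable_indic; exact: measurable_tail.
  move=> w; rewrite !truncE indicE; case: (ltP s `|X w|) => h3; last first.
    rewrite (le_trans h3); last by lra.
    by rewrite subrr normr0 mulr_ge0//; exact: ltW.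
  rewrite mem_set// mulr1 subr0; case: ifPn => // _.
  by rewrite normr0 ltW.
move: h2; rewrite lee_fin => h2.
have h3 := lerB_dist (s *: truncM P X s) ((4 * s) *: truncM P X (4 * s)).
rewrite distrC in h2.
have : `|s *: truncM P X s| <= `|(4 * s) *: truncM P X (4 * s)| + (4 * s) * tailG P X s.
  by rewrite -lerBlDl; exact: le_trans h3 h2.
rewrite (normrZ s) (normrZ (4 * s)) (gtr0_norm s0) (gtr0_norm s40) => h4.
rewrite -(ler_pM2l s0); apply: (le_trans h4).
by rewrite le_eqVlt; apply/orP; left; apply/eqP; ring.
Qed.

(** [h] has no monotonicity to appeal to, so its parts are compared separately. The worst
    coefficient is that of [truncK] at 4s: 16 directly and 5 times 16 through the tail, which occurs
    once in [h] and four times in the bound for [truncM]. *)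
Lemma h_scale s : 0 < s -> h P X s <= 96 * h P X (4 * s).
Proof.
move=> s0; have h1 := tailG_trunc s0; have h2 := truncM_scale s0.
have h3 : truncK P X s <= 16 * truncK P X (4 * s).
  rewrite !truncKE (_ : 16 * _ = s ^- 2 * trunc_moment (4 * s)); last by field; rewrite gt_eqF.
  rewrite ler_wpM2l ?invr_ge0 ?sqr_ge0//; apply: trunc_moment_le; first exact: ltW.
  by rewrite ler_peMl ?ltW// ltr1n.
have key (g k m g4 k4 m4 : R) : 0 <= g4 -> 0 <= k4 -> 0 <= m4 ->
  g <= g4 + 16 * k4 -> m <= 4 * m4 + 4 * g -> k <= 16 * k4 ->
  g + k + m <= 96 * (g4 + k4 + m4) by clear; lra.
by apply: key h1 h2 h3; rewrite ?tailG_ge0 ?truncK_ge0.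
Qed.

End one_space.
End truncation.

(** Induction step for (1 - G)^n (1 + n G) <= 1. *)
Lemma bernoulli_step (R : realFieldType) (a G : R) : 0 <= a ->
  (1 - G) * (1 + (a + 1) * G) <= 1 + a * G.
Proof.
move=> a0; have : 0 <= (a + 1) * G ^+ 2 by rewrite mulr_ge0 ?sqr_ge0// addr_ge0.
by move=> h; rewrite -subr_ge0 (_ : 1 + a * G - _ = (a + 1) * G ^+ 2)//; ring.
Qed.

Lemma exit_half_arith (R : realFieldType) (a b c k : R) : a <= 1 -> b <= 27 + k ->
  c <= 4 -> a + b + c <= 32 + k.
Proof. lra. Qed.

Lemma sqr_normD (R : realType) (B : completeNormedModType R) (a b : B) : `|a + b| ^+ 2 <= 2 * `|a| ^+ 2 + 2 * `|b| ^+ 2.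
Proof.
apply: (@le_trans _ _ ((`|a| + `|b|) ^+ 2)).
  by rewrite ler_pXn2r ?nnegrE ?addr_ge0// ler_normD.
move: (`|a|) (`|b|) => u v.
by rewrite -subr_ge0 (_ : _ - _ = (u - v) ^+ 2) ?sqr_ge0//; ring.
Qed.

(** * Cotype 2 applied to the centred truncated increments of a confined walk *)

Section exit_from_cotype.
Context {R : realType} {B : completeNormedModType R}.
Hypothesis sepB : separable B.
Context d (T : measurableType d) (P : probability T R) (X : T -> B).
Context d' (T' : measurableType d') (P' : probability T' R) (Xs : nat -> T' -> B).
Hypothesis mX : random_variable X.
Hypothesis copies : independent_copies P X P' Xs.
Variables (c r : R) (n : nat).
Hypotheses (cotype : cotype2_constant B c) (r0 : 0 < r) (n1 : (1 <= n)%N).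
Hypothesis half : (2^-1%:E <= P' (on_path Xs (stays (2 * r) n)))%E.

(** Twice the radius [2 * r] of the confinement: on that event no increment exceeds [s], so the
    truncated walk coincides with the original one up to time [n]. *)
Let s := 4 * r.
Let Y j w : B := trunc s (Xs j w).

Let s0 : 0 < s. Proof. by rewrite mulr_gt0. Qed.
Let mXs j : random_variable (Xs j). Proof. by case: copies. Qed.
Let lawX j (A : set (borel B)) : measurable A -> P' (Xs j @^-1` A) = P (X @^-1` A).
Proof. by case: copies => _ _; apply. Qed.
Let mY j : random_variable (Y j). Proof. exact: rv_trunc. Qed.
Let indY : mutually_independent P' Y.
Proof.
case: copies => _ ind _.
by apply: (mutually_independent_comp (f := id)) ind => //; exact: measurable_trunc.
Qed.
Let lawY j (A : set (borel B)) : measurable A -> P' (Y j @^-1` A) = P' (Y 0%N @^-1` A).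
Proof.
move=> mA; have mtA : measurable (trunc s @^-1` A).
  by rewrite -[X in measurable X]setTI; exact: measurable_trunc.
have e i : Y i @^-1` A = Xs i @^-1` (trunc s @^-1` A) by [].
by rewrite !e !lawX.
Qed.
Let Ys j w : `|Y j w| <= s. Proof. by apply: trunc_norm; exact: ltW. Qed.

Let Yhalf : (2^-1%:E <= P' (on_path Y (stays (2 * r) n)))%E.
Proof.
apply: (le_trans half); apply: le_measure; rewrite ?inE.
- exact: measurable_on_stays.
- exact: measurable_on_stays.
move=> w h; have e k : (k <= n)%N -> walk (Y^~ w) k = walk (Xs^~ w) k.
  move=> kn; apply: eq_bigr => j _; rewrite /Y truncE.
  have -> // : `|Xs j w| <= s.
  apply: (le_trans (stays_increment h (leq_trans (ltn_ord j) kn))).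
  by rewrite /s mulrA -natrM.
by move=> k kn; rewrite e//; exact: h.
Qed.

Let S w := walk (Y^~ w) n.
Let mS : random_variable S. Proof. exact: (rv_sum sepB). Qed.

(** Radius [2 * r] and increments of norm at most [4 * r] give 6 (2r + 4r)^2 = 216 r^2. *)
Let second_moment : (\int[P']_w (`|S w| ^+ 2)%:E <= (216 * r ^+ 2)%:E)%E.
Proof.
have := walk_second_moment sepB mY indY lawY (_ : 0 < 2 * r + s) (_ : 0 <= 2 * r) Ys Yhalf.
have -> : 6 * (2 * r + s) ^+ 2 = 216 * r ^+ 2 by rewrite /s; ring.
apply; last by rewrite mulr_ge0// ltW.
by rewrite addr_gt0// mulr_gt0.
Qed.

Let m := s *: truncM P X s.

Let EY j : has_expectation P' (Y j) m.
Proof.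
have [v [h1 h2]] := common_expectation sepB mX (mXs j) (@lawX j) (measurable_trunc s)
  (fun x => trunc_norm x (ltW s0)).
by rewrite /m -(has_expectation_unique sepB h1 (trunc_expectation sepB P mX (ltW s0))).
Qed.

Let ES : has_expectation P' S (m *+ n).
Proof.
rewrite -[n in _ *+ n]card_ord -sumr_const.
exact: (@has_expectation_sum _ _ sepB _ _ P' _ _ _ (fun j : 'I_n => Y j)).
Qed.

(** Jensen's inequality: the mean of the sum is [m *+ n], whose squared norm is at most the second
    moment. *)
Let mean_bound : (n%:R * `|m|) ^+ 2 <= 216 * r ^+ 2.
Proof.
rewrite -lee_fin; apply: le_trans second_moment.
apply: ex_sqr_tangent => //; first exact: rv_norm.
have -> : n%:R * `|m| = `|m *+ n| by rewrite normrMn mulr_natl.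
exact: has_expectation_norm ES.
Qed.

Let kap := trunc_moment P X s.
Let EY2 j : (\int[P']_w (`|Y j w| ^+ 2)%:E = kap%:E)%E.
Proof.
rewrite /kap -trunc_momentE ?ltW//.
pose X' : {mfun T >-> borel B} := mfun_Sub (mem_set mX).
have mf : measurable_fun setT (fun x : borel B => `|trunc s x : B| ^+ 2).
  by apply: rv_normX; exact: measurable_trunc.
rewrite (ex_law (P2 := distribution P X') (mXs j) (@lawX j) mf); last by move=> x; exact: sqr_ge0.
by rewrite (ex_law (P1 := P) (P2 := distribution P X') mX _ mf) => // x; exact: sqr_ge0.
Qed.

Let Z (j : 'I_n) w := Y j w - m.
Let mZ j : random_variable (Z j).
Proof. by apply: rv_sub => //; exact: rv_cst. Qed.

Let normB2 (a b : B) : `|a - b| ^+ 2 <= 2 * `|a| ^+ 2 + 2 * `|b| ^+ 2.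
Proof. by rewrite -(normrN b); exact: sqr_normD. Qed.

Let msm : `|m| <= s.
Proof.
have := has_expectation_norm sepB (EY 0).
rewrite -lee_fin => /le_trans; apply; apply: ex_le_cst => //; exact: rv_norm.
Qed.

Let Zbound j w : `|Z j w| ^+ 2 <= 4 * s ^+ 2.
Proof.
apply: (le_trans (normB2 _ _)).
have h1 : `|Y j w| ^+ 2 <= s ^+ 2 by rewrite ler_pXn2r ?nnegrE// ltW.
have h2 : `|m| ^+ 2 <= s ^+ 2 by rewrite ler_pXn2r ?nnegrE// ltW.
lra.
Qed.

Let zeta j := fine (\int[P']_w (`|Z j w| ^+ 2)%:E).
Let zetaE j : (\int[P']_w (`|Z j w| ^+ 2)%:E = (zeta j)%:E)%E.
Proof.
apply: (@ex_fin _ _ _ _ _ (4 * s ^+ 2)).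
- exact: rv_normX.
- by move=> w; exact: sqr_ge0.
- exact: Zbound.
Qed.

(** Centring costs a factor: |S - n m|^2 <= 2 |S|^2 + 2 |n m|^2, and both terms are controlled by
    216 r^2, whence 864 = 4 times 216. *)
Let cotype_applied : c * \sum_(j < n) zeta j <= 864 * r ^+ 2.
Proof.
case: cotype => c0 /(_ n _ _ P' Z n1 mZ) h.
have {}h : (c%:E * \sum_(j < n) \int[P']_w (`|Z j w| ^+ 2)%:E <=
            \int[P']_w (`|\sum_(j < n) Z j w| ^+ 2)%:E)%E.
  apply: h.
  - apply: (mutually_independent_comp (f := @nat_of_ord n) (g := fun x => (x : B) - m)) indY.
      exact: val_inj.
    by apply: (@rv_sub _ _ sepB _ (borel B) id); [exact: measurable_id|exact: rv_cst].
  - move=> j; rewrite -(subrr m); apply: has_expectationB => //.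
    exact: has_expectation_cst.
  - by move=> j; rewrite zetaE ltry.
rewrite (eq_bigr _ (fun j _ => zetaE j)) sumEFin in h; rewrite -lee_fin EFinM; apply: (le_trans h).
apply: (@le_trans _ _ (\int[P']_w (2 * `|S w| ^+ 2 + 2 * (n%:R * `|m|) ^+ 2)%:E)%E).
  apply: ex_le.
  - by apply: rv_normX; apply: (rv_sum sepB).
  - by apply: measurable_funD => //; apply: measurable_funM => //; exact: rv_normX.
  - by move=> w; exact: sqr_ge0.
  move=> w; have -> : \sum_(j < n) Z j w = S w - m *+ n.
    by rewrite /Z sumrB sumr_const card_ord.
  have -> : n%:R * `|m| = `|m *+ n| by rewrite normrMn mulr_natl.
  exact: normB2.
rewrite exD; last 4 first.
- by apply: measurable_funM => //; exact: rv_normX.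
- exact: measurable_cst.
- by move=> w; rewrite mulr_ge0// sqr_ge0.
- by move=> w; rewrite mulr_ge0// sqr_ge0.
rewrite ex_cst exZ//; last exact: rv_normX.
apply: (@le_trans _ _ (2%:E * (216 * r ^+ 2)%:E + (2 * (216 * r ^+ 2))%:E)%E).
  apply: leeD; first by rewrite lee_wpmul2l.
  by rewrite lee_fin ler_wpM2l.
by rewrite -EFinM -EFinD lee_fin; lra.
Qed.

Let kap_bound : n%:R * kap <= 2 * (864 * r ^+ 2 / c) + 2 * (216 * r ^+ 2).
Proof.
have h j : kap <= 2 * zeta j + 2 * `|m| ^+ 2.
  rewrite -lee_fin -(EY2 j) EFinD EFinM -zetaE -exZ//; last exact: rv_normX.
  rewrite -(ex_cst P' (2 * `|m| ^+ 2)) -exD; last 4 first.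
  - by apply: measurable_funM => //; exact: rv_normX.
  - exact: measurable_cst.
  - by move=> w; rewrite mulr_ge0// sqr_ge0.
  - by move=> w; rewrite mulr_ge0// sqr_ge0.
  apply: ex_le.
  - exact: rv_normX.
  - by apply: measurable_funD => //; apply: measurable_funM => //; exact: rv_normX.
  - by move=> w; exact: sqr_ge0.
  move=> w; have := normB2 (Z j w) (- m).
  by rewrite /Z opprK subrK normrN.
have h1 : n%:R * kap <= 2 * \sum_(j < n) zeta j + 2 * (n%:R * `|m| ^+ 2).
  have -> : n%:R * kap = \sum_(j < n) kap by rewrite sumr_const card_ord mulr_natl.
  apply: (le_trans (ler_sum _ (fun j _ => h j))).
  rewrite big_split /= -mulr_sumr sumr_const card_ord -mulrnAr.
  by rewrite [n%:R * _]mulr_natl.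
apply: (le_trans h1); apply: lerD.
  rewrite ler_wpM2l// ler_pdivlMr; last by case: cotype.
  by rewrite mulrC.
rewrite ler_wpM2l//; apply: le_trans mean_bound.
rewrite exprMn ler_wpM2r ?sqr_ge0// -natrX ler_nat.
by rewrite expnS expn1 leq_pmulr.
Qed.

(** On the confinement event none of the [n] independent increments exceeds [s], so 1/2 <= (1 -
    G)^n. Together with (1 - G)^n (1 + n G) <= 1 this gives n G <= 1. *)
Let tail_bound : n%:R * tailG P X s <= 1.
Proof.
set G := tailG P X s.
have G0 : 0 <= G by exact: tailG_ge0.
have G1 : G <= 1 by exact: tailG_le1.
have mN : measurable ([set x | `|x| <= s] : set (borel B)).
  have := @measurable_normB R B measurableT _ (measurable_itv `]-oo, s]).
  by rewrite setTI; congr measurable; apply/seteqP; split => p /=; rewrite in_itv.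
have pE j : P' (Xs j @^-1` [set x | `|x| <= s]) = (1 - G)%:E.
  rewrite lawX// EFinB -tailGE// -probability_setC; last exact: measurable_tail.
  by congr (P _); apply/seteqP; split => w /=; rewrite leNgt => /negP.
have h : (2^-1%:E <= ((1 - G) ^+ n)%:E)%E.
  apply: (le_trans half).
  apply: (@le_trans _ _ (P' (\bigcap_(i in [set` [fset j in iota 0 n]%fset])
      (Xs i @^-1` [set x | `|x| <= s])))).
    apply: le_measure; rewrite ?inE.
    - exact: measurable_on_stays.
    - by apply: fin_bigcap_measurable => // i _; exact: rv_preimage.
    move=> w hw j /=; rewrite !inE mem_iota add0n /= => jn.
    by apply: (le_trans (stays_increment hw jn)); rewrite /s mulrA -natrM.
  case: copies => _ ind _; rewrite ind//.
  under eq_bigr do rewrite pE.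
  rewrite big_const_seq count_predT.
  rewrite (_ : size _ = n).
    rewrite (_ : iter n _ _ = ((1 - G) ^+ n)%:E)//.
    by elim: (n) => [|k IH] //=; rewrite IH exprS EFinM.
  by rewrite -[RHS](size_iota 0); apply/perm_size/uniq_perm; rewrite ?fset_uniq ?iota_uniq// => j; rewrite !inE.
rewrite lee_fin in h.
have h2 k : (1 - G) ^+ k * (1 + k%:R * G) <= 1.
  elim: k => [|k IH]; first by rewrite expr0 mul0r addr0 mulr1.
  apply: le_trans IH; rewrite exprS -mulrA mulrCA ler_wpM2l//.
    by rewrite exprn_ge0// subr_ge0.
  by rewrite -natr1; exact: bernoulli_step.
have := h2 n; have nG0 : 0 <= n%:R * G by rewrite mulr_ge0.
move=> h3; have h4 : 2^-1 * (1 + n%:R * G) <= 1.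
  by apply: le_trans h3; rewrite ler_wpM2r// addr_ge0.
by rewrite mulrC ler_pdivrMr// mul1r [leRHS](_ : _ = 1 + 1)// lerD2l in h4.
Qed.

(** The three parts of [h] contribute 1 from the tail, (1728 / c + 432) / 16 = 108 / c + 27 from the
    truncated second moment, and at most 4, an upper bound for the square root of 216 / 16, from the
    mean. *)
Lemma exit_half_bound : n%:R * h P X (4 * r) <= 32 + 108 / c.
Proof.
have c0 : 0 < c by case: cotype.
have h1 : n%:R * truncK P X s <= 27 + 108 / c.
  rewrite truncKE mulrCA mulrC ler_pdivrMr ?exprn_gt0//.
  apply: (le_trans kap_bound); rewrite le_eqVlt; apply/orP; left; apply/eqP.
  by rewrite /s; field; rewrite gt_eqF.
have h2 : n%:R * `|truncM P X s| <= 4.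
  rewrite -(@ler_pXn2r _ 2) ?nnegrE ?mulr_ge0//.
  have := mean_bound; rewrite /m (normrZ s) (gtr0_norm s0) => h.
  have s20 : 0 < s ^+ 2 by rewrite exprn_gt0.
  rewrite -(ler_pM2r s20) -exprMn mulrAC -mulrA; apply: (le_trans h).
  rewrite -subr_ge0 (_ : _ - _ = 40 * r ^+ 2); last by rewrite /s; ring.
  by rewrite mulr_ge0 ?sqr_ge0.
by rewrite -/s /h !mulrDr; exact: exit_half_arith.
Qed.

End exit_from_cotype.

Lemma ereal_above_nat (R : realType) (x : \bar R) :
  (forall k : nat, (k%:R%:E <= x)%E) -> x = +oo%E.
Proof.
move=> hx; case: x hx => [a| |] // hx; last by have := hx 0.
have a0 : 0 <= a by have := hx 0; rewrite lee_fin.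
by have := hx (Num.bound a); rewrite lee_fin leNgt archi_boundP.
Qed.

Lemma exists_multiple (R : realType) (C h : R) : 0 <= C -> 0 < h ->
  exists N : nat, [/\ (1 <= N)%N, C < N%:R * h & N%:R * h <= C + h].
Proof.
move=> C0 h0; exists (Num.truncn (C / h)).+1.
have /truncn_itv/andP[h1 h2] : 0 <= C / h by rewrite divr_ge0// ltW.
split=> //; first by rewrite -ltr_pdivrMr.
by rewrite -natr1 mulrDl mul1r lerD2r -ler_pdivlMr.
Qed.

(** * Exit times in terms of confinement events *)

Section exit_time.
Context {R : realType} {B : completeNormedModType R}.
Hypothesis sepB : separable B.
Context d (T : measurableType d) (X : nat -> T -> B) (r : R).
Hypotheses (mX : forall j, random_variable (X j)) (r0 : 0 < r).

Lemma exit_time_le w k : (1 <= k)%N -> r < `|walk (X^~ w) k| ->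
  (exit_time X r w <= k%:R%:E)%E.
Proof. by move=> k1 rk; apply: ereal_inf_lbound; exists k. Qed.

Lemma exit_time_le_stays w n : ~ stays r n (X^~ w) -> (exit_time X r w <= n%:R%:E)%E.
Proof.
move=> /not_stays [k [kn [_ rk]]].
apply: (@le_trans _ _ k%:R%:E); last by rewrite lee_fin ler_nat.
(* [exit_time] admits only times at least 1 whereas [stays] also constrains time 0; the walk starts
   at 0 and [r > 0], so time 0 is never an exit. *)
case: k kn rk => [|k] kn rk; last exact: exit_time_le.
by exfalso; move: rk; rewrite walk0 normr0 ltNge ltW.
Qed.

Lemma exit_time_gt w n : (n%:R%:E < exit_time X r w)%E <-> stays r n (X^~ w).
Proof.
split.
  move=> h; apply: contrapT => /exit_time_le_stays h'.
  by move: (lt_le_trans h h'); rewrite ltxx.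
move=> h; apply: (@lt_le_trans _ _ n.+1%:R%:E); first by rewrite lte_fin ltr_nat.
apply: le_ereal_inf_tmp => _ [k [_ rk] <-]; rewrite lee_fin ler_nat ltnNge.
by apply/negP => kn; have := h k kn; rewrite leNgt rk.
Qed.

Lemma exit_time_ge0 w : (0 <= exit_time X r w)%E.
Proof. by apply: le_ereal_inf_tmp => _ [k _ <-]; rewrite lee_fin. Qed.

Lemma measurable_walk n : random_variable (fun w => walk (X^~ w) n).
Proof. exact: (rv_sum sepB). Qed.

Lemma measurable_exit_time : measurable_fun setT (exit_time X r).
Proof.
pose f (k : nat) (w : T) : \bar R := if r < `|walk (X^~ w) k| then k%:R%:E else +oo%E.
have -> : exit_time X r = fun w => einfs (f^~ w) 1.
  apply/funext => w; apply/eqP; rewrite eq_le; apply/andP; split.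
    apply: le_ereal_inf_tmp => _ [k k1 <-]; rewrite /f; case: ifPn => [rk|_].
      exact: exit_time_le.
    exact: leey.
  apply: le_ereal_inf_tmp => _ [k [k1 rk] <-]; apply: ereal_inf_lbound.
  by exists k => //; rewrite /f rk.
apply: measurable_fun_einfs => k.
apply: (measurable_fun_ifT (f := fun w => r < `|walk (X^~ w) k|)) => //.
by apply: measurable_fun_ltr => //; apply: rv_norm; exact: measurable_walk.
Qed.

(** A block form of the identity expressing T as the sum over n >= 0 of the indicators of T > n:
    each block of length [N] that begins before the exit is charged [N]. *)
Lemma exit_time_bound w (N : nat) : (1 <= N)%N ->
  (exit_time X r w <= N%:R%:E * \sum_(k <oo) (\1_(on_path X (stays r (k * N)%N)) w)%:E)%E.
Proof.
move=> N1.
have i0 k : (0 <= (\1_(on_path X (stays r (k * N)%N)) w : R)%:E)%E by rewrite lee_fin indicE.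
have partial K : (forall k, (k < K)%N -> stays r (k * N) (X^~ w)) ->
    (K%:R%:E <= \sum_(k <oo) (\1_(on_path X (stays r (k * N)%N)) w)%:E :> \bar R)%E.
  move=> h; apply: le_trans (nneseries_lim_ge K _) => //.
  rewrite big_mkord sumEFin lee_fin.
  rewrite (eq_bigr (fun=> 1)); first by rewrite sumr_const card_ord.
  by move=> k _; rewrite indicE mem_set//; exact: h.
have [ex|nex] := pselect (exists k, ~ stays r (k * N) (X^~ w)).
  have ex' : exists k, `[< ~ stays r (k * N) (X^~ w) >] by case: ex => k hk; exists k; exact/asboolP.
  case: (ex_minnP ex') => K /asboolP hK minK.
  apply: (le_trans (exit_time_le_stays hK)).
  rewrite mulnC natrM EFinM lee_wpmul2l//; apply: partial => k kK.
  apply: contrapT => hk; have := minK k (asboolT hk).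
  by rewrite leqNgt kK.
rewrite (_ : (\sum_(k <oo) _)%E = +oo%E).
  by rewrite gt0_muley ?leey// lte_fin ltr0n.
apply: ereal_above_nat => K; apply: partial => k _.
by apply: contrapT => hk; apply: nex; exists k.
Qed.

End exit_time.

Section mean_exit.
Context {R : realType} {B : completeNormedModType R}.
Hypothesis sepB : separable B.

(* If [n h(4r) > 32 + 108 / c] then [P(T_2r > n) < 1/2], so [E T_r <= 2 n]; rounding
   [n] up costs [h(4r) <= 3], and [h(r) <= 96 h(4r)]. *)
Definition mean_exit_of_cotype (c : R) : R := 96 * (2 * (35 + 108 / c)).

(** The k-th indicator in [exit_time_bound] has mean at most 2^-k by [stays_block_prob], and the
    geometric series sums to 2. *)
Lemma exit_time_mean d (T : measurableType d) (P : probability T R) (X : nat -> T -> B)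
    (r : R) (N : nat) :
  (forall j, random_variable (X j)) -> mutually_independent P X ->
  (forall i (A : set (borel B)), measurable A -> P (X i @^-1` A) = P (X 0%N @^-1` A)) ->
  0 < r -> (1 <= N)%N -> (P (on_path X (stays (2 * r) N)) <= 2^-1%:E)%E ->
  (\int[P]_w exit_time X r w <= (2 * N%:R)%:E)%E.
Proof.
move=> mX iX law r0 N1 half.
have mi k : measurable_fun setT (fun w => (\1_(on_path X (stays r (k * N)%N)) w : R)%:E).
  by apply/measurable_EFinP; apply: measurable_indic; exact: measurable_on_stays.
apply: (@le_trans _ _ (\int[P]_w (N%:R%:E * \sum_(k <oo) (\1_(on_path X (stays r (k * N)%N)) w)%:E))%E).
  apply: ge0_le_integral => //.
  - by move=> w _; exact: exit_time_ge0.
  - exact: measurable_exit_time.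
  - by apply: emeasurable_funM => //; apply: ge0_emeasurable_sum => // k w _ _; rewrite lee_fin indicE.
  - by move=> w _; exact: exit_time_bound.
rewrite ge0_integralZl//; last 2 first.
- by apply: ge0_emeasurable_sum => // k w _ _; rewrite lee_fin indicE.
- by move=> w _; apply: nneseries_ge0 => k _ _; rewrite lee_fin indicE.
rewrite mulrC EFinM lee_wpmul2l//.
rewrite integral_nneseries//.
apply: lime_le.
  by apply: is_cvg_nneseries => k _ _; apply: integral_ge0 => w _; rewrite lee_fin indicE.
apply: nearW => K; rewrite big_mkord.
apply: (@le_trans _ _ (\sum_(k < K) (2^-1 ^+ k)%:E)%E).
  apply: lee_sum => k _; rewrite ex_indic; last exact: measurable_on_stays.
  apply: (le_trans (stays_block_prob sepB mX iX law r N k)).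
  elim: (k : nat) => [|j IH]; first by rewrite expe0 expr0.
  by rewrite expeS exprS EFinM; apply: lee_pmul => //; exact: expe_ge0.
rewrite sumEFin lee_fin.
suff -> : \sum_(k < K) 2^-1 ^+ k = 2 - 2 * 2^-1 ^+ K :> R.
  by rewrite lerBlDr lerDl mulr_ge0// exprn_ge0.
elim: K => [|K IH]; first by rewrite big_ord0 expr0 mulr1 subrr.
by rewrite big_ord_recr /= IH exprS; field.
Qed.

Lemma cotype_mean_exit (c : R) : cotype2_constant B c ->
  mean_exit_constant B (mean_exit_of_cotype c).
Proof.
move=> hc; have c0 : 0 < c by case: hc.
have C0 : 0 < 108 / c by rewrite divr_gt0.
split; first by rewrite /mean_exit_of_cotype !mulr_gt0// addr_gt0.
move=> d T P X d' T' P' Xs r mX nd cop r0.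
have r40 : 0 < 4 * r by rewrite mulr_gt0.
have h0 : 0 < h P X (4 * r) by exact: h_gt0.
have h30 : h P X (4 * r) <= 3 by exact: h_le3.
have hr0 : 0 < h P X r by exact: h_gt0.
have hsc := h_scale sepB P mX r0.
case: (cop) => mXs ind law.
have law' i (A : set (borel B)) : measurable A -> P' (Xs i @^-1` A) = P' (Xs 0%N @^-1` A).
  by move=> mA; rewrite !law.
have [N [N1 Nlt Nle]] := exists_multiple (addr_ge0 (ler0n R 32) (ltW C0)) h0.
have half : (P' (on_path Xs (stays (2 * r) N)) <= 2^-1%:E)%E.
  rewrite leNgt; apply/negP => /ltW hh.
  have := exit_half_bound sepB mX cop hc r0 N1 hh.
  by rewrite leNgt Nlt.
apply: (le_trans (exit_time_mean mXs ind law' r0 N1 half)).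
rewrite lee_fin ler_pdivlMr// /mean_exit_of_cotype.
move: hsc h30 Nle h0; move: (h P X r) (h P X (4 * r)) => a b hsc h30 Nle h0.
apply: (@le_trans _ _ (2 * N%:R * (96 * b))); first by rewrite ler_wpM2l// mulr_ge0.
rewrite (_ : 2 * N%:R * _ = 96 * (2 * (N%:R * b))); last by ring.
rewrite !ler_pM2l//; apply: (le_trans Nle).
by rewrite addrAC lerD2r -lerBrDl (_ : 35 - 32 = 3)//; ring.
Qed.

Lemma mean_exit_tail_exit (c : R) : mean_exit_constant B c -> tail_exit_constant B c.
Proof.
move=> [c0 hc]; split => // d T P X d' T' P' Xs r n mX nd cop r0 n1.
have hm := hc _ _ _ _ _ _ _ _ _ mX nd cop r0.
have hr0 : 0 < h P X r by exact: h_gt0.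
have mXs : forall j, random_variable (Xs j) by case: cop.
have n0 : (0 : R) < n%:R by rewrite ltr0n.
have mE : measurable [set w | (n%:R%:E < exit_time Xs r w)%E].
  have := emeasurable_fun_o_infty measurableT (@measurable_exit_time _ _ sepB _ _ Xs r mXs) n%:R%:E.
  by rewrite setTI.
have le1 : (n%:R%:E * P' [set w | (n%:R)%:E < exit_time Xs r w] <= \int[P']_w exit_time Xs r w)%E.
  rewrite -ex_indic// -exZ//.
  apply: ge0_le_integral => //.
  - by apply/measurable_EFinP; apply: measurable_funM => //; exact: measurable_indic.
  - exact: measurable_exit_time.
  move=> w _; rewrite indicE; case: (boolP (w \in _)) => [/set_mem /= /ltW|_].
    by rewrite mulr1.
  by rewrite mulr0; exact: exit_time_ge0.
move: (h P X r) hr0 hm => a a0 hm.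
have key (p : \bar R) : p \is a fin_num -> (n%:R%:E * p <= (c / a)%:E)%E ->
    (p <= (c / (n%:R * a))%:E)%E.
  move=> pfin; rewrite -(fineK pfin) -EFinM !lee_fin => h1.
  by rewrite invfM mulrCA -ler_pdivrMl ?invr_gt0// invrK.
exact: key (fin_num_measure P' _ mE) (le_trans le1 hm).
Qed.

End mean_exit.

(** * Uniform draws from a finite set *)

Section averages.
Context {R : realType}.

(** Only uniform laws are used: an event of probability 1/m is modelled by one label out of m
    equally likely ones. *)
Definition avg (T : finType) (f : T -> R) : R := #|T|%:R^-1 * \sum_t f t.

Lemma eq_avg (T : finType) (f g : T -> R) : f =1 g -> avg f = avg g.
Proof. by move=> fg; rewrite /avg; congr (_ * _); apply: eq_bigr. Qed.

Lemma avg_le (T : finType) (f g : T -> R) : (forall t, f t <= g t) -> avg f <= avg g.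
Proof. by move=> fg; rewrite /avg ler_wpM2l ?invr_ge0//; apply: ler_sum. Qed.

Lemma avg_ge0 (T : finType) (f : T -> R) : (forall t, 0 <= f t) -> 0 <= avg f.
Proof. by move=> f0; rewrite /avg mulr_ge0 ?invr_ge0// sumr_ge0. Qed.

Lemma avg_cst (T : finType) (t0 : T) (a : R) : avg (fun _ : T => a) = a.
Proof.
rewrite /avg sumr_const -[a *+ _]mulr_natl mulrA mulVf ?mul1r//.
by rewrite pnatr_eq0 -lt0n; apply/card_gt0P; exists t0.
Qed.

Lemma avgD (T : finType) (f g : T -> R) : avg (fun t => f t + g t) = avg f + avg g.
Proof. by rewrite /avg big_split mulrDr. Qed.

Lemma avgZ (T : finType) (a : R) (f : T -> R) : avg (fun t => a * f t) = a * avg f.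
Proof. by rewrite /avg -mulr_sumr mulrCA. Qed.

Lemma avg_sum (T : finType) J (s : seq J) (Q : pred J) (f : J -> T -> R) :
  avg (fun t => \sum_(j <- s | Q j) f j t) = \sum_(j <- s | Q j) avg (f j).
Proof. by rewrite /avg exchange_big mulr_sumr. Qed.

Lemma avg_exchange (T U : finType) (f : T -> U -> R) :
  avg (fun t => avg (f t)) = avg (fun u => avg (f^~ u)).
Proof.
by rewrite /avg -!mulr_sumr exchange_big /= mulrCA.
Qed.

Lemma avg_bij (T U : finType) (g : T -> U) (f : U -> R) : bijective g ->
  avg (fun t => f (g t)) = avg f.
Proof.
by move=> bg; rewrite /avg (bij_eq_card bg) [in RHS](reindex g)//; exact: onW_bij.
Qed.

Lemma avg_pair (T U : finType) (f : T * U -> R) :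
  avg f = avg (fun t => avg (fun u => f (t, u))).
Proof.
rewrite /avg -mulr_sumr pair_big card_prod natrM invfM -mulrA.
by congr (_ * (_ * _)); apply: eq_bigr => -[].
Qed.

Lemma avg_ffun_prod (I T : finType) (f : I -> T -> R) :
  avg (fun w : {ffun I -> T} => \prod_i f i (w i)) = \prod_i avg (f i).
Proof.
rewrite /avg big_split /= prodr_const -bigA_distr_bigA card_ffun natrX exprVn.
by [].
Qed.

Lemma avg_gt0_exists (T : finType) (Q : pred T) (t : T) : Q t ->
  0 < avg (fun t => (Q t)%:R).
Proof.
move=> Qt; have c0 : (0 < #|T|)%N by apply/card_gt0P; exists t.
rewrite /avg mulr_gt0 ?invr_gt0 ?ltr0n// (bigD1 t)//= Qt.
by rewrite ltr_pwDl// sumr_ge0.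
Qed.

End averages.

(** * Independent uniform draws from the digits of a point of the unit interval *)

Section digits.
Context {R : realType}.
Variable M : nat.
Hypothesis M0 : (0 < M)%N.

(* On [[0, 1)] with Lebesgue measure the base-[M] digits are i.i.d. uniform. *)
Definition unit_prob : set (measurableTypeR R) -> \bar R :=
  mrestr (@lebesgue_measure R) (measurable_itv `[0, 1[).

HB.instance Definition _ := Measure.on unit_prob.

Let unit_probT : unit_prob setT = 1%E.
Proof. by rewrite /unit_prob /mrestr setTI lebesgue_measure_itv /= lte01 oppr0 adde0. Qed.

HB.instance Definition _ := Measure_isProbability.Build _ _ R unit_prob unit_probT.

Definition digit k (x : R) : nat := (Num.truncn (M%:R ^+ k.+1 * x) %% M)%N.

Fixpoint digits_value (w : nat -> nat) n : nat :=
  if n is m.+1 then (M * digits_value w m + w m)%N else 0.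

Lemma truncn_div (x : R) : 0 <= x -> (Num.truncn (M%:R * x) %/ M)%N = Num.truncn x.
Proof.
move=> x0; apply/esym/eqP; rewrite truncn_eq//.
have Mx0 : 0 <= M%:R * x by rewrite mulr_ge0.
have := truncn_itv Mx0; set q := Num.truncn _ => /andP[h1 h2].
have MR : (0 : R) < M%:R by rewrite ltr0n.
apply/andP; split.
  rewrite -(ler_pM2l MR); apply: le_trans h1.
  by rewrite -natrM ler_nat mulnC leq_divM.
rewrite -(ltr_pM2l MR); apply: (lt_le_trans h2).
by rewrite -natrM ler_nat mulnC ltn_ceil.
Qed.

(** The first [n] digits of [x] are those of the integer part of M^n x. Prescribing them therefore
    confines [x] to a single interval of length M^-n. *)
Lemma digits_truncn (w : nat -> nat) n (x : R) : (forall i, w i < M)%N ->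
  0 <= x -> x < 1 ->
  (forall i, (i < n)%N -> digit i x = w i) <->
  Num.truncn (M%:R ^+ n * x) = digits_value w n.
Proof.
move=> wM x0 x1; elim: n => [|n IH].
  split => // _; rewrite expr0 mul1r /=; apply/eqP.
  by rewrite truncn_eq// x0.
have y0 : 0 <= M%:R ^+ n * x by rewrite mulr_ge0// exprn_ge0.
have := truncn_div y0; rewrite mulrA -exprS => qE.
split=> [h|h].
  have h1 : Num.truncn (M%:R ^+ n * x) = digits_value w n.
    by apply/IH => i ni; apply: h; exact: ltnW.
  rewrite (divn_eq (Num.truncn (M%:R ^+ n.+1 * x)) M) qE h1 /= mulnC.
  by congr (_ + _)%N; exact: h.
have h2 : digit n x = w n.
  by rewrite /digit h /= mulnC modnMDl modn_small.
have h1 : Num.truncn (M%:R ^+ n * x) = digits_value w n.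
  by rewrite -qE h /= mulnC divnMDl// divn_small// addn0.
move=> i; rewrite ltnS leq_eqVlt => /orP[/eqP ->//|].
exact: (proj2 IH h1).
Qed.

Lemma digits_value_lt (w : nat -> nat) n : (forall i, w i < M)%N ->
  (digits_value w n < M ^ n)%N.
Proof.
move=> wM; elim: n => [|n IH] //=.
rewrite expnS; apply: (@leq_trans (M * (digits_value w n).+1)%N).
  by rewrite mulnS addnC ltn_add2r.
by rewrite leq_mul2l IH orbT.
Qed.

Lemma measurable_truncn (a : R) v : 0 < a ->
  measurable ([set x | Num.truncn (a * x) = v] : set (measurableTypeR R)).
Proof.
move=> a0.
have mge u : measurable ([set x | (u <= Num.truncn (a * x))%N] : set (measurableTypeR R)).
  case: u => [|u]; first by rewrite (_ : [set _ | _] = setT)//; apply/seteqP.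
  rewrite (_ : [set _ | _] = `[u.+1%:R / a, +oo[%classic); first exact: measurable_itv.
  by apply/seteqP; split => x /=; rewrite in_itv/= andbT truncn_gt_nat ler_pdivrMr// mulrC.
rewrite (_ : [set _ | _] = [set x | (v <= Num.truncn (a * x))%N] `\`
  [set x | (v.+1 <= Num.truncn (a * x))%N]); first exact: measurableD.
apply/seteqP; split => x /=; first by move=> ->; rewrite ltnn.
by move=> [h /negP]; rewrite -leqNgt => h'; apply/eqP; rewrite eqn_leq h h'.
Qed.

Lemma measurable_digit k v :
  measurable ([set x | digit k x = v] : set (measurableTypeR R)).
Proof.
rewrite (_ : [set x | _] = \bigcup_(u in [set u | (u %% M)%N = v])
    [set x | Num.truncn (M%:R ^+ k.+1 * x) = u]).
  apply: bigcup_measurable => u _; apply: measurable_truncn.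
  by rewrite exprn_gt0// ltr0n.
apply/seteqP; split => x /=; first by move=> <-; exists (Num.truncn (M%:R ^+ k.+1 * x)).
by move=> [u <- /= <-].
Qed.

Lemma unit_prob_digits (w : nat -> nat) n : (forall i, w i < M)%N ->
  unit_prob [set x | forall i, (i < n)%N -> digit i x = w i] = (M%:R ^- n)%:E.
Proof.
move=> wM; set A := digits_value w n.
have Mn : (0 : R) < M%:R ^+ n by rewrite exprn_gt0// ltr0n.
rewrite /unit_prob /mrestr (_ : _ `&` _ =
    `[A%:R / M%:R ^+ n, A.+1%:R / M%:R ^+ n[%classic).
  by rewrite lebesgue_measure_itv/= lte_fin ltr_pM2r ?invr_gt0// ltr_nat ltnSn -EFinB -mulrBl -natr1 addrC addKr mul1r.
apply/seteqP; split => x /=.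
  move=> [h]; rewrite in_itv/= => /andP[x0 x1].
  move/(digits_truncn n wM x0 x1) : h => /eqP.
  rewrite truncn_eq ?mulr_ge0 ?(ltW Mn)// => /andP[h1 h2].
  by rewrite in_itv/= ler_pdivrMr// ltr_pdivlMr// ![x * _]mulrC h1 h2.
rewrite !in_itv/= ler_pdivrMr// ltr_pdivlMr// => /andP[h1 h2].
have x0 : 0 <= x by rewrite -(pmulr_lge0 _ Mn); exact: le_trans h1.
have x1 : x < 1.
  rewrite -(ltr_pM2r Mn) mul1r; apply: (lt_le_trans h2).
  by rewrite -natrX ler_nat; exact: digits_value_lt.
split; last by rewrite x0 x1.
apply/(digits_truncn n wM x0 x1)/eqP.
by rewrite truncn_eq ?mulr_ge0 ?(ltW Mn)// mulrC h1 h2.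
Qed.

End digits.

Lemma ex_finite (R : realType) d (T : measurableType d) (P : probability T R)
    (U : finType) (u : T -> U) (p : U -> R) (g : U -> R) :
  (forall a, measurable (u @^-1` [set a])) -> (forall a, P (u @^-1` [set a]) = (p a)%:E) ->
  (forall a, 0 <= g a) ->
  (\int[P]_w (g (u w))%:E = (\sum_a p a * g a)%:E)%E.
Proof.
move=> mu pu g0.
have -> : (\int[P]_w (g (u w))%:E = \int[P]_w (\sum_a g a * \1_(u @^-1` [set a]) w)%:E)%E.
  apply: eq_integral => w _; congr _%:E.
  rewrite (bigD1 (u w))//= indicE mem_set// mulr1 big1 ?addr0// => a auw.
  rewrite indicE memNset ?mulr0//= => /esym/eqP; exact/negP.
have mi a : measurable_fun setT (\1_(u @^-1` [set a]) : T -> R) by exact: measurable_indic.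
rewrite ex_sum; last 2 first.
- by move=> a; exact: measurable_funM.
- by move=> a w; rewrite mulr_ge0// indicE.
under eq_bigr do rewrite exZ// ex_indic// pu -EFinM mulrC.
by rewrite sumEFin.
Qed.

Lemma indic_bool (R : realType) T (b : T -> bool) w : \1_[set x | b x] w = (b w)%:R :> R.
Proof.
by rewrite indicE; case bw: (b w); [rewrite mem_set|rewrite memNset//= bw].
Qed.

Lemma avg_marginal (R : realType) (I T : finType) (i : I) (g : T -> R) :
  avg (fun w : {ffun I -> T} => g (w i)) = avg g.
Proof.
have [t _|T0] := pickP (fun _ : T => true); last first.
  rewrite /avg [in LHS]big1 ?[in RHS]big1 ?mulr0//.
    by move=> t; have := T0 t.
  by move=> w; have := T0 (w i).
have := avg_ffun_prod (fun j (t : T) => if j == i then g t else 1 : R).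
rewrite [RHS](bigD1 i)//= eqxx big1 ?mulr1 => [<-|j /negbTE ->]; last exact: avg_cst.
apply: eq_avg => w; rewrite (bigD1 i)//= eqxx big1 ?mulr1// => j /negbTE -> //.
Qed.

Section finite_iid.
Context {R : realType} (W : finType) (w0 : W).

Let M := #|W|.
Let M0 : (0 < M)%N. Proof. by apply/card_gt0P; exists w0. Qed.

Definition draw (k : nat) (x : R) : W := nth w0 (enum W) (digit M k x).
Definition draws n (x : R) : {ffun 'I_n -> W} := [ffun i : 'I_n => draw i x].

Let P : probability (measurableTypeR R) R := @unit_prob R.

Lemma drawE k x a : (draw k x = a) <-> (digit M k x = index a (enum W)).
Proof.
have lt : (digit M k x < size (enum W))%N by rewrite -cardE ltn_mod.
split=> [<-|h]; first by rewrite index_uniq// enum_uniq.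
by rewrite /draw h nth_index// mem_enum.
Qed.

Lemma measurable_draw k a : measurable (draw k @^-1` [set a] : set (measurableTypeR R)).
Proof.
rewrite (_ : _ @^-1` _ = [set x | digit M k x = index a (enum W)]); first exact: measurable_digit.
by apply/seteqP; split => x /=; move/drawE.
Qed.

Lemma draws_preimage n (w : {ffun 'I_n -> W}) :
  draws n @^-1` [set w] = [set x | forall i, (i < n)%N ->
    digit M i x = (fun j => index (if insub j is Some o then w o else w0) (enum W)) i].
Proof.
apply/seteqP; split => x /= h.
  move=> i ni; apply/drawE; rewrite insubT -h ffunE.
  by [].
apply/ffunP => i; rewrite ffunE; have := h i (ltn_ord i).
by rewrite valK => /drawE.
Qed.

Lemma measurable_draws n (w : {ffun 'I_n -> W}) :
  measurable (draws n @^-1` [set w] : set (measurableTypeR R)).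
Proof.
rewrite (_ : _ @^-1` _ = \bigcap_(i in [set: 'I_n]) (draw i @^-1` [set w i])).
  by apply: fin_bigcap_measurable => // i _; exact: measurable_draw.
apply/seteqP; split => x /=; first by move=> <- i _ /=; rewrite ffunE.
by move=> h; apply/ffunP => i; rewrite ffunE; exact: h.
Qed.

Lemma prob_draws n (w : {ffun 'I_n -> W}) :
  P (draws n @^-1` [set w]) = (#|{ffun 'I_n -> W}|%:R^-1)%:E.
Proof.
rewrite draws_preimage; apply: (eq_trans (unit_prob_digits M0 _ _)).
  by move=> i; rewrite /M cardE index_mem mem_enum.
by rewrite card_ffun card_ord natrX.
Qed.

Lemma ex_draws n (g : {ffun 'I_n -> W} -> R) : (forall w, 0 <= g w) ->
  (\int[P]_x (g (draws n x))%:E = (avg g)%:E)%E.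
Proof.
move=> g0; rewrite (ex_finite (p := fun=> #|{ffun 'I_n -> W}|%:R^-1))//.
- by rewrite /avg mulr_sumr.
- exact: measurable_draws.
- exact: prob_draws.
Qed.

Lemma measurable_draws_pred n (Q : pred {ffun 'I_n -> W}) :
  measurable ([set x | Q (draws n x)] : set (measurableTypeR R)).
Proof.
rewrite (_ : [set x | _] = \bigcup_(w in [set w | Q w]) (draws n @^-1` [set w])).
  apply: fin_bigcup_measurable; first exact: finite_finset.
  by move=> w _; exact: measurable_draws.
by apply/seteqP; split => x /=; [move=> h; exists (draws n x)|move=> [w Qw /= e]; rewrite e].
Qed.

Lemma prob_draws_pred n (Q : pred {ffun 'I_n -> W}) :
  P [set x | Q (draws n x)] = (avg (fun w => (Q w)%:R))%:E.
Proof.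
rewrite -ex_draws// -ex_indic; last exact: measurable_draws_pred.
by apply: eq_integral => x _; rewrite indic_bool.
Qed.

Lemma ex_draw k (g : W -> R) : (forall a, 0 <= g a) ->
  (\int[P]_x (g (draw k x))%:E = (avg g)%:E)%E.
Proof.
move=> g0; rewrite -(avg_marginal (@ord_max k) g) -ex_draws//.
by apply: eq_integral => x _; rewrite ffunE.
Qed.

Context {B : completeNormedModType R} (F : W -> B).

Definition steps (j : nat) (x : measurableTypeR R) : B := F (draw j x).

Lemma rv_steps j : random_variable (steps j).
Proof.
move=> _ A mA; rewrite setTI.
rewrite (_ : _ @^-1` _ = \bigcup_(a in [set a | A (F a)]) (draw j @^-1` [set a])).
  apply: fin_bigcup_measurable; first exact: finite_finset.
  by move=> a _; exact: measurable_draw.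
by apply/seteqP; split => x /=; [move=> h; exists (draw j x)|move=> [a h /= e]; rewrite /steps e].
Qed.

Lemma prob_steps j (A : set (borel B)) : measurable A ->
  P (steps j @^-1` A) = (avg (fun a => (F a \in A)%:R))%:E.
Proof.
move=> mA; rewrite -(ex_draw j)// -ex_indic; last by apply: rv_preimage => //; exact: rv_steps.
by apply: eq_integral => x _; rewrite indicE.
Qed.

Lemma steps_independent : mutually_independent P steps.
Proof.
move=> J A mA.
pose n := (\max_(i <- J) i).+1.
have Jn i : i \in J -> (i < n)%N by move=> iJ; rewrite ltnS; exact: (@leq_bigmax_seq _ (enum_fset J) predT (fun i => i) i iJ isT).
pose Q (w : {ffun 'I_n -> W}) := [forall i, (val i \in J) ==> (F (w i) \in A (val i))].
rewrite (_ : \bigcap_(i in _) _ = [set x | Q (draws n x)]); last first.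
  apply/seteqP; split => x /= h.
    apply/forallP => i; apply/implyP => iJ; rewrite ffunE; apply/mem_set.
    exact: h.
  move=> i iJ /=; move/forallP : h => /(_ (Ordinal (Jn _ iJ)))/implyP/(_ iJ).
  by rewrite ffunE => /set_mem.
rewrite prob_draws_pred.
under [RHS]eq_bigr do rewrite prob_steps//.
rewrite prodEFin; congr _%:E.
(* The horizon [n] lies beyond every index of [J]; coordinates outside [J] receive the factor 1, so
   the product formula for all [n] draws reduces to [J]. *)
pose f (i : 'I_n) (a : W) : R := if val i \in J then (F a \in A (val i))%:R else 1.
have -> : avg (fun w => (Q w)%:R : R) = avg (fun w : {ffun 'I_n -> W} => \prod_i f i (w i)).
  apply: eq_avg => w; case: (boolP (Q w)) => [/forallP h|].
    rewrite big1// => i _; rewrite /f; case: ifPn => // iJ.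
    by have := h i; rewrite iJ /= => ->.
  rewrite negb_forall => /existsP[i]; rewrite negb_imply => /andP[iJ h].
  by rewrite (bigD1 i)//= /f iJ (negbTE h) mul0r.
rewrite avg_ffun_prod.
rewrite (bigID (fun i : 'I_n => val i \in J)) /= [X in _ * X]big1 ?mulr1; last first.
  by move=> i iJ; rewrite /f (negbTE iJ); exact: avg_cst.
rewrite (eq_bigr (fun i : 'I_n => avg (fun a => (F a \in A i)%:R))); last first.
  by move=> i iJ; rewrite /f iJ.
rewrite -(big_mkord (fun i => i \in J) (fun i => avg (fun a => (F a \in A i)%:R : R))).
rewrite -big_filter; apply: perm_big; apply: uniq_perm => //.
- by rewrite filter_uniq// iota_uniq.
- exact: fset_uniq.
- move=> i; rewrite mem_filter mem_index_iota /=; case: (boolP (i \in J)) => //= iJ.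
  exact: Jn.
Qed.

Lemma steps_copies : independent_copies P (steps 0) P steps.
Proof.
split; [exact: rv_steps|exact: steps_independent|].
by move=> j A mA; rewrite !prob_steps.
Qed.

(** Every outcome of a draw has positive probability, so a step that is almost surely constant would
    force [F] to be constant. *)
Lemma steps_nondegenerate a b : F a != F b -> nondegenerate P (steps 0).
Proof.
move=> ab [v hv].
have key c : F c = v.
  apply: contrapT => cv.
  have [N [mN N0 sub]] := hv.
  have : (P (draw 0 @^-1` [set c]) <= P N)%E.
    apply: le_measure; rewrite ?inE//; first exact: measurable_draw.
    by move=> x /= xc; apply: sub => /= h; apply: cv; rewrite -h /steps xc.
  rewrite N0 -ex_indic; last exact: measurable_draw.
  rewrite (_ : (\int[P]_x _)%E = (\int[P]_x ((draw 0 x == c)%:R)%:E)%E); last first.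
    apply: eq_integral => x _; rewrite indicE; congr (_%:R)%:E.
    by case: eqP => h; [rewrite mem_set|rewrite memNset].
  rewrite (ex_draw 0 (g := fun a => (a == c)%:R))// lee_fin leNgt.
  by rewrite (avg_gt0_exists (Q := fun a => a == c) (eqxx c)).
by move: ab; rewrite !key eqxx.
Qed.

(* [tailG + truncK] for a step drawn uniformly from [F]. *)
Definition trunc_energy (r : R) : R :=
  avg (fun a => if `|F a| <= r then r ^- 2 * `|F a| ^+ 2 else 1).

Lemma steps_h r : trunc_energy r <= h P (steps 0) r.
Proof.
have r20 : 0 <= r ^- 2 by rewrite invr_ge0 sqr_ge0.
have G : tailG P (steps 0) r = avg (fun a => (r < `|F a|)%R%:R).
  rewrite /tailG -ex_indic; last by apply: measurable_tail; exact: rv_steps.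
  rewrite (_ : (\int[P]_x _)%E = (\int[P]_x ((r < `|F (draw 0 x)|)%R%:R)%:E)%E).
    by rewrite (ex_draw 0 (g := fun a => (r < `|F a|)%R%:R)).
  by apply: eq_integral => x _; rewrite indic_bool.
have K : truncK P (steps 0) r = r ^- 2 * avg (fun a => `|trunc r (F a) : B| ^+ 2).
  rewrite truncKE; congr (_ * _).
  by rewrite /trunc_moment (ex_draw 0 (g := fun a => `|trunc r (F a) : B| ^+ 2)).
rewrite /h G K -avgZ -avgD -[leLHS]addr0; apply: lerD => //.
rewrite /trunc_energy; apply: avg_le => a; rewrite truncE.
by case: (leP `|F a| r) => _ /=; rewrite ?normr0 ?expr0n ?mulr0 ?addr0 ?add0r.
Qed.

(** Boolean form of [stays] on a finite word of draws, which turns its probability into an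
    average. *)
Definition confined (r : R) n (w : {ffun 'I_n -> W}) : bool :=
  [forall k : 'I_n.+1, `|\sum_(j < n | (j < k)%N) F (w j)| <= r].

Lemma confinedP r n x : confined r (draws n x) <-> stays r n (steps^~ x).
Proof.
have e k : (k <= n)%N -> walk (steps^~ x) k = \sum_(j < n | (j < k)%N) F (draws n x j).
  move=> kn; rewrite /walk (big_ord_widen n (fun j => steps j x) kn).
  by apply: eq_bigr => j _; rewrite ffunE.
split=> [/forallP h k kn|h].
  by rewrite e//; exact: (h (Ordinal (kn : (k < n.+1)%N))).
by apply/forallP => k; rewrite -e -1?ltnS//; apply: h; rewrite -ltnS.
Qed.

Lemma confined_bound c r n a b : tail_exit_constant B c ->
  F a != F b -> 0 < r -> (1 <= n)%N -> 0 < trunc_energy r ->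
  avg (fun w : {ffun 'I_n -> W} => (confined r w)%:R) <= c / (n%:R * trunc_energy r).
Proof.
move=> [c0 hc] ab r0 n1 H0.
have n0 : (0 : R) < n%:R by rewrite ltr0n.
have := hc _ _ _ _ _ _ _ _ r n (rv_steps 0) (steps_nondegenerate ab) steps_copies r0 n1.
rewrite (_ : [set w | _] = [set x | confined r (draws n x)]); last first.
  apply/seteqP; split => x /=.
    by move/(exit_time_gt _ r0) => h; apply/confinedP.
  by move/confinedP => h; apply/(exit_time_gt _ r0).
rewrite prob_draws_pred lee_fin => /le_trans; apply.
have hE := steps_h r; have h0 := lt_le_trans H0 hE.
move: (trunc_energy r) (h P (steps 0) r) H0 hE h0 => e a' H0 hE h0.
by rewrite ler_wpM2l ?(ltW c0)// lef_pV2 ?posrE ?mulr_gt0// ler_wpM2l// ltW.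
Qed.

End finite_iid.

(** * From exit times to Rademacher cotype *)

(** The functions [f] with a given image [g] form a product of fibres of [theta], so the sum of the
    product weights over them factors. *)
Lemma weighted_pushforward (R : realType) (I D D' : finType) (u : D -> R) (theta : D -> D')
    (Psi : {ffun I -> D'} -> R) :
  \sum_(f : {ffun I -> D}) (\prod_i u (f i)) * Psi [ffun i => theta (f i)] =
  \sum_(g : {ffun I -> D'}) (\prod_i \sum_(d | theta d == g i) u d) * Psi g.
Proof.
rewrite (partition_big (fun f : {ffun I -> D} => [ffun i => theta (f i)]) predT)//=.
apply: eq_bigr => g _.
rewrite (eq_bigr (fun f : {ffun I -> D} => (\prod_i u (f i)) * Psi g)); last by move=> f /eqP ->.
rewrite -mulr_suml; congr (_ * _).
rewrite (bigA_distr_big_dep (fun i d => theta d == g i) (fun _ d => u d)); apply: eq_bigl => f.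
apply/eqP/familyP => [<- i|h]; first by rewrite unfold_in ffunE.
by apply/ffunP => i; rewrite ffunE; apply/eqP; exact: h.
Qed.

Section rademacher.
Context {R : realType} {B : completeNormedModType R}.

Definition sg (b : bool) : R := (-1) ^+ b.

Lemma sg_addb a b : sg (a (+) b) = sg a * sg b. Proof. exact: signr_addb. Qed.

Lemma sg_norm b (y : B) : `|sg b *: y| = `|y|.
Proof. by rewrite normrZ normr_sign mul1r. Qed.

(** Convexity at the midpoint of a + b and a - b. It serves both the contraction principle and the
    reflection argument. *)
Lemma sqr_midpoint (a b : B) : `|a| ^+ 2 <= 2^-1 * (`|a + b| ^+ 2 + `|a - b| ^+ 2).
Proof.
have h : `|a| <= 2^-1 * (`|a + b| + `|a - b|).
  rewrite ler_pdivlMl// -[X in X * _]ger0_norm// -normrZ.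
  rewrite (_ : 2 *: a = (a + b) + (a - b)); first exact: ler_normD.
  by rewrite addrACA subrr addr0 scaler_nat mulr2n.
apply: (@le_trans _ _ ((2^-1 * (`|a + b| + `|a - b|)) ^+ 2)).
  by rewrite ler_pXn2r ?nnegrE ?mulr_ge0 ?addr_ge0 ?invr_ge0.
move: (`|a + b|) (`|a - b|) => u v.
rewrite -subr_ge0 (_ : _ - _ = (2^-1 * (u - v)) ^+ 2) ?sqr_ge0//; by field.
Qed.

(** Peeling off one term at a time doubles the weight of the rest. The weights do not depend on [n],
    and their growth is affordable because the layers of the sparse walk decay faster. *)
Lemma sqr_norm_sum (a : nat -> B) n :
  `|\sum_(l < n) a l| ^+ 2 <= \sum_(l < n) 2 ^+ l.+1 * `|a l| ^+ 2.
Proof.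
elim: n a => [|n IH] a; first by rewrite !big_ord0 normr0 expr0n.
rewrite !big_ord_recl /= expr1; apply: (le_trans (sqr_normD _ _)); rewrite lerD2l.
apply: (le_trans (ler_wpM2l (ler0n R 2) (IH (fun l => a l.+1)))).
rewrite mulr_sumr; apply: ler_sum => l _.
by rewrite mulrA -exprS.
Qed.

Section finite.
Variable I : finType.
Implicit Types x y : I -> B.

Definition rad x : R :=
  avg (fun e : {ffun I -> bool} => `|\sum_i sg (e i) *: x i| ^+ 2).

Lemma rad_ge0 x : 0 <= rad x.
Proof. by apply: avg_ge0 => e; exact: sqr_ge0. Qed.

Lemma eq_rad x y : x =1 y -> rad x = rad y.
Proof.
move=> xy; apply: eq_avg => e; congr (`|_| ^+ 2).
by apply: eq_bigr => i _; rewrite xy.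
Qed.

Lemma flip_bij (h : I -> bool) :
  bijective (fun e : {ffun I -> bool} => [ffun i => e i (+) h i]).
Proof.
by apply: inv_bij => e; apply/ffunP => i; rewrite !ffunE -addbA addbb addbF.
Qed.

Lemma rad_flip (h : I -> bool) x : rad (fun i => sg (h i) *: x i) = rad x.
Proof.
rewrite /rad -[RHS](avg_bij _ (flip_bij h)); apply: eq_avg => e.
congr (`|_| ^+ 2); apply: eq_bigr => i _.
by rewrite ffunE sg_addb scalerA.
Qed.

(** Contraction principle: flipping the signs outside [J] preserves the average, and the restricted
    sum is the midpoint of the original and the flipped one. *)
Lemma rad_restrict (J : pred I) x : rad (fun i => if J i then x i else 0) <= rad x.
Proof.
have e1 : rad x = 2^-1 * (rad x + rad (fun i => sg (~~ J i) *: x i)).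
  by rewrite rad_flip; field.
rewrite [leRHS]e1 /rad -avgD -avgZ; apply: avg_le => e.
have -> : \sum_i sg (e i) *: x i =
    \sum_i sg (e i) *: (if J i then x i else 0) + \sum_i sg (e i) *: (if J i then 0 else x i).
  rewrite -big_split; apply: eq_bigr => i _.
  by case: (J i); rewrite /= scaler0 ?addr0 ?add0r.
have -> : \sum_i sg (e i) *: (sg (~~ J i) *: x i) =
    \sum_i sg (e i) *: (if J i then x i else 0) - \sum_i sg (e i) *: (if J i then 0 else x i).
  rewrite -sumrB; apply: eq_bigr => i _.
  by case: (J i); rewrite /= /sg ?expr0 ?expr1 ?scale1r ?scaleN1r ?scaler0 ?subr0 ?sub0r// scalerN.
exact: sqr_midpoint.
Qed.

Lemma rad_single i x : `|x i| ^+ 2 <= rad x.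
Proof.
apply: le_trans (rad_restrict (pred1 i) x).
rewrite /rad -[leLHS](avg_cst ([ffun=> false] : {ffun I -> bool})).
apply: avg_le => e; rewrite (bigD1 i)//= eqxx big1 ?addr0 ?sg_norm// => j /negbTE ->.
by rewrite scaler0.
Qed.

(* Only the marginal law of the signs [e (pos i) i] matters, not the position. *)
Lemma rad_marginal (T : finType) (pos : I -> T) x :
  avg (fun e : {ffun T -> {ffun I -> bool}} => `|\sum_i sg (e (pos i) i) *: x i| ^+ 2) =
  rad x.
Proof.
set f := fun e : {ffun T -> {ffun I -> bool}} => _.
have bij (h : {ffun I -> bool}) :
    bijective (fun e : {ffun T -> {ffun I -> bool}} => [ffun j => [ffun i => e j i (+) h i]]).
  by apply: inv_bij => e; apply/ffunP => j; apply/ffunP => i; rewrite !ffunE -addbA addbb addbF.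
(* A further uniform sign vector [h], applied at every position at once, preserves the law of [e].
   For fixed [e] the average over [h] is [rad] of a sign change of [x]. *)
rewrite -[LHS](avg_cst ([ffun=> false] : {ffun I -> bool})).
rewrite (eq_avg (g := fun h : {ffun I -> bool} => avg (fun e : {ffun T -> {ffun I -> bool}} => f [ffun j => [ffun i => e j i (+) h i]]))); last first.
  by move=> h; rewrite (avg_bij f (bij h)).
rewrite avg_exchange -[RHS](avg_cst ([ffun=> [ffun=> false]] : {ffun T -> {ffun I -> bool}})).
apply: eq_avg => e; rewrite -(rad_flip (fun i => e (pos i) i)); apply: eq_avg => h.
rewrite /f; congr (`|_| ^+ 2); apply: eq_bigr => i _.
by rewrite !ffunE sg_addb mulrC scalerA.
Qed.

End finite.

(* Restricting to [N] nonzero vectors makes some constant [K] available a priori; the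
   constant finally obtained does not depend on [N]. *)
Definition rad_cotype N (K : R) : Prop :=
  forall (I : finType) (x : I -> B), (#|[pred i | x i != 0%R]| <= N)%N ->
  \sum_i `|x i| ^+ 2 <= K * rad x.

Lemma rad_cotype_base N : rad_cotype N N%:R.
Proof.
move=> I x xN; rewrite (bigID (fun i => x i != 0)) /= [X in _ + X]big1 ?addr0; last first.
  by move=> i; rewrite negbK => /eqP ->; rewrite normr0 expr0n.
apply: (le_trans (ler_sum _ (fun i _ => rad_single i x))).
rewrite sumr_const -[rad x *+ _]mulr_natl ler_wpM2r ?rad_ge0// ler_nat.
by apply: leq_trans xN; rewrite -(eq_card (A := [pred i | x i != 0])).
Qed.

Section thinning.
Variables (N : nat) (K : R) (I : finType) (x : I -> B).
Hypotheses (K0 : 0 <= K) (cot : rad_cotype N K) (xN : (#|[pred i | x i != 0%R]| <= N)%N).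

(** For fixed signs the cotype bound is applied to the block sums, of which at most [N] are nonzero
    since each needs a nonzero [x i]. After averaging, the block signs are absorbed into the signs
    of the coordinates. *)
Lemma rad_blocks (L : finType) (g : I -> L) :
  \sum_k rad (fun i => if g i == k then x i else 0) <= K * rad x.
Proof.
pose y (e : {ffun I -> bool}) k := \sum_i sg (e i) *: (if g i == k then x i else 0).
have h e : \sum_k `|y e k| ^+ 2 <= K * rad (y e).
  apply: cot; apply: leq_trans xN.
  apply: (@leq_trans #|[seq g i | i in [pred i | x i != 0]]|); last exact: leq_image_card.
  apply: subset_leq_card; apply/fintype.subsetP => k; rewrite !inE => yk.
  have [i /andP[gi xi]|no] := pickP (fun i => (g i == k) && (x i != 0)).
    by apply/fintype.imageP; exists i => //; rewrite (eqP gi).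
  move: yk; rewrite /y big1 ?eqxx// => i _; have := no i.
  case: (g i == k) => /= [/negbT|_]; last by rewrite scaler0.
  by rewrite negbK => /eqP ->; rewrite scaler0.
have := avg_le h; rewrite avg_sum => /le_trans; apply.
rewrite avgZ ler_wpM2l// /rad avg_exchange.
rewrite -[leRHS](avg_cst ([ffun=> false] : {ffun L -> bool})).
apply: avg_le => t; rewrite -/(rad x) -(rad_flip (fun i => t (g i)) x) le_eqVlt; apply/orP; left.
apply/eqP/eq_avg => e; congr (`|_| ^+ 2).
rewrite /y; under eq_bigr do rewrite scaler_sumr.
rewrite exchange_big /=; apply: eq_bigr => i _.
rewrite (bigD1 (g i))//= eqxx big1 ?addr0; last first.
  by move=> k /negbTE; rewrite eq_sym => ->; rewrite !scaler0.
by rewrite !scalerA mulrC.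
Qed.

(* Label the coordinates independently with [0, ..., m], each label [k > 0] having
   probability [p]: every block [k > 0] is a copy of the thinned family. *)
Lemma rad_thinning (p : R) (m : nat) : 0 <= p -> m%:R * p <= 1 ->
  m%:R * (\sum_(J : {ffun I -> bool}) (\prod_i (if J i then p else 1 - p)) *
    rad (fun i => if J i then x i else 0)) <= K * rad x.
Proof.
move=> p0 mp.
pose w (k : 'I_m.+1) : R := if k == ord0 then 1 - m%:R * p else p.
have w0 k : 0 <= w k by rewrite /w; case: ifP => // _; rewrite subr_ge0.
have w1 : \sum_k w k = 1.
  rewrite big_ord_recl /w eqxx (eq_bigr (fun=> p)) => [|k _]; last first.
    by [].
  by rewrite sumr_const card_ord -[p *+ m]mulr_natl subrK.
set E := \sum_(J : {ffun I -> bool}) _.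
have EE k : k != ord0 -> \sum_(g : {ffun I -> 'I_m.+1}) (\prod_i w (g i)) *
    rad (fun i => if g i == k then x i else 0) = E.
  move=> k0; pose Psi (J : {ffun I -> bool}) := rad (fun i => if J i then x i else 0).
  rewrite (eq_bigr (fun g : {ffun I -> 'I_m.+1} => (\prod_i w (g i)) *
    Psi [ffun i => g i == k])); last first.
    by move=> g _; congr (_ * _); apply: eq_rad => i; rewrite ffunE.
  rewrite (weighted_pushforward w (fun l => l == k)); apply: eq_bigr => J _.
  congr (_ * _); apply: eq_bigr => i _.
  have wk : \sum_(l | (l == k) == true) w l = p.
    by rewrite (big_pred1 k) => [|l]; [rewrite /w (negbTE k0)|rewrite eqb_id].
  case: (J i) => //.
  apply/esym/eqP; rewrite subr_eq -[X in X == _]w1 (bigID (fun l => (l == k) == true)) /= wk addrC.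
  apply/eqP; congr (_ + _); by apply: eq_bigl => l; case: (l == k).
have tot : \sum_(g : {ffun I -> 'I_m.+1}) (\prod_i w (g i)) *
    \sum_k rad (fun i => if g i == k then x i else 0) <= K * rad x.
  apply: (@le_trans _ _ (\sum_(g : {ffun I -> 'I_m.+1}) (\prod_i w (g i)) * (K * rad x))).
    by apply: ler_sum => g _; rewrite ler_wpM2l ?prodr_ge0//; exact: rad_blocks.
  by rewrite -mulr_suml -(bigA_distr_bigA (fun _ l => w l)) /= big1 ?mul1r// => i _.
apply: le_trans tot.
under [leRHS]eq_bigr do rewrite mulr_sumr.
rewrite exchange_big big_ord_recl /=.
rewrite [X in _ <= _ + X](eq_bigr (fun=> E)); last by move=> k _; exact: EE.
rewrite sumr_const card_ord mulr_natl lerDr.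
by apply: sumr_ge0 => g _; rewrite mulr_ge0 ?prodr_ge0 ?rad_ge0.
Qed.

End thinning.
End rademacher.

(** A first hitting index is determined by the predicate up to and including that index; hence
    altering the steps after the first exit leaves the exit time unchanged. *)
Lemma eq_find_iota (P Q : pred nat) m :
  (forall k, (k <= find P (iota 0 m))%N -> P k = Q k) ->
  find Q (iota 0 m) = find P (iota 0 m).
Proof.
move=> h; set t := find P (iota 0 m).
have tm : (t <= m)%N by rewrite -[m in (_ <= m)%N](size_iota 0); exact: find_size.
have nthE k : (k < m)%N -> nth 0%N (iota 0 m) k = k by move=> km; rewrite nth_iota.
apply/eqP; rewrite eqn_leq; apply/andP; split.
  case: (ltnP t m) => [lt|]; last first.
    by move=> /(leq_trans _); apply; rewrite -[m in (_ <= m)%N](size_iota 0); exact: find_size.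
  have Pt : P t.
    by rewrite -(nthE t lt); apply: nth_find; rewrite has_find size_iota.
  rewrite leqNgt; apply/negP => /(before_find 0%N).
  by rewrite nthE// -h// Pt.
rewrite leqNgt; apply/negP => lt.
have hq : has Q (iota 0 m) by rewrite has_find size_iota; exact: leq_trans lt tm.
have := nth_find 0%N hq; rewrite nthE; last exact: leq_trans lt tm.
rewrite -h; last exact: ltnW.
by have := before_find 0%N lt; rewrite nthE ?(leq_trans lt tm)// => ->.
Qed.

Section doob.
Context {R : realType} {B : completeNormedModType R} (W : finType) (F : W -> B).
Variable iota : W -> W.
Hypotheses (iotaK : involutive iota) (Fiota : forall w, F (iota w) = - F w).
Variables (r : R) (n : nat).
Hypothesis r0 : 0 <= r.

Let S (k : nat) (w : {ffun 'I_n -> W}) : B := \sum_(j < n | (j < k)%N) F (w j).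
(** The first exit time from radius [r], equal to [n.+1] when the walk never leaves. *)
Let tau (w : {ffun 'I_n -> W}) : nat := find (fun k => r < `|S k w|) (seq.iota 0 n.+1).
Let reflect_after (w : {ffun 'I_n -> W}) : {ffun 'I_n -> W} :=
  [ffun j : 'I_n => if (j < tau w)%N then w j else iota (w j)].

Let S_reflect k w : (k <= tau w)%N -> S k (reflect_after w) = S k w.
Proof.
by move=> kt; apply: eq_bigr => j jk; rewrite ffunE (leq_trans jk kt).
Qed.

Let tau_reflect w : tau (reflect_after w) = tau w.
Proof. by apply: eq_find_iota => k kt; rewrite S_reflect. Qed.

Let reflectK : involutive reflect_after.
Proof.
move=> w; apply/ffunP => j; rewrite ffunE tau_reflect ffunE.
by case: (j < tau w)%N => //; rewrite iotaK.
Qed.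

(* Reflecting the steps taken after the first exit turns [S_n] into
   [2 S_tau - S_n], so that one of the two has norm at least [|S_tau| > r]. *)
Lemma reflection_bound (w0 : W) :
  r ^+ 2 * (1 - avg (fun w : {ffun 'I_n -> W} => (confined F r w)%:R)) <=
  avg (fun w : {ffun 'I_n -> W} => `|\sum_j F (w j)| ^+ 2).
Proof.
set f := fun w : {ffun 'I_n -> W} => `|_| ^+ 2.
have -> : avg f = avg (fun w => 2^-1 * (f w + f (reflect_after w))).
  by rewrite avgZ avgD (avg_bij f (inv_bij reflectK)); field.
rewrite -{1}(avg_cst ([ffun=> w0] : {ffun 'I_n -> W}) 1) -mulN1r -avgZ -avgD -avgZ.
apply: avg_le => w; case: (boolP (confined F r w)) => [_|nc].
  by rewrite mulr1 subrr mulr0 mulr_ge0 ?invr_ge0 ?addr_ge0 ?sqr_ge0.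
rewrite mulr0 addr0 mulr1.
have tn : (tau w < n.+1)%N.
  rewrite /tau -[X in (_ < X)%N](size_iota 0) -has_find.
  move: nc; rewrite negb_forall => /existsP[k hk]; apply/hasP; exists (val k).
    by rewrite mem_iota /= add0n.
  by rewrite ltNge.
have rt : r < `|S (tau w) w|.
  have hh : has (fun k => r < `|S k w|) (seq.iota 0 n.+1) by rewrite has_find size_iota.
  by have := nth_find 0%N hh; rewrite nth_iota.
pose D := \sum_(j < n | ~~ (j < tau w)%N) F (w j).
have e1 : \sum_j F (w j) = S (tau w) w + D by rewrite (bigID (fun j : 'I_n => (j < tau w)%N)).
have e2 : \sum_j F (reflect_after w j) = S (tau w) w - D.
  rewrite (bigID (fun j : 'I_n => (j < tau w)%N)) /= -sumrN; congr (_ + _).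
    by apply: eq_bigr => j jt; rewrite ffunE jt.
  by apply: eq_bigr => j jt; rewrite ffunE (negbTE jt) Fiota.
rewrite /f e1 e2; apply: le_trans (sqr_midpoint _ _).
by rewrite ler_pXn2r ?nnegrE// ltW.
Qed.

End doob.

Section counts.
Context {R : realType}.

(** By induction (1 + y)^k (1 - k y) <= 1, and the second factor is at least 1/2 at k = n. *)
Lemma pow_half (n : nat) (y : R) : 0 <= y -> n%:R * y <= 2^-1 -> (1 + y) ^+ n <= 2.
Proof.
move=> y0 ny.
have h k : (k <= n)%N -> (1 + y) ^+ k * (1 - k%:R * y) <= 1.
  elim: k => [|k IH] kn; first by rewrite expr0 mul0r subr0 mulr1.
  apply: le_trans (IH (ltnW kn)); rewrite exprSr -mulrA ler_wpM2l ?exprn_ge0 ?addr_ge0//.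
  rewrite -natr1 -subr_ge0 (_ : _ - _ = (k%:R + 1) * y ^+ 2); last by ring.
  by rewrite mulr_ge0 ?sqr_ge0 ?addr_ge0.
have := h n (leqnn n); set a := (1 + y) ^+ n => h1.
have a0 : 0 <= a by rewrite exprn_ge0// addr_ge0.
have : a * 2^-1 <= a * (1 - n%:R * y) by rewrite ler_wpM2l//; move: ny; lra.
by move=> /le_trans/(_ h1); rewrite ler_pdivrMr// mul1r.
Qed.

Lemma pow_bernoulli (n : nat) (y : R) : 0 <= y -> y <= 1 -> 1 - n%:R * y <= (1 - y) ^+ n.
Proof.
move=> y0 y1; elim: n => [|n IH]; first by rewrite mul0r subr0 expr0.
rewrite exprSr; apply: (@le_trans _ _ ((1 - n%:R * y) * (1 - y))).
  rewrite -natr1 -subr_ge0 (_ : _ - _ = n%:R * y ^+ 2); last by ring.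
  by rewrite mulr_ge0 ?sqr_ge0.
by rewrite ler_wpM2r// subr_ge0.
Qed.

Variables (T : finType) (n : nat) (act : pred T) (t0 : T) (s : nat).
Hypotheses (n1 : (1 <= n)%N) (s1 : (1 <= s)%N).
Hypothesis freq : avg (fun t : T => (act t)%:R) = (4 * s%:R * n%:R)^-1 :> R.

Definition active (a : {ffun 'I_n -> T}) : {pred 'I_n} := [pred j | act (a j)].

(* Markov's inequality for [(1 + 2 s) ^ (number of active steps)]. *)
Lemma active_tail l :
  (2 ^ l * s ^ l.+1)%:R * avg (fun a : {ffun 'I_n -> T} => (l < #|active a|)%N%:R) <= 1 :> R.
Proof.
(* One step multiplies the mean of t^(number of active steps) by 1 + 2s / (4sn) = 1 + 1 / (2n), so
   [n] steps multiply it by at most 2. This 2 is paid for by t^(l+1) >= (2s)^(l+1), which is twice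
   2^l s^(l+1). *)
pose t : R := 1 + 2 * s%:R.
have t1 : 1 <= t by rewrite lerDl mulr_ge0.
have h1 : t ^+ l.+1 * avg (fun a : {ffun 'I_n -> T} => (l < #|active a|)%N%:R) <=
    avg (fun a : {ffun 'I_n -> T} => \prod_(j < n) (if act (a j) then t else 1)).
  rewrite -avgZ; apply: avg_le => a.
  have -> : \prod_(j < n) (if act (a j) then t else 1) = t ^+ #|active a|.
    by rewrite -big_mkcond /= prodr_const.
  case: ltnP => la; rewrite ?mulr1 ?mulr0; first exact: ler_weXn2l.
  by rewrite exprn_ge0// (le_trans _ t1).
rewrite (avg_ffun_prod (fun (_ : 'I_n) a => if act a then t else 1)) in h1.
have h2 : avg (fun a : T => if act a then t else 1) = 1 + (2 * n%:R)^-1.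
  rewrite (eq_avg (g := fun a => 1 + (2 * s%:R) * (act a)%:R)); last first.
    by move=> a; case: ifP; rewrite ?mulr1 ?mulr0 ?addr0.
  rewrite avgD (avg_cst t0) avgZ freq; congr (_ + _).
  by field; rewrite !pnatr_eq0 -!lt0n n1 s1.
rewrite prodr_const card_ord h2 in h1.
have h3 : (1 + (2 * n%:R)^-1) ^+ n <= 2 :> R.
  apply: pow_half; first by rewrite invr_ge0 mulr_ge0.
  by rewrite invfM mulrCA mulfV ?mulr1// pnatr_eq0 -lt0n.
have := le_trans h1 h3; set p := avg _ => h4.
have p0 : 0 <= p by apply: avg_ge0.
rewrite -(ler_pM2l (ltr0n R 2)) mulr1; apply: le_trans h4.
rewrite mulrA ler_wpM2r// natrM !natrX mulrA -exprS -exprMn.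
by rewrite lerXn2r ?nnegrE ?mulr_ge0 ?addr_ge0 ?mulr_ge0// lerDr.
Qed.

End counts.

(** * The sparse random walk attached to a finite family of vectors *)

Section sparse_walk.
Context {R : realType} {B : completeNormedModType R}.
Variables (I : finType) (x : I -> B) (s : nat).
Let n := #|I|.
Hypotheses (n1 : (1 <= n)%N) (s2 : (2 <= s)%N).

(** The predecessor makes the label type ['I_q.+1] inhabited by [ord0], the active label; [qE]
    recovers the number of labels. *)
Let q := (4 * s * n).-1.
Let qE : q.+1 = (4 * s * n)%N.
Proof. by rewrite prednK// !muln_gt0 (ltnW s2) n1. Qed.

Let label := 'I_q.+1.
Let act (a : label) := a == ord0.

Let freq : avg (fun a : label => (act a)%:R) = (4 * s%:R * n%:R)^-1 :> R.
Proof.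
rewrite /avg card_ord (bigD1 ord0)//= big1 ?addr0; last first.
  by move=> a /negbTE a0; rewrite /act a0.
rewrite /act mulr1.
by rewrite qE !natrM.
Qed.

(* Coordinate [i] is active, with probability [1 / (4 s #|I|)], when its label is [0];
   an active coordinate contributes [x i] with a random sign. *)
Definition sparse_step (w : {ffun I -> 'I_((4 * s * #|I|).-1.+1)} * {ffun I -> bool}) : B :=
  \sum_i (if w.1 i == ord0 then sg (w.2 i) *: x i else 0).

Definition sparse_opp (w : {ffun I -> 'I_((4 * s * #|I|).-1.+1)} * {ffun I -> bool}) :
    {ffun I -> 'I_((4 * s * #|I|).-1.+1)} * {ffun I -> bool} :=
  (w.1, [ffun i => ~~ w.2 i]).

Lemma sparse_oppK : involutive sparse_opp.
Proof.
by move=> [a e]; rewrite /sparse_opp /=; congr pair; apply/ffunP => i; rewrite !ffunE negbK.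
Qed.

Lemma sparse_step_opp w : sparse_step (sparse_opp w) = - sparse_step w.
Proof.
rewrite /sparse_step -sumrN; apply: eq_bigr => i _ /=; rewrite ffunE.
by case: ifP => _; rewrite ?oppr0// /sg signrN scaleNr.
Qed.

Let W : finType := ({ffun I -> label} * {ffun I -> bool})%type.

(** Regroups the randomness: the labels of one coordinate over all times become a single variable,
    so the activity counts of different coordinates are independent, while the signs stay indexed by
    time. *)
Let unfold_path (z : {ffun I -> {ffun 'I_n -> label}} * {ffun 'I_n -> {ffun I -> bool}}) :
    {ffun 'I_n -> W} :=
  [ffun j => ([ffun i => z.1 i j], z.2 j)].

Let unfold_path_bij : bijective unfold_path.
Proof.
exists (fun w : {ffun 'I_n -> W} => ([ffun i => [ffun j => (w j).1 i]], [ffun j => (w j).2])).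
  move=> [a e]; rewrite /unfold_path; congr pair.
    by apply/ffunP => i; rewrite ffunE; apply/ffunP => j; rewrite ffunE ffunE /= ffunE.
  by apply/ffunP => j; rewrite !ffunE.
move=> w; apply/ffunP => j; rewrite ffunE /= ffunE.
rewrite [RHS]surjective_pairing; congr pair.
by apply/ffunP => i; rewrite !ffunE.
Qed.

(** Default position past the last activity of a coordinate; the sign read there multiplies the zero
    vector. *)
Let j0 : 'I_n := Ordinal n1.
Let hits (a : {ffun I -> {ffun 'I_n -> label}}) i := enum (active act (a i)).

(* The [l]-th layer collects, for each coordinate, the [l]-th step at which it is active:
   layer [0] is dominated by [rad x] and layer [l > 0] is a thinned Rademacher sum. *)
Let layers (a : {ffun I -> {ffun 'I_n -> label}}) (e : {ffun 'I_n -> {ffun I -> bool}}) :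
  \sum_j sparse_step (unfold_path (a, e) j) =
  \sum_(l < n) \sum_i sg (e (nth j0 (hits a i) l) i) *: (if (l < size (hits a i))%N then x i else 0).
Proof.
rewrite [RHS]exchange_big /=.
under eq_bigr do rewrite /sparse_step ffunE /=.
rewrite exchange_big /=; apply: eq_bigr => i _.
under eq_bigr do rewrite ffunE.
rewrite -big_mkcond /=.
rewrite (eq_bigl (mem (active act (a i)))) // -big_enum /= -/(hits a i).
rewrite (big_nth j0) big_mkord.
have sn : (size (hits a i) <= n)%N by rewrite -cardE -[X in (_ <= X)%N]card_ord max_card.
rewrite (big_ord_widen n (fun l => sg (e (nth j0 (hits a i) l) i) *: x i) sn).
rewrite big_mkcond /=; apply: eq_bigr => l _.
by case: ifP => // _; rewrite scaler0.
Qed.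

Variables (N : nat) (K : R).
Hypotheses (K0 : 0 <= K) (cot : rad_cotype (B := B) N K).
Hypothesis xN : (#|[pred i | x i != 0%R]| <= N)%N.

(** Coordinate [i] belongs to layer [l] when it is active more than [l] times. This happens
    independently over [i] with a probability p, and by [active_tail] p times 2^l s^(l+1) is at most
    1, which is the number of disjoint copies that [rad_thinning] allows. *)
Let layer_energy l :
  (2 ^ l * s ^ l.+1)%:R * avg (fun a : {ffun I -> {ffun 'I_n -> label}} =>
    rad (fun i => if (l < size (hits a i))%N then x i else 0)) <= K * rad x.
Proof.
pose p : R := avg (fun a : {ffun 'I_n -> label} => (l < #|active act a|)%N%:R).
have p0 : 0 <= p by apply: avg_ge0.
have mp : (2 ^ l * s ^ l.+1)%:R * p <= 1.
  apply: (active_tail (ord0 : label)); [exact: n1|exact: ltnW|exact: freq].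
apply: le_trans (rad_thinning K0 cot xN p0 mp); rewrite le_eqVlt; apply/orP; left; apply/eqP.
congr (_ * _).
pose Psi (J : {ffun I -> bool}) := rad (fun i => if J i then x i else 0).
pose u (_ : {ffun 'I_n -> label}) : R := #|{ffun 'I_n -> label}|%:R^-1.
transitivity (\sum_(a : {ffun I -> {ffun 'I_n -> label}}) (\prod_i u (a i)) *
    Psi [ffun i => (l < #|active act (a i)|)%N]).
  rewrite /avg mulr_sumr; apply: eq_bigr => a _; congr (_ * _).
    by rewrite prodr_const card_ffun natrX exprVn.
  by apply: eq_rad => i; rewrite ffunE /hits -cardE.
rewrite (weighted_pushforward u (fun b => (l < #|active act b|)%N)).
apply: eq_bigr => J _; congr (_ * _); apply: eq_bigr => i _.
have pE : \sum_(b | (l < #|active act b|)%N == true) u b = p.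
  rewrite /p /avg mulr_sumr big_mkcond /=; apply: eq_bigr => b _.
  by case: ltnP => _; rewrite ?mulr1 ?mulr0.
case: (J i) => //; apply/esym/eqP; rewrite subr_eq -pE.
have tot : \sum_b u b = 1.
  rewrite sumr_const -[_ *+ _]mulr_natl mulfV// pnatr_eq0 -lt0n.
  by apply/card_gt0P; exists [ffun=> ord0].
rewrite -[X in X == _]tot (bigID (fun b => (l < #|active act b|)%N == true)) /= addrC.
by apply/eqP; congr (_ + _); apply: eq_bigl => b; case: (_ < _)%N.
Qed.

Lemma sparse_walk_upper :
  avg (fun w : {ffun 'I_#|I| -> {ffun I -> 'I_((4 * s * #|I|).-1.+1)} * {ffun I -> bool}} =>
    `|\sum_j sparse_step (w j)| ^+ 2) <= (2 + 4 * K / s%:R ^+ 2) * rad x.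
Proof.
rewrite -(avg_bij _ unfold_path_bij) avg_pair.
pose E l := avg (fun a : {ffun I -> {ffun 'I_n -> label}} =>
    rad (fun i => if (l < size (hits a i))%N then x i else 0)).
apply: (@le_trans _ _ (\sum_(l < n) 2 ^+ l.+1 * E l)).
  rewrite (eq_bigr (fun l : 'I_n => avg (fun a : {ffun I -> {ffun 'I_n -> label}} => 2 ^+ l.+1 *
    rad (fun i => if (l < size (hits a i))%N then x i else 0)))); last first.
    by move=> l _; rewrite avgZ.
  rewrite -avg_sum; apply: avg_le => a.
  apply: (@le_trans _ _ (avg (fun e : {ffun 'I_n -> {ffun I -> bool}} =>
    \sum_(l < n) 2 ^+ l.+1 * `|\sum_i sg (e (nth j0 (hits a i) l) i) *:
      (if (l < size (hits a i))%N then x i else 0)| ^+ 2))).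
    apply: avg_le => e; rewrite layers.
    exact: (sqr_norm_sum (fun l => \sum_i sg (e (nth j0 (hits a i) l) i) *:
      (if (l < size (hits a i))%N then x i else 0))).
  rewrite avg_sum; apply: ler_sum => l _; rewrite avgZ.
  by rewrite (rad_marginal (fun i => nth j0 (hits a i) l)).
(* Layer 0 is bounded by contraction instead of [cot], which keeps [K] out of the leading
   coefficient 2. *)
have E0 : E 0%N <= rad x.
  rewrite -[leRHS](avg_cst ([ffun=> [ffun=> ord0]] : {ffun I -> {ffun 'I_n -> label}})).
  by apply: avg_le => a; exact: rad_restrict.
have sR : (0 : R) < s%:R by rewrite ltr0n (ltnW s2).
(* Layer l + 1 costs 2^(l+2) K / (2^(l+1) s^(l+2)) = 2 K / s^(l+2), and s >= 2 turns the surplus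
   s^-l into a summable 2^-l. *)
have El l : 2 ^+ l.+2 * E l.+1 <= 2 * (K / s%:R ^+ 2 * rad x) * 2^-1 ^+ l.
  have h1 := layer_energy l.+1; rewrite -/(E l.+1) natrM !natrX in h1.
  have c0 : (0 : R) < s%:R ^+ l.+2 by rewrite exprn_gt0.
  have h2 : 2 ^+ l.+1 * E l.+1 <= K * rad x / s%:R ^+ l.+2.
    by rewrite ler_pdivlMr// mulrAC.
  rewrite exprS -mulrA -[leRHS]mulrA ler_wpM2l//; apply: (le_trans h2).
  rewrite (_ : K / _ * _ * _ = K * rad x * (s%:R ^- 2 * 2^-1 ^+ l)); last by ring.
  apply: ler_wpM2l; first by rewrite mulr_ge0 ?rad_ge0.
  rewrite -addn2 addnC exprD invfM ler_wpM2l ?invr_ge0 ?sqr_ge0// -exprVn.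
  by rewrite lerXn2r ?nnegrE ?invr_ge0// lef_pV2 ?posrE// ler_nat.
have := n1; case: (n) E0 El => // n' E0 El _.
rewrite big_ord_recl /= expr1 [leRHS]mulrDl; apply: lerD; first by rewrite ler_wpM2l.
apply: (le_trans (ler_sum _ (fun (l : 'I_n') _ => El l))).
rewrite -mulr_sumr.
have geo : \sum_(i < n') 2^-1 ^+ i <= 2 :> R.
  suff -> : \sum_(k < n') 2^-1 ^+ k = 2 - 2 * 2^-1 ^+ n' :> R.
    by rewrite lerBlDr lerDl mulr_ge0// exprn_ge0.
  elim: (n') => [|k IH]; first by rewrite big_ord0 expr0 mulr1 subrr.
  by rewrite big_ord_recr /= IH exprS; field.
apply: (le_trans (ler_wpM2l _ geo)).
  apply: mulr_ge0 => //; apply: mulr_ge0; last exact: rad_ge0.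
  by apply: divr_ge0 => //; exact: sqr_ge0.
rewrite le_eqVlt; apply/orP; left; apply/eqP; ring.
Qed.

(** When [i] alone is active, the step is a signed copy of [x i], which survives truncation at [r].
    These events are disjoint and each has probability at least y (1 - n y) >= y / 2 with y = 1 / (4
    s n). *)
Lemma sparse_energy (r : R) : 0 < r -> (forall i, `|x i| <= r) ->
  (8 * s%:R * n%:R * r ^+ 2)^-1 * \sum_i `|x i| ^+ 2 <= trunc_energy sparse_step r.
Proof.
move=> r0 xr; have r2 : 0 < r ^+ 2 by rewrite exprn_gt0.
pose only i (w : W) : R := \prod_k (if k == i then act (w.1 k) else ~~ act (w.1 k))%:R.
have onlyP i w : only i w = (act (w.1 i) && [forall k, (k != i) ==> ~~ act (w.1 k)])%:R.
  case: (boolP (_ && _)) => [/andP[ai /forallP h]|].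
    rewrite /only big1// => k _; case: eqP => [->|/eqP ki]; first by rewrite ai.
    by have := h k; rewrite ki => /= ->.
  rewrite negb_and => /orP[ai|].
    by rewrite /only (bigD1 i)//= eqxx (negbTE ai) mul0r.
  rewrite negb_forall => /existsP[k]; rewrite negb_imply negbK => /andP[ki ak].
  by rewrite /only (bigD1 k)//= (negbTE ki) ak mul0r.
have sR : (0 : R) < s%:R by rewrite ltr0n (ltnW s2).
have nR : (0 : R) < n%:R by rewrite ltr0n.
pose y : R := (4 * s%:R * n%:R)^-1.
have y0 : 0 < y by rewrite invr_gt0 !mulr_gt0.
have ny : n%:R * y <= 2^-1.
  rewrite (_ : _ * y = 4^-1 * s%:R^-1); last by rewrite /y; field; rewrite !gt_eqF.
  have : s%:R^-1 <= 2^-1 :> R by rewrite lef_pV2 ?posrE// ler_nat.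
  have : (0 : R) <= s%:R^-1 by rewrite invr_ge0 ltW.
  lra.
have y1 : y <= 1.
  apply: (@le_trans _ _ (n%:R * y)); last by move: ny; lra.
  by rewrite ler_peMl ?(ltW y0)// ler1n.
have only_avg i : y / 2 <= avg (only i).
  rewrite (_ : avg (only i) = avg (fun a : {ffun I -> label} =>
     \prod_k (if k == i then act (a k) else ~~ act (a k))%:R)); last first.
    rewrite avg_pair; apply: eq_avg => a.
    rewrite -[RHS](avg_cst ([ffun=> false] : {ffun I -> bool})).
    exact: eq_avg.
  rewrite (avg_ffun_prod (fun k a => (if k == i then act a else ~~ act a)%:R)).
  have hneg : avg (fun a : label => (~~ act a)%:R) = 1 - y :> R.
    rewrite (eq_avg (g := fun a => 1 + (-1) * (act a)%:R)); last first.
      by move=> a; case: (act a); rewrite ?mulr1 ?mulr0 ?addr0 ?subrr.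
    by rewrite avgD (avg_cst (ord0 : label)) avgZ freq mulN1r.
  rewrite (bigD1 i)//= (eq_avg (g := fun a => (act a)%:R)); last by move=> a; rewrite eqxx.
  rewrite freq -/y ler_wpM2l ?(ltW y0)//.
  rewrite (eq_bigr (fun=> 1 - y)); last first.
    by move=> k /negbTE ki; rewrite -hneg; apply: eq_avg => a; rewrite ki.
  rewrite prodr_const; set m := #|_|.
  apply: le_trans (pow_bernoulli m (ltW y0) y1).
  have mn : m%:R * y <= n%:R * y by rewrite ler_wpM2r ?(ltW y0)// ler_nat max_card.
  move: mn ny; lra.
apply: (@le_trans _ _ (avg (fun w : W => \sum_i r ^- 2 * `|x i| ^+ 2 * only i w))).
  rewrite avg_sum mulr_sumr; apply: ler_sum => i _; rewrite avgZ.
  apply: (@le_trans _ _ (r ^- 2 * `|x i| ^+ 2 * (y / 2))).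
    rewrite le_eqVlt; apply/orP; left; apply/eqP; rewrite /y.
    by field; rewrite !gt_eqF.
  by rewrite ler_wpM2l// mulr_ge0 ?sqr_ge0// invr_ge0 ltW.
apply: avg_le => w.
have nonneg : 0 <= (if `|sparse_step w| <= r then r ^- 2 * `|sparse_step w| ^+ 2 else 1).
  by case: ifP => // _; rewrite mulr_ge0 ?sqr_ge0// invr_ge0 ltW.
have [i oi|no] := pickP (fun i => act (w.1 i) && [forall k, (k != i) ==> ~~ act (w.1 k)]); last first.
  by rewrite big1// => i _; rewrite onlyP no mulr0.
have /andP[ai /forallP hi] := oi.
have wE : sparse_step w = sg (w.2 i) *: x i.
  rewrite /sparse_step (bigD1 i)//= [w.1 i == _]ai big1 ?addr0// => k ki.
  by have := hi k; rewrite ki /= /act => /negbTE ->.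
rewrite wE sg_norm xr (bigD1 i)//= onlyP oi mulr1 big1 ?addr0// => k ki.
rewrite onlyP (_ : _ && _ = false) ?mulr0//.
by apply/negbTE; rewrite negb_and; have := hi k; rewrite ki => /= ->.
Qed.

End sparse_walk.

(** * Improving the Rademacher cotype constant *)

Section iteration.
Context {R : realType} {B : completeNormedModType R}.
Variables (c : R) (s : nat).
Hypotheses (hc : tail_exit_constant B c) (s2 : (2 <= s)%N) (sc : 256 * c <= s%:R).

(** The value of [r] turns [sparse_energy] into [trunc_energy] >= 2 c / n with n = #|I|, so the tail
    bound at time n leaves confinement probability at most 1/2. Positive energy also gives a nonzero
    step, which differs from its opposite and so makes the walk nondegenerate. *)
Lemma sparse_exit_bound (I : finType) (x : I -> B) (r : R) :
  0 < r -> (forall i, `|x i| <= r) -> 16 * s%:R * c * r ^+ 2 = \sum_i `|x i| ^+ 2 ->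
  r ^+ 2 / 2 <= avg (fun w : {ffun 'I_#|I| -> {ffun I -> 'I_((4 * s * #|I|).-1.+1)} * {ffun I -> bool}} =>
    `|\sum_j sparse_step x (w j)| ^+ 2).
Proof.
move=> r0 xr Vr; have [c0 _] := hc.
have sR : (0 : R) < s%:R by rewrite ltr0n (ltnW s2).
have V0 : 0 < \sum_i `|x i| ^+ 2 by rewrite -Vr !mulr_gt0// exprn_gt0.
have n1 : (1 <= #|I|)%N.
  rewrite lt0n; apply/eqP => /fintype0 I0.
  by move: V0; rewrite big1 ?ltxx// => i; have := I0 i.
have nR : (0 : R) < #|I|%:R by rewrite ltr0n.
have := sparse_energy n1 s2 r0 xr; rewrite -Vr.
rewrite (_ : _^-1 * _ = 2 * c / #|I|%:R); last first.
  by field; rewrite !gt_eqF//.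
set F := sparse_step x (s := s) => cE.
have E0 : 0 < trunc_energy F r by apply: lt_le_trans cE; rewrite divr_gt0// mulr_gt0.
have [a Fa] : exists a, F a != 0.
  apply: contrapT => no; move: E0; rewrite /trunc_energy /avg big1 ?mulr0 ?ltxx// => a _.
  have -> : F a = 0 by apply/eqP/negPn/negP => h; apply: no; exists a.
  by rewrite normr0 (ltW r0) expr0n mulr0.
have ab : F a != F (sparse_opp a).
  rewrite /F sparse_step_opp -/F -subr_eq0 opprK -mulr2n -scaler_nat scaler_eq0 negb_or Fa.
  by rewrite pnatr_eq0.
have h1 := confined_bound a hc ab r0 n1 E0.
have {}h1 : avg (fun w : {ffun 'I_#|I| -> _} => (confined F r w)%:R) <= 2^-1 :> R.
  apply: (le_trans h1); rewrite ler_pdivrMr; last exact: (mulr_gt0 nR E0).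
  by move: cE; rewrite ler_pdivrMr// [_ * #|I|%:R]mulrC; move: (_ * trunc_energy _ _) => u; lra.
have := reflection_bound (sparse_oppK (I := I) (s := s)) (sparse_step_opp x (s := s)) #|I| (ltW r0) a.
apply: le_trans; rewrite ler_pM2l ?exprn_gt0//; move: h1; move: (avg _) => u; lra.
Qed.

Lemma rad_cotype_step N (K : R) : 0 <= K -> rad_cotype (B := B) N K ->
  rad_cotype (B := B) N (64 * s%:R * c + K / 2).
Proof.
move=> K0 cot I x xN; have [c0 _] := hc.
have sR : (0 : R) < s%:R by rewrite ltr0n (ltnW s2).
have rad0 := rad_ge0 x.
set V := \sum_i _; have : 0 <= V by apply: sumr_ge0 => i _; exact: sqr_ge0.
rewrite le_eqVlt => /orP[/eqP <-|V0].
  by rewrite mulr_ge0// addr_ge0// ?divr_ge0// !mulr_ge0// ltW.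
have d0 : 0 < 16 * s%:R * c by rewrite !mulr_gt0.
pose r : R := Num.sqrt (V / (16 * s%:R * c)).
have r0 : 0 < r by rewrite sqrtr_gt0 divr_gt0.
have Vr : 16 * s%:R * c * r ^+ 2 = V.
  by rewrite sqr_sqrtr ?divr_ge0 ?(ltW V0) ?(ltW d0)// mulrC divfK// gt_eqF.
(* A single vector longer than [r] settles the matter without any walk: r^2 <= |x i|^2 <= rad x,
   hence V <= 16 s c rad x. *)
have [i xi|small] := pickP (fun i => r < `|x i|).
  have h1 : r ^+ 2 <= rad x.
    apply: le_trans (rad_single i x); rewrite ler_pXn2r ?nnegrE ?(ltW r0)//.
    exact: ltW.
  rewrite -Vr; apply: (@le_trans _ _ (16 * s%:R * c * rad x)).
    by rewrite ler_wpM2l// ltW.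
  rewrite ler_wpM2r//; have := divr_ge0 K0 (ler0n R 2).
  by move: d0; rewrite -!mulrA; move: (_ * c) (K / 2) => u v; lra.
have xr i : `|x i| <= r by rewrite leNgt small.
have n1 : (1 <= #|I|)%N.
  rewrite lt0n; apply/eqP => /fintype0 I0.
  by move: V0; rewrite /V big1 ?ltxx// => i; have := I0 i.
have h1 := le_trans (sparse_exit_bound r0 xr Vr) (sparse_walk_upper n1 s2 K0 cot xN).
have h2 : V <= 32 * s%:R * c * ((2 + 4 * K / s%:R ^+ 2) * rad x).
  rewrite -Vr (_ : 16 * s%:R * c * r ^+ 2 = 32 * s%:R * c * (r ^+ 2 / 2)); last by field.
  by rewrite ler_wpM2l// !mulr_ge0// ltW.
apply: (le_trans h2); rewrite mulrA ler_wpM2r//.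
(* Here 32 s c meets 4 K / s^2; one power of s remains in the denominator, and s >= 256 c makes the
   new factor of K at most 1/2. *)
rewrite (_ : _ * _ = 64 * s%:R * c + K * (128 * c / s%:R)); last first.
  by field; rewrite gt_eqF.
rewrite lerD2l ler_wpM2l// ler_pdivrMr//; move: sc; lra.
Qed.

(** The map K -> a + K / 2 with a = 64 s c has fixed point 2 a = 128 s c. Started from a constant
    for [N] vectors it leaves an excess of N 2^-k after k rounds, which tends to 0 for each fixed
    family. *)
Lemma rad_cotype_all N : rad_cotype (B := B) N (128 * s%:R * c).
Proof.
have [c0 _] := hc; set a := 64 * s%:R * c.
have a0 : 0 <= a by rewrite !mulr_ge0// ltW.
have step k : rad_cotype (B := B) N (2 * a + N%:R * 2^-1 ^+ k).
  elim: k => [|k IH] I x xN.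
    apply: (le_trans (rad_cotype_base xN)).
    by rewrite ler_wpM2r ?rad_ge0// expr0 mulr1 lerDr mulr_ge0.
  have K0 : 0 <= 2 * a + N%:R * 2^-1 ^+ k.
    by apply: addr_ge0; apply: mulr_ge0 => //; rewrite exprn_ge0.
  apply: (le_trans (rad_cotype_step K0 IH xN)); rewrite ler_wpM2r ?rad_ge0// -/a.
  by rewrite le_eqVlt; apply/orP; left; apply/eqP; rewrite exprS; field.
move=> I x xN; rewrite (_ : 128 * _ * _ = 2 * a); last by rewrite /a; ring.
apply/ler_addgt0Pr => e e0.
pose t := N%:R * rad x.
have t0 : 0 <= t by rewrite mulr_ge0 ?rad_ge0.
have te0 : 0 <= t / e by rewrite divr_ge0// ltW.
pose k := (Num.truncn (t / e)).+1.
have hk : t / e <= 2 ^+ k.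
  apply: (@le_trans _ _ k%:R); first by rewrite ltW// truncnS_gt.
  by rewrite -natrX ler_nat ltnW// ltn_expl.
apply: (le_trans (step k _ _ xN)); rewrite mulrDl lerD2l mulrAC -/t.
by rewrite exprVn ler_pdivrMr ?exprn_gt0// mulrC -ler_pdivrMr.
Qed.

End iteration.

(** * From Rademacher cotype to cotype 2 *)

Section centered_summand.
Context {R : realType} {B : completeNormedModType R}.
Hypothesis sepB : separable B.
Context d (T : measurableType d) (P : probability T R).

(** Independence makes the joint law the product of the marginal laws, by uniqueness of product
    measures; Tonelli's theorem then integrates the bound obtained with the value of [Y] frozen. *)
Lemma ex_independent_pair (Y Z : T -> B) (g : borel B * borel B -> R) (f : T -> R) :
  random_variable Y -> random_variable Z ->
  (forall A A' : set (borel B), measurable A -> measurable A' ->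
    P (Y @^-1` A `&` Z @^-1` A') = (P (Y @^-1` A) * P (Z @^-1` A'))%E) ->
  measurable_fun setT g -> (forall p, 0 <= g p) ->
  measurable_fun setT f -> (forall w, 0 <= f w) ->
  (forall w, ((f w)%:E <= \int[P]_w' (g (Y w, Z w'))%:E)%E) ->
  (\int[P]_w (f w)%:E <= \int[P]_w (g (Y w, Z w))%:E)%E.
Proof.
move=> mY mZ ind mg g0 mf f0 fg.
pose fY : {mfun T >-> borel B} := mfun_Sub (mem_set (mY : measurable_fun setT (Y : T -> borel B))).
pose fZ : {mfun T >-> borel B} := mfun_Sub (mem_set (mZ : measurable_fun setT (Z : T -> borel B))).
pose PY : probability (borel B) R := distribution P fY.
pose PZ : probability (borel B) R := distribution P fZ.
have mYZ : measurable_fun setT ((fun w => (Y w, Z w)) : T -> borel B * borel B).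
  exact: (measurable_fun_pair (f := (Y : T -> borel B)) (g := (Z : T -> borel B))).
pose fYZ : {mfun T >-> (borel B * borel B)%type} := mfun_Sub (mem_set mYZ).
have mge : measurable_fun setT (EFin \o g) by exact/measurable_EFinP.
have g0e p : (0 <= (EFin \o g) p)%E by rewrite lee_fin.
have -> : (\int[P]_w (g (Y w, Z w))%:E = \int[PY \x PZ]_p (g p)%:E)%E.
  rewrite [RHS](@eq_measure_integral _ _ _ _ (distribution P fYZ)).
    exact/esym/(ge0_integral_distribution fYZ mge g0e).
  move=> A mA _; exact: product_measure_unique.
have mF := measurable_fun_fubini_tonelli_F (m2 := PZ) _ mge g0e.
rewrite (fubini_tonelli1 (m1 := PY) (m2 := PZ) _ mge g0e) (ge0_integral_distribution fY)//; last first.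
  by move=> y; apply: integral_ge0.
apply: ge0_le_integral => //.
- by move=> w _; rewrite lee_fin.
- exact/measurable_EFinP.
- exact: (measurableT_comp mF).
move=> w _; apply: (le_trans (fg w)).
rewrite /= /fubini_F (ge0_integral_distribution fZ)//.
exact: measurableT_comp.
Qed.

Lemma ex_centered_summand (Y Z : T -> B) :
  random_variable Y -> has_expectation P Z 0 ->
  (forall A A' : set (borel B), measurable A -> measurable A' ->
    P (Y @^-1` A `&` Z @^-1` A') = (P (Y @^-1` A) * P (Z @^-1` A'))%E) ->
  (\int[P]_w (`|Y w| ^+ 2)%:E <= \int[P]_w (`|Y w + Z w| ^+ 2)%:E)%E.
Proof.
move=> mY hZ ind; have mZ : random_variable Z by case: hZ.
have mfst : random_variable (fst : borel B * borel B -> B) by exact: measurable_fst.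
have msnd : random_variable (snd : borel B * borel B -> B) by exact: measurable_snd.
apply: (ex_independent_pair (g := fun p : borel B * borel B => `|(p.1 : B) + p.2| ^+ 2)) => //.
- exact/rv_normX/rv_add.
- exact: rv_normX.
move=> w; apply: (ex_sqr_tangent (f := fun w' => `|Y w + Z w'|)) => //.
  by apply: rv_norm; apply: rv_add => //; exact: rv_cst.
have := has_expectation_norm sepB (has_expectationD sepB (has_expectation_cst P (Y w)) hZ).
by rewrite addr0.
Qed.

Section independent_family.
Variables (I : finType) (X : I -> T -> B).
Hypotheses (indX : mutually_independent P X) (EX : forall i, has_expectation P (X i) 0).

Let mX i : random_variable (X i). Proof. by case: (EX i). Qed.

Lemma ex_subsum_le (Q : pred I) :
  (\int[P]_w (`|\sum_(i | Q i) X i w| ^+ 2)%:E <= \int[P]_w (`|\sum_i X i w| ^+ 2)%:E)%E.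
Proof.
rewrite (_ : (\int[P]_w (`|\sum_i X i w| ^+ 2)%:E)%E = (\int[P]_w
    (`|\sum_(i | Q i) X i w + \sum_(i | ~~ Q i) X i w| ^+ 2)%:E)%E); last first.
  by apply: eq_integral => w _; rewrite (bigID Q).
apply: (ex_centered_summand (Y := fun w => \sum_(i | Q i) X i w)
  (Z := fun w => \sum_(i | ~~ Q i) X i w)).
- exact: rv_sum.
- have := has_expectation_sum sepB (index_enum I) (fun i => ~~ Q i) EX.
  by rewrite big1.
move=> A A' mA mA'.
have m (Q' : pred I) (C : set (borel B)) : measurable C ->
    measurable ([set p | C (\sum_(i | Q' i) p i)] : set (path [set i | Q' i])).
  move=> mC; apply: (rv_preimage (X := fun p : path [set i | Q' i] => \sum_(i | Q' i) p i)) => //.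
  by apply: rv_sum => // i Qi; exact: rv_coord.
apply: (path_independent mX indX _ (m Q A mA) (m (predC Q) A' mA')).
by apply/seteqP; split => // i [/= ->].
Qed.

(** The signs split the sum into a difference of two partial sums. Each has second moment at most
    that of the full sum, and the square of the difference costs 2 + 2 = 4. *)
Lemma ex_signed_sum_le (e : I -> bool) :
  (\int[P]_w (`|\sum_i (sg (e i) : R) *: X i w| ^+ 2)%:E <=
   4%:E * \int[P]_w (`|\sum_i X i w| ^+ 2)%:E)%E.
Proof.
pose S (Q : pred I) w : B := \sum_(i | Q i) X i w.
have mS Q : random_variable (S Q) by exact: rv_sum.
have mS2 Q : measurable_fun setT (fun w => 2 * `|S Q w| ^+ 2).
  by apply: measurable_funM => //; exact: rv_normX.
apply: (@le_trans _ _ (\int[P]_w (2 * `|S (fun i => ~~ e i) w| ^+ 2 + 2 * `|S e w| ^+ 2)%:E)%E).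
  apply: ex_le => //.
  - by apply: rv_normX; apply: rv_sum => // i _; exact: rv_scale.
  - exact: measurable_funD.
  move=> w; rewrite -(normrN (S e w)); apply: le_trans (sqr_normD _ _).
  rewrite (bigID e) /= addrC le_eqVlt; apply/orP; left; apply/eqP; congr (`|_ + _| ^+ 2).
    by apply: eq_bigr => i /negbTE ->; rewrite /sg expr0 scale1r.
  by rewrite /S -sumrN; apply: eq_bigr => i ->; rewrite /sg expr1 scaleN1r.
rewrite exD//; try by move=> w; rewrite mulr_ge0.
have h Q : (\int[P]_w (2 * `|S Q w| ^+ 2)%:E <= 2%:E * \int[P]_w (`|\sum_i X i w| ^+ 2)%:E)%E.
  rewrite exZ//; last by exact: rv_normX.
  by apply: lee_wpmul2l => //; exact: ex_subsum_le.
apply: (le_trans (leeD (h _) (h _))).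
rewrite -ge0_muleDl// ?lee_fin//.
by rewrite -EFinD -natrD.
Qed.

Lemma ex_rad_le (t : R) : (\int[P]_w (`|\sum_i X i w| ^+ 2)%:E = t%:E)%E ->
  (\int[P]_w (rad (X^~ w))%:E <= (4 * t)%:E)%E.
Proof.
move=> St; have mf (e : {ffun I -> bool}) :
    measurable_fun setT (fun w => `|\sum_i (sg (e i) : R) *: X i w| ^+ 2).
  by apply: rv_normX; apply: rv_sum => // i _; exact: rv_scale.
rewrite exZ ?invr_ge0//; last 2 first.
- exact: measurable_sum.
- by move=> w; apply: sumr_ge0 => e _; exact: sqr_ge0.
rewrite ex_sum//.
apply: (@le_trans _ _ (#|{ffun I -> bool}|%:R^-1%:E * \sum_(e : {ffun I -> bool}) (4 * t)%:E)%E).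
  apply: lee_wpmul2l; first by rewrite lee_fin invr_ge0.
  by apply: lee_sum => e _; rewrite EFinM -St; exact: ex_signed_sum_le.
by rewrite sumEFin -EFinM lee_fin [leLHS](avg_cst [ffun=> false]).
Qed.

End independent_family.
End centered_summand.

Lemma rad_cotype_cotype2 (R : realType) (B : completeNormedModType R) (K : R) :
  separable B -> 0 < K -> (forall N, rad_cotype (B := B) N K) ->
  cotype2_constant B (4 * K)^-1.
Proof.
move=> sepB K0 cot; split; first by rewrite invr_gt0 mulr_gt0.
move=> n d T P X n1 mX indX EX _.
have : (0 <= \int[P]_w (`|\sum_(i < n) X i w| ^+ 2)%:E)%E by apply: ex_ge0.
case ES : (\int[P]_w _)%E => [t| |] // _; last by rewrite leey.
have h : (\sum_(i < n) \int[P]_w (`|X i w| ^+ 2)%:E <= (K * (4 * t))%:E)%E.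
  rewrite -ex_sum//; last by move=> i; exact: rv_normX.
  apply: (@le_trans _ _ (\int[P]_w (K * rad (X^~ w))%:E)%E).
    apply: ex_le.
    - by apply: measurable_sum => i; exact: rv_normX.
    - apply: measurable_funM => //; apply: measurable_funM => //; apply: measurable_sum => e.
      by apply: rv_normX; apply: (rv_sum sepB) => i _; exact: rv_scale.
    - by move=> w; apply: sumr_ge0.
    (* Cotype is applied to the vectors [X i w] for each [w] separately; the number of nonzero ones
       varies with [w], so a constant valid for every [N] is used here. *)
    - by move=> w; exact: (cot #|[pred i | X i w != 0]|).
  rewrite exZ//; last 3 first.
  - apply: measurable_funM => //; apply: measurable_sum => e.
    by apply: rv_normX; apply: (rv_sum sepB) => i _; exact: rv_scale.
  - exact: ltW.
  - by move=> w; exact: rad_ge0.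
  rewrite EFinM; apply: lee_wpmul2l; first by rewrite lee_fin ltW.
  exact: ex_rad_le.
apply: (le_trans (lee_wpmul2l _ h)); first by rewrite lee_fin invr_ge0 mulr_ge0// ltW.
by rewrite -EFinM lee_fin (_ : _^-1 * _ = t)//; field; rewrite gt_eqF.
Qed.

(** Inverse of 4 times the Rademacher constant 128 s c. The integer s is the integer part of 256 c
    plus 2, which secures both s >= 256 c and s >= 2. *)
Definition cotype_of_tail_exit (R : realType) (c : R) : R :=
  (512 * (Num.truncn (256 * c)).+2%:R * c)^-1.

Lemma tail_exit_cotype (R : realType) (B : completeNormedModType R) (c : R) :
  separable B -> tail_exit_constant B c -> cotype2_constant B (cotype_of_tail_exit c).
Proof.
move=> sepB hc; have [c0 _] := hc; set s := (Num.truncn (256 * c)).+2.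
have sc : 256 * c <= s%:R.
  by apply: ltW; apply: (lt_trans (truncnS_gt _)); rewrite ltr_nat.
rewrite /cotype_of_tail_exit -/s (_ : 512 * _ * c = 4 * (128 * s%:R * c)); last by ring.
apply: rad_cotype_cotype2 => //; first by rewrite !mulr_gt0.
by move=> N; exact: rad_cotype_all.
Qed.

Theorem theorem1p2 (R : realType) :
  (forall B : completeNormedModType R, separable B ->
     (cotype2 B <-> exists c : R, mean_exit_constant B c) /\
     ((exists c : R, mean_exit_constant B c) <->
      exists c : R, tail_exit_constant B c)) /\
  [/\ constants_determine_each_other
        (@cotype2_constant R) (@mean_exit_constant R),
      constants_determine_each_other
        (@mean_exit_constant R) (@tail_exit_constant R)
    & constants_determine_each_other
        (@cotype2_constant R) (@tail_exit_constant R)].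
Proof.
have cm : constant_determines (@cotype2_constant R) (@mean_exit_constant R).
  by exists (@mean_exit_of_cotype R) => B c sepB; exact: cotype_mean_exit.
have mt : constant_determines (@mean_exit_constant R) (@tail_exit_constant R).
  by exists id => B c sepB; exact: mean_exit_tail_exit.
have tc : constant_determines (@tail_exit_constant R) (@cotype2_constant R).
  by exists (@cotype_of_tail_exit R) => B c sepB; exact: tail_exit_cotype.
have trans (S1 S2 S3 : completeNormedModType R -> R -> Prop) :
    constant_determines S1 S2 -> constant_determines S2 S3 -> constant_determines S1 S3.
  move=> [f hf] [g hg]; exists (g \o f) => B c sepB h1.
  exact/(hg _ _ sepB)/(hf _ _ sepB).
have ex (S1 S2 : completeNormedModType R -> R -> Prop) (B : completeNormedModType R) :
    separable B ->
    constant_determines S1 S2 -> (exists c, S1 B c) -> exists c, S2 B c.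
  by move=> sepB [f hf] [c hc]; exists (f c); exact: hf.
have mc := trans _ _ _ mt tc; have tm := trans _ _ _ tc cm; have ct := trans _ _ _ cm mt.
split; last by split; split.
by move=> B sepB; split; split; exact: ex.
Qed.
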